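(* Let $m=(m_0,m_1,m_2)\in\mathbb{R}^3$ with all $m_j\ne0$, $m_2\ne\pm1$ and $q_5:=m_1(m_0^2-1)-2m_0\neq0$. Let the mechanism, its initial configuration, the numbers $q,q_0,q_1,q_4$ and the set $X$ of solutions $(a,b,c)\in(\mathbb{R}^4)^3$ of the constraint equations lying in the prime components selected by the initial configuration be as in the context. Let $V\subset\mathbb{R}^4$ (Bennett's variety) be the set of $(a_0,a_2,c_0,c_2)$ with $$a_0^2+\frac{(m_0^2+1)^2}{q_5^2}a_2^2=\frac{1}{m_1^2+1},\qquad m_2^2c_0^2+m_1^2c_2^2=\frac{m_1^2m_2^2}{m_1^2+m_2^2},\qquad m_1(m_0^2+1)c_2a_2+q_5c_0a_0=0 .$$ Consider the eight formulas $$a_1=m_1a_0,\quad a_3=\frac{m_0^2+2m_0m_1-1}{q_5}a_2,\quad c_1=\frac{m_2}{m_1}c_0,\quad c_3=\frac{m_1}{m_2}c_2,$$ $$b_0=t_0a_0c_0,\quad b_1=t_1a_0c_0,\quad b_2=t_2a_0c_2+t_3a_2c_0,\quad b_3=t_4a_0c_2+t_5a_2c_0,$$ where $$t_0=\frac{(m_2^2-1)q_0}{m_1m_2q},\quad t_1=\frac{(m_2^2-1)q_1}{m_1m_2q},\quad t_2=\frac{m_1(m_2-1)(q_4^2-4m_0^2)+4m_0q_4(m_1^2+m_2)}{m_2(m_0^2+1)q},$$ $$t_3=\frac{m_1(m_2-1)(m_0^2-1)-2m_0(m_2+m_1^2)}{m_1q_5},\quad t_4=\frac{(m_1^2+m_2)(q_4^2-4m_0^2)-4m_0m_1(m_2-1)q_4}{m_2(m_0^2+1)q},$$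 $$t_5=\frac{(m_2+m_1^2)(m_0^2-1)+2m_0m_1(m_2-1)}{m_1q_5}.$$ Let $h$ be the polynomial map sending $(a_0,a_2,c_0,c_2)\in V$ to the point $(a,b,c)$ given by these formulas, let $\pi(a,b,c)=(a_0,a_2,c_0,c_2)$, and let $Y$ be the set of points of $X$ satisfying all eight formulas. (i) $h$ maps $V$ into $Y$ (in particular every $h(v)$, $v\in V$, satisfies all the constraint equations), $\pi$ maps $Y$ into $V$, and $\pi\circ h=\mathrm{id}_V$, $h\circ\pi=\mathrm{id}_Y$. Thus $a_0,a_2,c_0,c_2$ can be chosen as essential variables: all other variables are polynomial functions of them on $Y$, and the number of variables eliminated in this way is as big as possible. (ii) $Y$ describes all of $X$ up to the signs of the Euler parameters, which do not affect the orientations $R(a),R(b),R(c)$. More precisely: every point of $X$ satisfies either $(b_0,b_1)=(t_0a_0c_0,t_1a_0c_0)$ or $(b_0,b_1)=-(t_0a_0c_0,t_1a_0c_0)$, and the two cases differ only by the sign of $b$. Let $X_+$ be the set of points of $X$ satisfying the first alternative. Then $X_+=Y\cup\{(a,b,c)\in X_+: a_0=0\}\cup\{(a,b,c)\in X_+: c_0=0\}$. Each of the last two sets consists of 8 points, which differ only by the choice of signs in $\pm a,\pm b,\pm c$ and hence represent one physical configuration; four of the 8 points lie in $Y$. (iii) $V$ is regular (has no singular points), and has two real components, which both represent the same physical situation. One component is parametrized by $t\in\mathbb{R}$ as $$a_0=\frac{\cos t}{\sqrt{m_1^2+1}},\quad a_2=-\frac{q_5\sin t}{(m_0^2+1)\sqrt{m_1^2+1}},\quad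 c_0=\frac{m_1m_2\sin t}{\sqrt{q_6}},\quad c_2=\frac{m_2\cos t}{\sqrt{q_6}},$$ with $q_6=(m_1^2+m_2^2)(m_2^2\sin^2t+\cos^2t)$. Composed with $h$ this parametrizes one component of $Y$, and the initial point $(a_{\mathsf{init}},b_{\mathsf{init}},c_{\mathsf{init}})$ (with $b$ and $-b$ identified, since $R(b)=R(-b)$) is obtained for $\cos t=m_1/\sqrt{m_1^2+1}$, $\sin t=-1/\sqrt{m_1^2+1}$. The other component is obtained by changing the sign of $c$ in this parametrization.
   Context: Vectors in $\mathbb{R}^4$ are indexed $a=(a_0,a_1,a_2,a_3)$; $\mathbf{e}^j$ are the standard unit vectors of $\mathbb{R}^3$; $\langle\cdot,\cdot\rangle$ is the standard inner product; $I$ is the $3\times3$ identity. $$R(a)=\begin{pmatrix} a_0^2+a_1^2-a_2^2-a_3^2 & 2a_1a_2-2a_0a_3 & 2a_1a_3+2a_0a_2\\ 2a_1a_2+2a_0a_3 & a_0^2-a_1^2+a_2^2-a_3^2 & 2a_2a_3-2a_0a_1\\ 2a_1a_3-2a_0a_2 & 2a_2a_3+2a_0a_1 & a_0^2-a_1^2-a_2^2+a_3^2\end{pmatrix}.$$ The mechanism is a closed loop of four rigid bodies connected by four revolute joints (a nonplanar Bennett mechanism in which each joint axis is orthogonal to the two adjacent links); one body is fixed and $a,b,c$ are the Euler parameters of the other three. Put $q=m_0^2(m_2-1)^2+(m_2+1)^2$, $r=(m_0^2+1)(1-m_2^2)/q$, and $q_4=m_0^2(m_2-1)+m_2+1$,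 $q_0=q_4(m_1^2+m_2)-2m_0(m_2-1)m_1$, $q_1=q_4m_1(m_2-1)+2m_0(m_1^2+m_2)$, $q_2=(1-m_2)(m_1^2+m_2^2)(m_1^2m_0+m_2m_1+m_2m_0-3m_1)$, $q_3=(m_1^2+m_2^2)\big(m_2m_1(m_2m_0-m_1-2m_0)-m_2^2+3m_1^2+m_1m_0+3m_2\big)$. Rotation axes: $\chi^0=\mathbf{e}^3$, $\chi^1=\frac{1}{m_0^2+1}(0,-2m_0,m_0^2-1)$, $$\chi^2=\frac{1}{(m_0^2+1)(m_1^2+1)q}\begin{pmatrix}4m_0m_1(1-m_2^2)(m_0^2+1)\\ 4m_0\big((1-m_0^2)(m_1^2+m_2^2)+m_2(m_0^2+1)(m_1^2+1)\big)\\ (m_2-1)^2(m_1^2+1)m_0^4+2\big((m_2^2-3)m_1^2-3m_2^2+1\big)m_0^2+(m_2+1)^2(m_1^2+1)\end{pmatrix},$$ $$\chi^3=\frac{1}{(m_1^2+m_2^2)q}\begin{pmatrix}4m_0m_1m_2(1-m_2^2)\\ 2m_0(m_2^2-m_1^2)(1-m_2^2)\\ (m_0m_2-m_0+m_2+1)(m_0m_2-m_0-m_2-1)(m_1^2+m_2^2)\end{pmatrix}.$$ Bases of the planes orthogonal to the axes: $\eta^0=\mathbf{e}^1$, $\xi^0=\mathbf{e}^2$, and for $\ell=1,2,3$, writing $\chi=\chi^\ell$, $$\eta^\ell=\Big(\frac{\chi_3\chi_1^2+\chi_2^2}{1-\chi_3^2},-\frac{\chi_1\chi_2}{1+\chi_3},-\chi_1\Big),\qquad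 \xi^\ell=\Big(-\frac{\chi_1\chi_2}{1+\chi_3},\chi_3+\frac{\chi_1^2}{1+\chi_3},-\chi_2\Big).$$ Initial orientations (Euler parameters) of the three moving bodies: $$a_{\mathsf{init}}=\frac{1}{m_1^2+1}\Big(m_1,\ m_1^2,\ \frac{q_5}{m_0^2+1},\ \frac{m_0^2+2m_0m_1-1}{m_0^2+1}\Big),$$ $$c_{\mathsf{init}}=\frac{1}{m_1^2+m_2^2}\big(-m_1m_2,\,-m_2^2,\,m_1m_2,\,m_1^2\big),$$ and $b_{\mathsf{init}}=\frac{1}{(m_1^2+1)(m_1^2+m_2^2)q}(B_0,B_1,B_2,B_3)$ with $B_0=m_1(m_2^2-1)q_0$, $B_1=m_1(m_2^2-1)q_1$, $$B_2=(1-m_2)(m_1^2-m_2)q_1+2q_2-\frac{8(m_1^2+m_2^2)(m_1^2m_0+m_2m_1+m_2m_0-m_1)}{m_0^2+1},$$ $$B_3=(1-m_2)(m_1^2-m_2)q_0+2q_3+\frac{8(m_1^2+m_2^2)(m_2m_1m_0-m_1^2-m_1m_0-m_2)}{m_0^2+1}.$$ Axes and planes in body coordinates: $\chi^{1,1}=R(a_{\mathsf{init}})^T\chi^1$, $\eta^{2,1}=R(a_{\mathsf{init}})^T\eta^2$, $\xi^{2,1}=R(a_{\mathsf{init}})^T\xi^2$; $\chi^{2,2}=R(b_{\mathsf{init}})^T\chi^2$, $\eta^{3,2}=R(b_{\mathsf{init}})^T\eta^3$, $\xi^{3,2}=R(b_{\mathsf{init}})^T\xi^3$; $\chi^{3,3}=R(c_{\mathsf{init}})^T\chi^3$,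 $\eta^{0,3}=R(c_{\mathsf{init}})^T\eta^0$, $\xi^{0,3}=R(c_{\mathsf{init}})^T\xi^0$. Constraint equations: the normalizations $|a|^2=|b|^2=|c|^2=1$; the loop equations $\big(I+rR(a)+R(b)+rR(c)\big)\mathbf{e}^1=0$; and the joint equations $$\langle\eta^1,R(a)\chi^{1,1}\rangle=\langle\xi^1,R(a)\chi^{1,1}\rangle=0,\qquad \langle R(a)\eta^{2,1},R(b)\chi^{2,2}\rangle=\langle R(a)\xi^{2,1},R(b)\chi^{2,2}\rangle=0,$$ $$\langle R(b)\eta^{3,2},R(c)\chi^{3,3}\rangle=\langle R(b)\xi^{3,2},R(c)\chi^{3,3}\rangle=0,\qquad \langle R(c)\eta^{0,3},\chi^0\rangle=\langle R(c)\xi^{0,3},\chi^0\rangle=0 .$$ Let $I_a, I_{ab}, I_{bc}, I_c$ be the polynomial ideals generated by the four successive pairs of joint polynomials together with the normalization polynomials of the Euler parameters occurring in them (coefficients in $\mathbb{Q}(m_0,m_1,m_2)$). None of these ideals is prime: each is the intersection of two prime ideals (for a revolute joint they correspond to the two choices of orientation of the axis), and exactly one of the two has a variety containing the initial configuration; denote it $J_a, J_{ab}, J_{bc}, J_c$ respectively. Here $$J_a=\big\langle a_1-m_1a_0,\ q_5a_3-(m_0^2+2m_0m_1-1)a_2,\ (m_1^2+1)q_5^2a_0^2+(m_1^2+1)(m_0^2+1)^2a_2^2-q_5^2\big\rangle,$$ $$J_c=\big\langle m_1c_1-m_2c_0,\ m_2c_3-m_1c_2,\ m_2^2(m_1^2+m_2^2)c_0^2+m_1^2(m_1^2+m_2^2)c_2^2-m_1^2m_2^2\big\rangle.$$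 $X\subset(\mathbb{R}^4)^3$ is the common zero set of $J_a,J_{ab},J_{bc},J_c$ and the loop equations, for the given $m$; the other prime components are discarded as they do not contain the initial configuration.
   Formalization: The claim that the number of eliminated variables is as big as possible is proved only for m off a proper algebraic set (it fails e.g. at m=(2,9/8,3/2), where a_0,a_2,b_2 suffice); for all m it is proved that none of a_0,a_2,c_0,c_2 can be dropped. *)

(* Defs.v *)
From mathcomp Require Import all_boot all_order all_algebra.
From mathcomp Require Import all_classical all_reals all_analysis.
From mathcomp Require mpoly.
(* The notations of multinomials clash with those of mathcomp-analysis. *)
Export -(notations) mpoly.
Import Order.TTheory GRing.Theory Num.Theory numFieldNormedType.Exports.

Set Implicit Arguments.
Unset Strict Implicit.
Unset Printing Implicit Defensive.

Local Open Scope classical_set_scope.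
Local Open Scope ring_scope.

Notation "{ 'mpoly' T [ n ] }" := (mpoly n T) 
  (at level 0, T, n at level 2, format "{ 'mpoly'  T [ n ] }").
Local Notation "''X_' i" := (@mpolyX _ _ (mnm1 i)) (at level 8, i at level 2).
Local Notation "p .@[ v ]" := (@meval _ _ v p) (at level 2).

Section LinearAlgebra.

Variable A : pzRingType.

Definition cvec (s : seq A) : 'cV[A]_3 := \col_i s`_i.

Definition rvec n (s : seq A) : 'rV[A]_n := \row_i s`_i.

Definition dot (u v : 'cV[A]_3) : A := (u^T *m v) 0 0.

Definition norm2 (a : 'rV[A]_4) : A := \sum_i a 0 i ^+ 2.

Definition rotmx (a : 'rV[A]_4) : 'M[A]_3 :=
  let: (a0, a1, a2, a3) := (a 0 0, a 0 1, a 0 2, a 0 3) in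
  \matrix_(i < 3, j < 3) (nth [::]
    [:: [:: a0 ^+ 2 + a1 ^+ 2 - a2 ^+ 2 - a3 ^+ 2;
            2 * a1 * a2 - 2 * a0 * a3;
            2 * a1 * a3 + 2 * a0 * a2];
        [:: 2 * a1 * a2 + 2 * a0 * a3;
            a0 ^+ 2 - a1 ^+ 2 + a2 ^+ 2 - a3 ^+ 2;
            2 * a2 * a3 - 2 * a0 * a1];
        [:: 2 * a1 * a3 - 2 * a0 * a2;
            2 * a2 * a3 + 2 * a0 * a1;
            a0 ^+ 2 - a1 ^+ 2 - a2 ^+ 2 + a3 ^+ 2]] i)`_j.

End LinearAlgebra.

Section Ideals.

Variables (R : realType) (n : nat).
Implicit Types (s : seq {mpoly R[n]}) (J : {pred {mpoly R[n]}}) (x : 'rV[R]_n).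

Definition in_ideal s (f : {mpoly R[n]}) : Prop :=
  exists g : 'I_(size s) -> {mpoly R[n]}, f = \sum_i g i * s`_i.

Definition in_variety J x : Prop := forall f, f \in J -> f.@[x 0] = 0.

Definition prime_ideal J : Prop := idealr_closed J /\ prime_idealr_closed J.

(* The ideal generated by s is the intersection of two prime ideals, of which
   J is the one whose variety contains x. *)
Definition prime_component s x J : Prop :=
  [/\ prime_ideal J, in_variety J x &
      exists J' : {pred {mpoly R[n]}},
        [/\ prime_ideal J', ~ in_variety J' x &
            forall f, in_ideal s f <-> f \in J /\ f \in J']].

Definition common_zeros s : set 'rV[R]_n :=
  [set x | forall f, f \in s -> f.@[x 0] = 0].

Definition poly_jacobian s x : 'M[R]_(size s, n) :=
  \matrix_(i < size s, j < n) (mderiv j s`_i).@[x 0].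

End Ideals.

(* Points (a, b, c) of (R^4)^3, and their twelve coordinates
   a_0, ..., a_3, b_0, ..., b_3, c_0, ..., c_3. *)
Notation conf R := ('rV[R]_4 * 'rV[R]_4 * 'rV[R]_4)%type.

Section Configurations.

Variable R : realType.
Implicit Types (p q : conf R) (Y : set (conf R)) (S : {set 'I_12}).

Definition coords p : 'rV[R]_12 := row_mx (row_mx p.1.1 p.1.2) p.2.

(* On Y, every coordinate is a polynomial function of those indexed by S; the
   polynomial f only sees the latter, the others being replaced by 0. *)
Definition polynomial_in_on S Y : Prop :=
  forall i, exists f : {mpoly R[12]}, forall p, Y p ->
    coords p 0 i = f.@[fun j => if j \in S then coords p 0 j else 0].

(* The positions of a_0, a_2, c_0, c_2. *)
Definition essential : {set 'I_12} :=
  finset (fun i : 'I_12 => (i : nat) \in [:: 0; 2; 8; 10]%N).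

Definition essential_coords p : 'rV[R]_4 :=
  rvec 4 [:: p.1.1 0 0; p.1.1 0 2; p.2 0 0; p.2 0 2].

Definition flip_b p : conf R := (p.1.1, - p.1.2, p.2).

(* v = (a_0, a_2, c_0, c_2) *)
Definition flip_c (v : 'rV[R]_4) : 'rV[R]_4 :=
  rvec 4 [:: v 0 0; v 0 1; - v 0 2; - v 0 3].

Definition sign_class p : set (conf R) :=
  [set q | exists s1 s2 s3 : bool,
     q = ((-1) ^+ s1 *: p.1.1, (-1) ^+ s2 *: p.1.2, (-1) ^+ s3 *: p.2)].

Definition same_orientation p q : Prop :=
  [/\ rotmx p.1.1 = rotmx q.1.1, rotmx p.1.2 = rotmx q.1.2 & rotmx p.2 = rotmx q.2].

Definition components (T : topologicalType) (E : set T) : set (set T) :=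
  [set connected_component E x | x in E].

End Configurations.

Section Mechanism.

Variables (R : realType) (m0 m1 m2 : R).

Definition q : R := m0 ^+ 2 * (m2 - 1) ^+ 2 + (m2 + 1) ^+ 2.

Definition r : R := (m0 ^+ 2 + 1) * (1 - m2 ^+ 2) / q.

Definition q4 : R := m0 ^+ 2 * (m2 - 1) + m2 + 1.

Definition q0 : R := q4 * (m1 ^+ 2 + m2) - 2 * m0 * (m2 - 1) * m1.

Definition q1 : R := q4 * m1 * (m2 - 1) + 2 * m0 * (m1 ^+ 2 + m2).

Definition q2 : R :=
  (1 - m2) * (m1 ^+ 2 + m2 ^+ 2) *
  (m1 ^+ 2 * m0 + m2 * m1 + m2 * m0 - 3 * m1).

Definition q3 : R :=
  (m1 ^+ 2 + m2 ^+ 2) *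
  (m2 * m1 * (m2 * m0 - m1 - 2 * m0) - m2 ^+ 2 + 3 * m1 ^+ 2
   + m1 * m0 + 3 * m2).

Definition q5 : R := m1 * (m0 ^+ 2 - 1) - 2 * m0.

Definition chi0 : 'cV[R]_3 := cvec [:: 0; 0; 1].

Definition chi1 : 'cV[R]_3 :=
  (m0 ^+ 2 + 1)^-1 *: cvec [:: 0; - 2 * m0; m0 ^+ 2 - 1].

Definition chi2 : 'cV[R]_3 :=
  ((m0 ^+ 2 + 1) * (m1 ^+ 2 + 1) * q)^-1 *: cvec [::
    4 * m0 * m1 * (1 - m2 ^+ 2) * (m0 ^+ 2 + 1);
    4 * m0 * ((1 - m0 ^+ 2) * (m1 ^+ 2 + m2 ^+ 2)
              + m2 * (m0 ^+ 2 + 1) * (m1 ^+ 2 + 1));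
    (m2 - 1) ^+ 2 * (m1 ^+ 2 + 1) * m0 ^+ 4
    + 2 * ((m2 ^+ 2 - 3) * m1 ^+ 2 - 3 * m2 ^+ 2 + 1) * m0 ^+ 2
    + (m2 + 1) ^+ 2 * (m1 ^+ 2 + 1)].

Definition chi3 : 'cV[R]_3 :=
  ((m1 ^+ 2 + m2 ^+ 2) * q)^-1 *: cvec [::
    4 * m0 * m1 * m2 * (1 - m2 ^+ 2);
    2 * m0 * (m2 ^+ 2 - m1 ^+ 2) * (1 - m2 ^+ 2);
    (m0 * m2 - m0 + m2 + 1) * (m0 * m2 - m0 - m2 - 1)
    * (m1 ^+ 2 + m2 ^+ 2)].

Definition eta (chi : 'cV[R]_3) : 'cV[R]_3 :=
  let: (x1, x2, x3) := (chi 0 0, chi 1 0, chi 2 0) in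
  cvec [:: (x3 * x1 ^+ 2 + x2 ^+ 2) / (1 - x3 ^+ 2);
           - (x1 * x2 / (1 + x3));
           - x1].

Definition xi (chi : 'cV[R]_3) : 'cV[R]_3 :=
  let: (x1, x2, x3) := (chi 0 0, chi 1 0, chi 2 0) in
  cvec [:: - (x1 * x2 / (1 + x3));
           x3 + x1 ^+ 2 / (1 + x3);
           - x2].

Definition eta0 : 'cV[R]_3 := cvec [:: 1; 0; 0].

Definition xi0 : 'cV[R]_3 := cvec [:: 0; 1; 0].

Definition a_init : 'rV[R]_4 :=
  (m1 ^+ 2 + 1)^-1 *: rvec 4 [::
    m1; m1 ^+ 2; q5 / (m0 ^+ 2 + 1);
    (m0 ^+ 2 + 2 * m0 * m1 - 1) / (m0 ^+ 2 + 1)].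

Definition b_init : 'rV[R]_4 :=
  ((m1 ^+ 2 + 1) * (m1 ^+ 2 + m2 ^+ 2) * q)^-1 *: rvec 4 [::
    m1 * (m2 ^+ 2 - 1) * q0;
    m1 * (m2 ^+ 2 - 1) * q1;
    (1 - m2) * (m1 ^+ 2 - m2) * q1 + 2 * q2
    - 8 * (m1 ^+ 2 + m2 ^+ 2) *
      (m1 ^+ 2 * m0 + m2 * m1 + m2 * m0 - m1) / (m0 ^+ 2 + 1);
    (1 - m2) * (m1 ^+ 2 - m2) * q0 + 2 * q3
    + 8 * (m1 ^+ 2 + m2 ^+ 2) *
      (m2 * m1 * m0 - m1 ^+ 2 - m1 * m0 - m2) / (m0 ^+ 2 + 1)].

Definition c_init : 'rV[R]_4 :=
  (m1 ^+ 2 + m2 ^+ 2)^-1 *: rvec 4 [::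
    - m1 * m2; - m2 ^+ 2; m1 * m2; m1 ^+ 2].

Definition init : conf R := (a_init, b_init, c_init).

(* In chi_l_k, eta_l_k, xi_l_k the index l is the joint and k the body in
   whose coordinates the vector is expressed. *)
Definition chi_1_1 : 'cV[R]_3 := (rotmx a_init)^T *m chi1.
Definition eta_2_1 : 'cV[R]_3 := (rotmx a_init)^T *m eta chi2.
Definition xi_2_1 : 'cV[R]_3 := (rotmx a_init)^T *m xi chi2.
Definition chi_2_2 : 'cV[R]_3 := (rotmx b_init)^T *m chi2.
Definition eta_3_2 : 'cV[R]_3 := (rotmx b_init)^T *m eta chi3.
Definition xi_3_2 : 'cV[R]_3 := (rotmx b_init)^T *m xi chi3.
Definition chi_3_3 : 'cV[R]_3 := (rotmx c_init)^T *m chi3.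
Definition eta_0_3 : 'cV[R]_3 := (rotmx c_init)^T *m eta0.
Definition xi_0_3 : 'cV[R]_3 := (rotmx c_init)^T *m xi0.

Definition normalized (p : conf R) : Prop :=
  [/\ norm2 p.1.1 = 1, norm2 p.1.2 = 1 & norm2 p.2 = 1].

Definition loop_eq (p : conf R) : Prop :=
  let: (a, b, c) := p in
  (1%:M + r *: rotmx a + rotmx b + r *: rotmx c) *m cvec [:: 1; 0; 0] = 0.

Definition joint_eq (p : conf R) : Prop :=
  let: (a, b, c) := p in
  [/\ dot (eta chi1) (rotmx a *m chi_1_1) = 0
        /\ dot (xi chi1) (rotmx a *m chi_1_1) = 0,
      dot (rotmx a *m eta_2_1) (rotmx b *m chi_2_2) = 0
        /\ dot (rotmx a *m xi_2_1) (rotmx b *m chi_2_2) = 0,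
      dot (rotmx b *m eta_3_2) (rotmx c *m chi_3_3) = 0
        /\ dot (rotmx b *m xi_3_2) (rotmx c *m chi_3_3) = 0 &
      dot (rotmx c *m eta_0_3) chi0 = 0 /\ dot (rotmx c *m xi_0_3) chi0 = 0].

Definition constraint_eq (p : conf R) : Prop :=
  [/\ normalized p, loop_eq p & joint_eq p].

(* Generators of the ideal of a joint between two moving bodies, with Euler
   parameters x = (X_0, ..., X_3) and y = (X_4, ..., X_7), where eta and xi
   are fixed in the first body and chi in the second one. *)
Definition joint_ideal (eta xi chi : 'cV[R]_3) : seq {mpoly R[4 + 4]} :=
  let x : 'rV[{mpoly R[4 + 4]}]_4 := \row_j 'X_(lshift 4 j) in
  let y : 'rV[{mpoly R[4 + 4]}]_4 := \row_j 'X_(rshift 4 j) in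
  let C (u : 'cV[R]_3) := map_mx (@mpolyC (4 + 4) R) u in
  [:: dot (rotmx x *m C eta) (rotmx y *m C chi);
      dot (rotmx x *m C xi) (rotmx y *m C chi);
      norm2 x - 1; norm2 y - 1].

Definition I_ab : seq {mpoly R[4 + 4]} := joint_ideal eta_2_1 xi_2_1 chi_2_2.
Definition I_bc : seq {mpoly R[4 + 4]} := joint_ideal eta_3_2 xi_3_2 chi_3_3.

(* The varieties of J_a and J_c, given by the generators of these ideals. *)
Definition variety_Ja (a : 'rV[R]_4) : Prop :=
  let: (a0, a1, a2, a3) := (a 0 0, a 0 1, a 0 2, a 0 3) in
  [/\ a1 - m1 * a0 = 0,
      q5 * a3 - (m0 ^+ 2 + 2 * m0 * m1 - 1) * a2 = 0 &
      (m1 ^+ 2 + 1) * q5 ^+ 2 * a0 ^+ 2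
      + (m1 ^+ 2 + 1) * (m0 ^+ 2 + 1) ^+ 2 * a2 ^+ 2 - q5 ^+ 2 = 0].

Definition variety_Jc (c : 'rV[R]_4) : Prop :=
  let: (c0, c1, c2, c3) := (c 0 0, c 0 1, c 0 2, c 0 3) in
  [/\ m1 * c1 - m2 * c0 = 0,
      m2 * c3 - m1 * c2 = 0 &
      m2 ^+ 2 * (m1 ^+ 2 + m2 ^+ 2) * c0 ^+ 2
      + m1 ^+ 2 * (m1 ^+ 2 + m2 ^+ 2) * c2 ^+ 2 - m1 ^+ 2 * m2 ^+ 2 = 0].

Definition solutions (Jab Jbc : {pred {mpoly R[4 + 4]}}) : set (conf R) :=
  [set p : conf R | let: (a, b, c) := p in
     [/\ variety_Ja a, in_variety Jab (row_mx a b),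
         in_variety Jbc (row_mx b c), variety_Jc c & loop_eq p]].

(* In the variables (X_0, X_1, X_2, X_3) = (a_0, a_2, c_0, c_2). *)
Definition bennett : seq {mpoly R[4]} :=
  let C := @mpolyC 4 R in
  let: (a0, a2, c0, c2) := ('X_0, 'X_1, 'X_2, 'X_3) in
  [:: a0 ^+ 2 + C ((m0 ^+ 2 + 1) ^+ 2 / q5 ^+ 2) * a2 ^+ 2
      - C (1 / (m1 ^+ 2 + 1));
      C (m2 ^+ 2) * c0 ^+ 2 + C (m1 ^+ 2) * c2 ^+ 2
      - C (m1 ^+ 2 * m2 ^+ 2 / (m1 ^+ 2 + m2 ^+ 2));
      C (m1 * (m0 ^+ 2 + 1)) * c2 * a2 + C q5 * c0 * a0].

Definition bennett_variety : set 'rV[R]_4 := common_zeros bennett.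

Definition t0 : R := (m2 ^+ 2 - 1) * q0 / (m1 * m2 * q).

Definition t1 : R := (m2 ^+ 2 - 1) * q1 / (m1 * m2 * q).

Definition t2 : R :=
  (m1 * (m2 - 1) * (q4 ^+ 2 - 4 * m0 ^+ 2) + 4 * m0 * q4 * (m1 ^+ 2 + m2))
  / (m2 * (m0 ^+ 2 + 1) * q).

Definition t3 : R :=
  (m1 * (m2 - 1) * (m0 ^+ 2 - 1) - 2 * m0 * (m2 + m1 ^+ 2)) / (m1 * q5).

Definition t4 : R :=
  ((m1 ^+ 2 + m2) * (q4 ^+ 2 - 4 * m0 ^+ 2) - 4 * m0 * m1 * (m2 - 1) * q4)
  / (m2 * (m0 ^+ 2 + 1) * q).

Definition t5 : R :=
  ((m2 + m1 ^+ 2) * (m0 ^+ 2 - 1) + 2 * m0 * m1 * (m2 - 1)) / (m1 * q5).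

(* v = (a_0, a_2, c_0, c_2) *)
Definition bennett_map (v : 'rV[R]_4) : conf R :=
  let: (a0, a2, c0, c2) := (v 0 0, v 0 1, v 0 2, v 0 3) in
  (rvec 4 [:: a0; m1 * a0; a2; (m0 ^+ 2 + 2 * m0 * m1 - 1) / q5 * a2],
   rvec 4 [:: t0 * a0 * c0; t1 * a0 * c0;
              t2 * a0 * c2 + t3 * a2 * c0; t4 * a0 * c2 + t5 * a2 * c0],
   rvec 4 [:: c0; m2 / m1 * c0; c2; m1 / m2 * c2]).

Definition eight_formulas (p : conf R) : Prop :=
  let: (a, b, c) := p in
  let: (a0, a2, c0, c2) := (a 0 0, a 0 2, c 0 0, c 0 2) in
  [/\ a 0 1 = m1 * a0 /\ a 0 3 = (m0 ^+ 2 + 2 * m0 * m1 - 1) / q5 * a2,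
      c 0 1 = m2 / m1 * c0 /\ c 0 3 = m1 / m2 * c2,
      b 0 0 = t0 * a0 * c0 /\ b 0 1 = t1 * a0 * c0 &
      b 0 2 = t2 * a0 * c2 + t3 * a2 * c0
        /\ b 0 3 = t4 * a0 * c2 + t5 * a2 * c0].

Definition solutions_by_formulas (Jab Jbc : {pred {mpoly R[4 + 4]}}) : set (conf R) :=
  solutions Jab Jbc `&` [set p | eight_formulas p].

(* (b_0, b_1) = s (t_0 a_0 c_0, t_1 a_0 c_0), for a sign s *)
Definition alternative (s : R) : set (conf R) :=
  [set p : conf R | let: (a, b, c) := p in
     b 0 0 = s * (t0 * a 0 0 * c 0 0) /\ b 0 1 = s * (t1 * a 0 0 * c 0 0)].

Definition q6 (t : R) : R :=
  (m1 ^+ 2 + m2 ^+ 2) * (m2 ^+ 2 * sin t ^+ 2 + cos t ^+ 2).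

Definition param (t : R) : 'rV[R]_4 :=
  rvec 4 [:: cos t / Num.sqrt (m1 ^+ 2 + 1);
             - (q5 * sin t / ((m0 ^+ 2 + 1) * Num.sqrt (m1 ^+ 2 + 1)));
             m1 * m2 * sin t / Num.sqrt (q6 t);
             m2 * cos t / Num.sqrt (q6 t)].

End Mechanism.

(* D does not vanish at (m0, m1, m2). *)
Definition nonzero_at (R : realType) (D : {mpoly R[3]}) (m0 m1 m2 : R) : Prop :=
  D.@[rvec 3 [:: m0; m1; m2] 0] != 0.

(* Main.v *)
(* Quaternions are written over the complex numbers C = span (1, i), the link
   direction e^1 being i. With v = m0 + i and u = m0 (m2 - 1) + i (m2 + 1), so
   that |u|^2 = q and q_4 + 2 m0 i = v^* u, the prime components J_a and J_c say
   that a and c are unit multiples of complex * (x0 + x2 j) * complex and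
   complex * (y0 + y2 j) * complex with fixed complex factors and real unit
   vectors x, y. Removing these factors leaves a mechanism whose twist angles
   alpha, beta satisfy sin alpha = - r sin beta, and V becomes
   x0 y0 + m2 x2 y2 = 0.

   The components J_ab and J_bc express that both bodies see the oriented joint
   axis at the same place. Since the link of body b is orthogonal to both of its
   joint axes, the loop equation yields two equations in x, y only; each of them
   is (x0 y0 + m2 x2 y2) times a bilinear form, and the common zeros of the two
   forms are folded configurations that do not close up. So X lies over V, and b
   is determined up to sign by R(b) e^1 and the image of one joint axis.

   Optimality of the number of variables: the sign changes of (a, b, c) that
   preserve V act on every coordinate by a character of (Z/2)^3. At the points
   with a_2 = c_0 = 0 or a_0 = c_2 = 0 they force three polynomially generating
   coordinates to be one of b_2, b_3, one of a_0, a_1, c_2, c_3 and one of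
   a_2, a_3, c_0, c_1. Averaging over the signs, the missing variable is then
   divisible by b_2 (or b_3), which is contradicted at a zero of the latter on
   the complexification of V; for generic m that zero is not a pole. *)

Require Import Defs.
From mathcomp Require Import all_boot all_order all_algebra.
From mathcomp Require Import all_classical all_reals all_analysis.
From mathcomp Require Import ring.
Import Order.TTheory GRing.Theory Num.Theory numFieldNormedType.Exports.

Set Implicit Arguments.
Unset Strict Implicit.
Unset Printing Implicit Defensive.

Local Open Scope classical_set_scope.
Local Open Scope ring_scope.

(** The predicates [Jab] and [Jbc] are arbitrary: no generators are given, only primality, the
    initial point and the decomposition of the joint ideal. So nothing is computed inside them; each
    is replaced once and for all by its real zero set. This needs a single membership certificate in
    the ideal of an arbitrary joint, which is why the vector algebra is set up over commutative
    rings, polynomial rings included. On the reduced curve, [x0 y0 + m2 x2 y2 = 0] makes [(x0, x2)]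
    proportional to [(- m2 y2, y0)]. Identities that are homogeneous in [x] and in [y] then become
    plain rational identities in three independent quantities, and [field] settles them. The zero of
    [b_2] or [b_3] on the complexified curve is reached without complex numbers. In terms of
    [s = sin^2 t] these coordinates are, up to a square root, linear with real coefficients. Their
    zero is real but may lie outside the unit interval, so the contradiction is first brought into
    the form of an identity of polynomials in [s]. *)

Definition quat (A : pzRingType) (x0 x1 x2 x3 : A) : 'rV[A]_4 :=
  rvec 4 [:: x0; x1; x2; x3].

Definition vec3 (A : pzRingType) (x y z : A) : 'cV[A]_3 := cvec [:: x; y; z].

(** * Quaternions and rotations *)

Section LinearCombination.

Variable A : comNzRingType.
Implicit Types k l r x y : A.

(** Certificates: a consequence of polynomial equations reduces to one [ring] or [field] identity
    once the cofactors [k] of the equations are supplied. *)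
Lemma lincomb1 k l r x y : l = r -> x - y = k * (l - r) -> x = y.
Proof. by move=> -> E; apply/eqP; rewrite -subr_eq0 E subrr mulr0. Qed.

Lemma lincomb2 k1 k2 l1 r1 l2 r2 x y : l1 = r1 -> l2 = r2 ->
  x - y = k1 * (l1 - r1) + k2 * (l2 - r2) -> x = y.
Proof.
by move=> -> -> E; apply/eqP; rewrite -subr_eq0 E !subrr !mulr0 addr0.
Qed.

Lemma lincomb3 k1 k2 k3 l1 r1 l2 r2 l3 r3 x y : l1 = r1 -> l2 = r2 -> l3 = r3 ->
  x - y = k1 * (l1 - r1) + k2 * (l2 - r2) + k3 * (l3 - r3) -> x = y.
Proof.
by move=> -> -> -> E; apply/eqP; rewrite -subr_eq0 E !subrr !mulr0 !addr0.
Qed.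

Lemma lincomb4 k1 k2 k3 k4 l1 r1 l2 r2 l3 r3 l4 r4 x y :
  l1 = r1 -> l2 = r2 -> l3 = r3 -> l4 = r4 ->
  x - y = k1 * (l1 - r1) + k2 * (l2 - r2) + k3 * (l3 - r3) + k4 * (l4 - r4) -> x = y.
Proof.
by move=> -> -> -> -> E; apply/eqP; rewrite -subr_eq0 E !subrr !mulr0 !addr0.
Qed.

Lemma lincomb5 k1 k2 k3 k4 k5 l1 r1 l2 r2 l3 r3 l4 r4 l5 r5 x y :
  l1 = r1 -> l2 = r2 -> l3 = r3 -> l4 = r4 -> l5 = r5 ->
  x - y = k1 * (l1 - r1) + k2 * (l2 - r2) + k3 * (l3 - r3) + k4 * (l4 - r4)
          + k5 * (l5 - r5) -> x = y.
Proof.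
by move=> -> -> -> -> -> E; apply/eqP; rewrite -subr_eq0 E !subrr !mulr0 !addr0.
Qed.

End LinearCombination.

Arguments lincomb1 {A} k {l r x y}.
Arguments lincomb2 {A} k1 k2 {l1 r1 l2 r2 x y}.
Arguments lincomb3 {A} k1 k2 k3 {l1 r1 l2 r2 l3 r3 x y}.
Arguments lincomb4 {A} k1 k2 k3 k4 {l1 r1 l2 r2 l3 r3 l4 r4 x y}.
Arguments lincomb5 {A} k1 k2 k3 k4 k5 {l1 r1 l2 r2 l3 r3 l4 r4 l5 r5 x y}.

Section Coordinates.

Variable A : comNzRingType.
Implicit Types (p : 'rV[A]_4) (u v : 'cV[A]_3) (a b k x y z : A).

Lemma quatE x0 x1 x2 x3 (a := quat x0 x1 x2 x3) :
  ((a 0 0 = x0) * (a 0 1 = x1) * (a 0 2 = x2) * (a 0 3 = x3))%type.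
Proof. by rewrite /a /quat /rvec !mxE. Qed.

Lemma vec3E x y z (u := vec3 x y z) :
  ((u 0 0 = x) * (u 1 0 = y) * (u 2 0 = z))%type.
Proof. by rewrite /u /vec3 /cvec !mxE. Qed.

Lemma ord4P (P : 'I_4 -> Prop) : P 0 -> P 1 -> P 2 -> P 3 -> forall i, P i.
Proof.
move=> P0 P1 P2 P3 [[|[|[|[|//]]]] lt_i].
- by rewrite (_ : Ordinal _ = 0) //; apply: val_inj.
- by rewrite (_ : Ordinal _ = 1) //; apply: val_inj.
- by rewrite (_ : Ordinal _ = 2) //; apply: val_inj.
- by rewrite (_ : Ordinal _ = 3) //; apply: val_inj.
Qed.

Lemma ord3P (P : 'I_3 -> Prop) : P 0 -> P 1 -> P 2 -> forall i, P i.
Proof.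
move=> P0 P1 P2 [[|[|[|//]]] lt_i].
- by rewrite (_ : Ordinal _ = 0) //; apply: val_inj.
- by rewrite (_ : Ordinal _ = 1) //; apply: val_inj.
- by rewrite (_ : Ordinal _ = 2) //; apply: val_inj.
Qed.

Lemma quat_eta p : p = quat (p 0 0) (p 0 1) (p 0 2) (p 0 3).
Proof. by apply/rowP; apply: ord4P; rewrite quatE. Qed.

Lemma vec3_eta u : u = vec3 (u 0 0) (u 1 0) (u 2 0).
Proof. by apply/colP; apply: ord3P; rewrite vec3E. Qed.

Lemma quat_inj x0 x1 x2 x3 y0 y1 y2 y3 :
  quat x0 x1 x2 x3 = quat y0 y1 y2 y3 -> [/\ x0 = y0, x1 = y1, x2 = y2 & x3 = y3].
Proof.
move=> e; have /= E i : quat x0 x1 x2 x3 0 i = quat y0 y1 y2 y3 0 i by rewrite e.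
by move: (E 0) (E 1) (E 2) (E 3); rewrite !quatE.
Qed.

Lemma vec3_inj x y z x' y' z' :
  vec3 x y z = vec3 x' y' z' -> [/\ x = x', y = y' & z = z'].
Proof.
move=> e; have /= E i : vec3 x y z i 0 = vec3 x' y' z' i 0 by rewrite e.
by move: (E 0) (E 1) (E 2); rewrite !vec3E.
Qed.

Lemma scale_quat k x0 x1 x2 x3 :
  k *: quat x0 x1 x2 x3 = quat (k * x0) (k * x1) (k * x2) (k * x3).
Proof. by apply/rowP; apply: ord4P; rewrite mxE !quatE. Qed.

Lemma opp_quat x0 x1 x2 x3 :
  - quat x0 x1 x2 x3 = quat (- x0) (- x1) (- x2) (- x3).
Proof. by apply/rowP; apply: ord4P; rewrite mxE !quatE. Qed.

Lemma scale_vec3 k x y z : k *: vec3 x y z = vec3 (k * x) (k * y) (k * z).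
Proof. by apply/colP; apply: ord3P; rewrite mxE !vec3E. Qed.

Lemma add_vec3 x y z x' y' z' :
  vec3 x y z + vec3 x' y' z' = vec3 (x + x') (y + y') (z + z').
Proof. by apply/colP; apply: ord3P; rewrite mxE !vec3E. Qed.

Lemma vec30 : 0 = vec3 (0 : A) 0 0.
Proof. by apply/colP; apply: ord3P; rewrite mxE !vec3E. Qed.

Lemma dot_vec3 x y z x' y' z' :
  dot (vec3 x y z) (vec3 x' y' z') = x * x' + y * y' + z * z'.
Proof.
rewrite /dot mxE !big_ord_recr big_ord0 /= add0r !mxE.
by [].
Qed.

Lemma norm2_quat x0 x1 x2 x3 :
  norm2 (quat x0 x1 x2 x3) = x0 ^+ 2 + x1 ^+ 2 + x2 ^+ 2 + x3 ^+ 2.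
Proof. by rewrite /norm2 !big_ord_recr big_ord0 /= add0r !mxE. Qed.

Lemma rotmx_vec3 a0 a1 a2 a3 x y z :
  rotmx (quat a0 a1 a2 a3) *m vec3 x y z = vec3
   ((a0 ^+ 2 + a1 ^+ 2 - a2 ^+ 2 - a3 ^+ 2) * x
    + (2 * a1 * a2 - 2 * a0 * a3) * y + (2 * a1 * a3 + 2 * a0 * a2) * z)
   ((2 * a1 * a2 + 2 * a0 * a3) * x
    + (a0 ^+ 2 - a1 ^+ 2 + a2 ^+ 2 - a3 ^+ 2) * y + (2 * a2 * a3 - 2 * a0 * a1) * z)
   ((2 * a1 * a3 - 2 * a0 * a2) * x + (2 * a2 * a3 + 2 * a0 * a1) * y
    + (a0 ^+ 2 - a1 ^+ 2 - a2 ^+ 2 + a3 ^+ 2) * z).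
Proof.
by apply/colP; apply: ord3P;
   rewrite /rotmx !quatE mxE !big_ord_recr big_ord0 /= add0r !mxE.
Qed.

Definition qconj (a : 'rV[A]_4) : 'rV[A]_4 := quat (a 0 0) (- a 0 1) (- a 0 2) (- a 0 3).

Definition qmul (a b : 'rV[A]_4) : 'rV[A]_4 := quat
  (a 0 0 * b 0 0 - a 0 1 * b 0 1 - a 0 2 * b 0 2 - a 0 3 * b 0 3)
  (a 0 0 * b 0 1 + a 0 1 * b 0 0 + a 0 2 * b 0 3 - a 0 3 * b 0 2)
  (a 0 0 * b 0 2 - a 0 1 * b 0 3 + a 0 2 * b 0 0 + a 0 3 * b 0 1)
  (a 0 0 * b 0 3 + a 0 1 * b 0 2 - a 0 2 * b 0 1 + a 0 3 * b 0 0).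

Lemma qmul_quat x0 x1 x2 x3 y0 y1 y2 y3 :
  qmul (quat x0 x1 x2 x3) (quat y0 y1 y2 y3) = quat
    (x0 * y0 - x1 * y1 - x2 * y2 - x3 * y3) (x0 * y1 + x1 * y0 + x2 * y3 - x3 * y2)
    (x0 * y2 - x1 * y3 + x2 * y0 + x3 * y1) (x0 * y3 + x1 * y2 - x2 * y1 + x3 * y0).
Proof. by rewrite /qmul !quatE. Qed.

(** Testing on a generic vector turns an identity of rotation matrices into three scalar identities
    for [ring]. *)
Lemma mx3_ext (M N : 'M[A]_3) :
  (forall x y z, M *m vec3 x y z = N *m vec3 x y z) -> M = N.
Proof.
move=> MN; apply/matrixP => i j.
have := MN (j == 0)%:R (j == 1)%:R (j == 2)%:R.
have -> : vec3 (j == 0)%:R (j == 1)%:R (j == 2)%:R = delta_mx j 0 :> 'cV[A]_3.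
  by apply/colP; apply: ord3P; rewrite vec3E mxE eqxx andbT eq_sym.
by rewrite -!colE => /colP /(_ i); rewrite !mxE.
Qed.

Lemma rotmxM (a b : 'rV[A]_4) : rotmx (qmul a b) = rotmx a *m rotmx b.
Proof.
apply: mx3_ext => x y z.
rewrite (quat_eta a) (quat_eta b) /qmul !quatE -mulmxA !rotmx_vec3.
by congr vec3; ring.
Qed.

Lemma rotmx_qconj (a : 'rV[A]_4) : rotmx (qconj a) = (rotmx a)^T.
Proof.
rewrite (quat_eta a) /qconj !quatE.
by apply/matrixP; apply: ord3P; apply: ord3P; rewrite /rotmx !quatE !mxE /=;
   rewrite ?sqrrN ?mulrN ?mulNr ?opprK // addrC // mulrAC.
Qed.

Lemma norm2M (a b : 'rV[A]_4) : norm2 (qmul a b) = norm2 a * norm2 b.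
Proof.
by rewrite (quat_eta a) (quat_eta b) /qmul !quatE !norm2_quat; ring.
Qed.

Lemma rotmx_scalar k : rotmx (quat k 0 0 0) = (k ^+ 2)%:M.
Proof.
apply: mx3_ext => x y z; rewrite mul_scalar_mx scale_vec3 rotmx_vec3.
by congr vec3; ring.
Qed.

Lemma qconjM (a : 'rV[A]_4) : qmul (qconj a) a = quat (norm2 a) 0 0 0.
Proof.
by rewrite (quat_eta a) /qconj /qmul !quatE norm2_quat; congr quat; ring.
Qed.

Lemma mulqconj (a : 'rV[A]_4) : qmul a (qconj a) = quat (norm2 a) 0 0 0.
Proof.
by rewrite (quat_eta a) /qconj /qmul !quatE norm2_quat; congr quat; ring.
Qed.

Lemma rotmxK (a : 'rV[A]_4) : (rotmx a)^T *m rotmx a = (norm2 a ^+ 2)%:M.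
Proof. by rewrite -rotmx_qconj -rotmxM qconjM rotmx_scalar. Qed.

Lemma rotmxKV (a : 'rV[A]_4) : rotmx a *m (rotmx a)^T = (norm2 a ^+ 2)%:M.
Proof. by rewrite -rotmx_qconj -rotmxM mulqconj rotmx_scalar. Qed.

Lemma rotmxZ k (a : 'rV[A]_4) : rotmx (k *: a) = k ^+ 2 *: rotmx a.
Proof.
apply: mx3_ext => x y z; rewrite (quat_eta a) scale_quat -scalemxAl !rotmx_vec3.
by rewrite scale_vec3; congr vec3; ring.
Qed.

Lemma rotmxN (a : 'rV[A]_4) : rotmx (- a) = rotmx a.
Proof. by rewrite -scaleN1r rotmxZ sqrrN expr1n scale1r. Qed.

Lemma dotC u v : dot u v = dot v u.
Proof. by rewrite (vec3_eta u) (vec3_eta v) !dot_vec3; ring. Qed.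

Lemma dotMl (M : 'M[A]_3) u v : dot (M *m u) v = dot u (M^T *m v).
Proof. by rewrite /dot trmx_mul mulmxA. Qed.

Lemma dotMr (M : 'M[A]_3) u v : dot u (M *m v) = dot (M^T *m u) v.
Proof. by rewrite dotMl trmxK. Qed.

Lemma dotZr k u v : dot u (k *: v) = k * dot u v.
Proof. by rewrite /dot -scalemxAr mxE. Qed.

Lemma dotNr u v : dot u (- v) = - dot u v.
Proof. by rewrite /dot mulmxN mxE. Qed.

Lemma dot_rotmx (a : 'rV[A]_4) u v : dot (rotmx a *m u) (rotmx a *m v) = norm2 a ^+ 2 * dot u v.
Proof. by rewrite dotMl mulmxA rotmxK mul_scalar_mx dotZr. Qed.

Lemma norm2N (a : 'rV[A]_4) : norm2 (- a) = norm2 a.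
Proof. by rewrite (quat_eta a) opp_quat !norm2_quat; ring. Qed.

Lemma norm2_qconj (a : 'rV[A]_4) : norm2 (qconj a) = norm2 a.
Proof. by rewrite (quat_eta a) /qconj !quatE !norm2_quat; ring. Qed.

End Coordinates.

Section Orthonormal.

Variable A : comNzRingType.
Implicit Types (e f x w : 'cV[A]_3).

Definition orthoframe e f x : Prop :=
  [/\ dot e e = 1 /\ dot f f = 1, dot x x = 1,
      dot e f = 0, dot e x = 0 & dot f x = 0].

(** It is applied with polynomial entries, so no division is available: for a square matrix over a
    commutative ring [M *m M^T = 1] already gives [M^T *m M = 1]. *)
Lemma parseval e f x w : orthoframe e f x ->
  dot w w = dot e w ^+ 2 + dot f w ^+ 2 + dot x w ^+ 2.
Proof.
case=> [[ee ff] xx ef ex fx].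
pose M : 'M[A]_3 := \matrix_(i, j) (nth 0 [:: e; f; x] i) j 0.
have MV (v : 'cV[A]_3) : M *m v = vec3 (dot e v) (dot f v) (dot x v).
  by apply/colP; apply: ord3P;
    rewrite vec3E /dot !mxE; apply: eq_bigr => k _; rewrite !mxE.
have MT : M *m M^T = 1%:M.
  have colM i : col i M^T = nth 0 [:: e; f; x] i.
    by apply/colP => k; rewrite !mxE.
  apply/matrixP => i j.
  have -> : (M *m M^T) i j = (M *m col j M^T) i 0.
    by rewrite !mxE; apply: eq_bigr => k _; rewrite !mxE.
  rewrite colM MV; move: i j; apply: ord3P; apply: ord3P;
    by rewrite vec3E mxE /= ?ee ?ff ?xx ?(dotC x f) ?(dotC x e) ?(dotC f e) ?ef ?ex ?fx.
have := dotMr M^T w (M *m w); rewrite mulmxA (mulmx1C MT) mul1mx trmxK => ->.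
by rewrite MV dot_vec3 -!expr2.
Qed.

Lemma orthoframe_rotmx e f x (a : 'rV[A]_4) : norm2 a = 1 ->
  orthoframe e f x ->
  orthoframe ((rotmx a)^T *m e) ((rotmx a)^T *m f) ((rotmx a)^T *m x).
Proof.
move=> a1 [[ee ff] xx ef ex fx].
have E u v : dot ((rotmx a)^T *m u) ((rotmx a)^T *m v) = dot u v.
  by rewrite -rotmx_qconj dot_rotmx norm2_qconj a1 expr1n mul1r.
by split; rewrite ?E //; split; rewrite E.
Qed.

(** No normalization of [a] and [b] is assumed. With indeterminates in their place, this is the
    identity from which the certificate for [(s - 1) * (s + 1)] is read off. *)
Lemma dot_rotmx_parseval e f x y (a b : 'rV[A]_4) :
  orthoframe e f x -> dot y y = 1 ->
  dot (rotmx a *m e) (rotmx b *m y) ^+ 2 + dot (rotmx a *m f) (rotmx b *m y) ^+ 2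
  + dot (rotmx a *m x) (rotmx b *m y) ^+ 2 = norm2 a ^+ 2 * norm2 b ^+ 2.
Proof.
move=> onb yy; have := parseval ((rotmx a)^T *m (rotmx b *m y)) onb.
by rewrite -[in LHS]rotmx_qconj !dot_rotmx norm2_qconj yy mulr1 -!dotMl => ->.
Qed.

End Orthonormal.

Section Morphisms.

Variables (A B : comNzRingType) (phi : {rmorphism A -> B}).

Lemma map_rotmx (a : 'rV[A]_4) : map_mx phi (rotmx a) = rotmx (map_mx phi a).
Proof.
apply/matrixP; apply: ord3P; apply: ord3P;
  by rewrite !mxE /= !(rmorphD, rmorphN, rmorphXn, rmorphM, rmorph1).
Qed.

Lemma map_dot (u v : 'cV[A]_3) : phi (dot u v) = dot (map_mx phi u) (map_mx phi v).
Proof. by rewrite /dot map_trmx -map_mxM [RHS]mxE. Qed.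

Lemma map_norm2 (a : 'rV[A]_4) : phi (norm2 a) = norm2 (map_mx phi a).
Proof.
by rewrite /norm2 rmorph_sum; apply: eq_bigr => i _; rewrite mxE rmorphXn.
Qed.

(** For [phi] an evaluation, this turns the generators of a joint ideal into the joint equations at
    a point. *)
Lemma map_dot_rotmx (a b : 'rV[A]_4) (u v : 'cV[A]_3) :
  phi (dot (rotmx a *m u) (rotmx b *m v)) =
  dot (rotmx (map_mx phi a) *m map_mx phi u) (rotmx (map_mx phi b) *m map_mx phi v).
Proof. by rewrite map_dot !map_mxM !map_rotmx. Qed.

End Morphisms.

(** * The prime component of a joint *)

Section PrimeComponent.

Variables (R : realType) (n : nat).
Implicit Types (s : seq {mpoly R[n]}) (J : {pred {mpoly R[n]}}).

Lemma mem_in_ideal s f : f \in s -> in_ideal s f.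
Proof.
move=> fs; have lt_f : (index f s < size s)%N by rewrite index_mem.
exists (fun i => (i == Ordinal lt_f)%:R).
rewrite (bigD1 (Ordinal lt_f)) //= eqxx mul1r nth_index // big1 ?addr0 //.
by move=> i /negbTE ->; rewrite mul0r.
Qed.

Lemma in_ideal_vanish s f (x : 'rV[R]_n) :
  common_zeros s x -> in_ideal s f -> meval (x 0) f = 0.
Proof.
move=> xs [g ->]; rewrite rmorph_sum /= big1 // => i _.
rewrite mevalM (xs s`_i) ?mulr0 //.
exact: mem_nth.
Qed.

(** If some [f] in [J] does not vanish at [x], then for every [g] in [J'] the product [g * f] lies
    in both ideals, hence vanishes at [x], and so does [g]. *)
Lemma variety_inter J J' s (x : 'rV[R]_n) :
  (forall f, f \in J /\ f \in J' -> in_ideal s f) ->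
  prime_ideal J -> prime_ideal J' ->
  common_zeros s x -> in_variety J x \/ in_variety J' x.
Proof.
move=> JJ' [[J0 _ Jid] _] [[J'0 _ J'id] _] xs.
have [|/existsNP [f /not_implyP [fJ fx]]] := pselect (in_variety J x); first by left.
right=> g gJ'; have : in_ideal s (g * f).
  apply: JJ'; split; first by have := Jid g _ _ fJ J0; rewrite addr0.
  by rewrite mulrC; have := J'id f _ _ gJ' J'0; rewrite addr0.
move=> /(in_ideal_vanish xs) /eqP; rewrite mevalM mulf_eq0 => /orP[] /eqP //.
Qed.

End PrimeComponent.

(** The equality case of Cauchy-Schwarz: [|u - v|^2 = 0]. *)
Lemma dot_eq1 (R : realType) (u v : 'cV[R]_3) :
  dot u u = 1 -> dot v v = 1 -> dot u v = 1 -> u = v.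
Proof.
rewrite (vec3_eta u) (vec3_eta v) !dot_vec3.
set x := u 0 0; set y := u 1 0; set z := u 2 0.
set x' := v 0 0; set y' := v 1 0; set z' := v 2 0 => uu vv uv.
have : (x - x') ^+ 2 + (y - y') ^+ 2 + (z - z') ^+ 2 = 0.
  by apply: (lincomb3 1 1 (-2) uu vv uv); ring.
move/eqP; rewrite !paddr_eq0 ?addr_ge0 ?sqr_ge0 // !sqrf_eq0 !subr_eq0.
by case/andP=> /andP[/eqP -> /eqP ->] /eqP ->.
Qed.

Section JointComponent.

Variable R : realType.
Implicit Types (e f x y : 'cV[R]_3) (a b : 'rV[R]_4) (J : {pred {mpoly R[4 + 4]}}).

Let X : 'rV[{mpoly R[4 + 4]}]_4 := \row_j mpolyX R (mnm1 (lshift 4 j)).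
Let Y : 'rV[{mpoly R[4 + 4]}]_4 := \row_j mpolyX R (mnm1 (rshift 4 j)).
Let C (u : 'cV[R]_3) := map_mx (@mpolyC (4 + 4) R) u.

Let at_ a b := meval (row_mx a b 0).

Let at_X a b : map_mx (at_ a b) X = a.
Proof. by apply/rowP => j; rewrite !mxE /at_ mevalXU row_mxEl. Qed.

Let at_Y a b : map_mx (at_ a b) Y = b.
Proof. by apply/rowP => j; rewrite !mxE /at_ mevalXU row_mxEr. Qed.

Let at_C a b u : map_mx (at_ a b) (C u) = u.
Proof. by apply/colP => j; rewrite !mxE /at_ mevalC. Qed.

Let at_dot a b u v :
  at_ a b (dot (rotmx X *m C u) (rotmx Y *m C v)) = dot (rotmx a *m u) (rotmx b *m v).
Proof. by rewrite /at_ map_dot_rotmx at_X at_Y !at_C. Qed.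

Let dotC_C u v : dot (C u) (C v) = mpolyC (4 + 4) (dot u v).
Proof. by rewrite -map_dot. Qed.

Lemma common_zeros_joint e f y a b :
  common_zeros (joint_ideal e f y) (row_mx a b) <->
  [/\ norm2 a = 1, norm2 b = 1, dot (rotmx a *m e) (rotmx b *m y) = 0
     & dot (rotmx a *m f) (rotmx b *m y) = 0].
Proof.
have at_norm1 : at_ a b (norm2 X - 1) = norm2 a - 1.
  by rewrite /at_ mevalB meval1 map_norm2 at_X.
have at_norm2 : at_ a b (norm2 Y - 1) = norm2 b - 1.
  by rewrite /at_ mevalB meval1 map_norm2 at_Y.
split=> [z | [a1 b1 ez fz] g].
  have z' i : (i < 4)%N -> at_ a b (joint_ideal e f y)`_i = 0.
    by move=> i4; apply: z; apply: mem_nth.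
  split; [have := z' 2%N isT | have := z' 3%N isT | have := z' 0%N isT | have := z' 1%N isT].
  - by move/eqP; rewrite [X in X == _]at_norm1 subr_eq0 => /eqP.
  - by move/eqP; rewrite [X in X == _]at_norm2 subr_eq0 => /eqP.
  - by rewrite [X in X = _]at_dot.
  - by rewrite [X in X = _]at_dot.
rewrite !inE => /or4P[] /eqP ->.
- by rewrite [LHS]at_dot.
- by rewrite [LHS]at_dot.
- by rewrite [LHS]at_norm1 a1 subrr.
- by rewrite [LHS]at_norm2 b1 subrr.
Qed.

(** A unit vector read as a pure quaternion is the half turn about that vector, and it reverses
    everything orthogonal to it. *)
Lemma rotmx_half_turn e f x : orthoframe e f x ->
  rotmx (quat 0 (e 0 0) (e 1 0) (e 2 0)) *m x = - x.
Proof.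
case=> [[+ _] _ _ + _]; rewrite (vec3_eta e) (vec3_eta x) !dot_vec3 !vec3E.
set e0 := e 0 0; set e1 := e 1 0; set e2 := e 2 0.
set x0 := x 0 0; set x1 := x 1 0; set x2 := x 2 0 => ee ex.
rewrite rotmx_vec3 -[RHS]scaleN1r scale_vec3; congr vec3.
- by apply: (lincomb2 (- x0) (2 * e0) ee ex); ring.
- by apply: (lincomb2 (- x1) (2 * e1) ee ex); ring.
- by apply: (lincomb2 (- x2) (2 * e2) ee ex); ring.
Qed.

(* With [s = <R(x) chi, R(y) chi'>], the product [(s - 1)(s + 1)] lies in the
   ideal of the joint, so a prime component containing the initial point
   contains [s - 1]: both bodies then see the oriented axis at the same place. *)
Lemma prime_component_joint e f x y a0 b0 J :
  orthoframe e f x -> dot y y = 1 -> rotmx a0 *m x = rotmx b0 *m y ->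
  prime_component (joint_ideal e f y) (row_mx a0 b0) J ->
  forall a b, in_variety J (row_mx a b) <->
    [/\ norm2 a = 1, norm2 b = 1 & rotmx a *m x = rotmx b *m y].
Proof.
move=> onb yy xy0 [pJ J0 [J' [pJ' J'0 JJ']]].
have [[ee ff] xx ef ex fx] := onb.
pose s := dot (rotmx X *m C x) (rotmx Y *m C y).
have s_ideal : in_ideal (joint_ideal e f y) ((s - 1) * (s + 1)).
  pose E := dot (rotmx X *m C e) (rotmx Y *m C y).
  pose F := dot (rotmx X *m C f) (rotmx Y *m C y).
  have sE : E ^+ 2 + F ^+ 2 + s ^+ 2 = norm2 X ^+ 2 * norm2 Y ^+ 2.
    have onC : orthoframe (C e) (C f) (C x).
      by split; rewrite !dotC_C ?ee ?ff ?xx ?ef ?ex ?fx ?mpolyC0 ?mpolyC1.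
    have yyC : dot (C y) (C y) = 1 by rewrite dotC_C yy mpolyC1.
    exact: (dot_rotmx_parseval X Y onC yyC).
  (* With [N = norm2 X] and [P = norm2 Y], Parseval gives [s^2 - 1 = N^2 P^2 - 1 - E^2 - F^2], and
     [N^2 P^2 - 1 = (N - 1)(N + 1) P^2 + (P - 1)(P + 1)]. *)
  exists (fun i => [:: - E; - F; (norm2 X + 1) * norm2 Y ^+ 2; norm2 Y + 1]`_i).
  rewrite !big_ord_recr big_ord0 /= add0r.
  transitivity (norm2 X ^+ 2 * norm2 Y ^+ 2 - 1 - E ^+ 2 - F ^+ 2).
    by rewrite -sE; ring.
  rewrite -/E -/F -/X -/Y; ring.
have ideal_zero z : in_ideal (joint_ideal e f y) z -> z \in J by move/JJ' => [].
have zJ a b : in_variety J (row_mx a b) -> common_zeros (joint_ideal e f y) (row_mx a b).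
  by move=> Jab g /mem_in_ideal /ideal_zero /Jab.
have unit_dot a b : norm2 a = 1 -> rotmx a *m x = rotmx b *m y -> at_ a b s = 1.
  by move=> a1 xy; rewrite at_dot -xy dot_rotmx xx a1 expr1n mulr1.
have := ideal_zero _ s_ideal.
have [a01 b01 _ _] : _ := (common_zeros_joint _ _ _ _ _).1 (zJ _ _ J0).
move=> /pJ.2 /orP[sJ | /J0]; last first.
  rewrite [LHS](_ : _ = at_ a0 b0 s + 1); last by rewrite /at_ mevalD meval1.
  by rewrite unit_dot // => /eqP; rewrite (_ : 1 + 1 = 2%:R) // pnatr_eq0.
move=> a b; split=> [Jab | [a1 b1 xy]].
  have [a1 b1 _ _] := (common_zeros_joint _ _ _ _ _).1 (zJ _ _ Jab).
  split=> //; apply: dot_eq1; rewrite ?dot_rotmx ?a1 ?b1 ?xx ?yy ?expr1n ?mulr1 //.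
  have /eqP := Jab _ sJ; rewrite [X in X == _](_ : _ = at_ a b s - 1).
    by rewrite at_dot subr_eq0 => /eqP.
  by rewrite /at_ mevalB meval1.
have zab : common_zeros (joint_ideal e f y) (row_mx a b).
  apply/common_zeros_joint; split; rewrite -?xy ?dot_rotmx ?ex ?fx ?mulr0 //.
(* Either [(a, b)] is a zero of [J], as claimed, or of [J']. In the latter case primality puts
   [s - 1] or [s + 1] into [J'], and [s + 1] takes the value 2 at [(a, b)]. *)
have [//|J'ab] := variety_inter (fun z => (JJ' z).2) pJ pJ' zab.
have /pJ'.2 /orP[sJ' | /J'ab] : (s - 1) * (s + 1) \in J' by case/JJ': s_ideal.
  (* [s - 1] would lie in the ideal of the joint, but the half turn about [e]
     reverses the axis and gives a zero of that ideal with [s = -1]. *)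
  pose a' := qmul a0 (quat 0 (e 0 0) (e 1 0) (e 2 0)).
  have a'x : rotmx a' *m x = - (rotmx b0 *m y).
    by rewrite rotmxM -mulmxA (rotmx_half_turn onb) mulmxN xy0.
  have a'1 : norm2 a' = 1.
    rewrite norm2M a01 mul1r norm2_quat -ee [in RHS](vec3_eta e) dot_vec3; ring.
  have za' : common_zeros (joint_ideal e f y) (row_mx a' b0).
    apply/common_zeros_joint; split=> //.
      by rewrite -[rotmx b0 *m y]opprK -a'x dotNr dot_rotmx ex mulr0 oppr0.
    by rewrite -[rotmx b0 *m y]opprK -a'x dotNr dot_rotmx fx mulr0 oppr0.
  have /eqP : at_ a' b0 (s - 1) = 0 by apply: (in_ideal_vanish za'); apply/JJ'.
  rewrite /at_ mevalB meval1 [X in X - 1]at_dot.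
  rewrite -[rotmx b0 *m y]opprK -a'x dotNr dot_rotmx xx a'1 expr1n mulr1.
  by rewrite -opprD oppr_eq0 (_ : 1 + 1 = 2%:R) // pnatr_eq0.
rewrite [LHS](_ : _ = at_ a b s + 1); last by rewrite /at_ mevalD meval1.
by rewrite unit_dot // => /eqP; rewrite (_ : 1 + 1 = 2%:R) // pnatr_eq0.
Qed.

End JointComponent.

(** * The reduced mechanism *)

Section Reduced.

Variables (R : realType) (m0 m2 : R).
Hypotheses (m0_neq0 : m0 != 0) (m2_neq0 : m2 != 0).
Hypotheses (m2_neq1 : m2 != 1) (m2_neqN1 : m2 != -1).

Let q : R := q m0 m2.
Let r : R := r m0 m2.

(* cos_alpha + i sin_alpha = u^2 / |u|^2 and cos_beta + i sin_beta = v^2 / |v|^2 *)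
Definition cos_alpha : R := ((m0 * (m2 - 1)) ^+ 2 - (m2 + 1) ^+ 2) / q.
Definition sin_alpha : R := 2 * m0 * (m2 ^+ 2 - 1) / q.
Definition cos_beta : R := (m0 ^+ 2 - 1) / (m0 ^+ 2 + 1).
Definition sin_beta : R := 2 * m0 / (m0 ^+ 2 + 1).

Local Notation k := cos_alpha.
Local Notation l := sin_alpha.
Local Notation g := cos_beta.
Local Notation f := sin_beta.

Lemma m0D1_neq0 : m0 ^+ 2 + 1 != 0.
Proof. by rewrite lt0r_neq0 // ltr_wpDl ?sqr_ge0. Qed.

Lemma q_gt0 : 0 < q.
Proof.
rewrite /q /Defs.q ltr_pwDl // ?sqr_ge0 // mulr_gt0 //.
  by rewrite lt0r sqrf_eq0 m0_neq0 sqr_ge0.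
by rewrite lt0r sqrf_eq0 subr_eq0 m2_neq1 sqr_ge0.
Qed.

Lemma q_neq0 : q != 0. Proof. exact: lt0r_neq0 q_gt0. Qed.

Let D0 := m0D1_neq0.
Let Dq : (m0 * (m2 - 1)) ^+ 2 + (m2 + 1) ^+ 2 != 0.
Proof. by rewrite exprMn; exact: q_neq0. Qed.

Lemma r_neq0 : r != 0.
Proof.
rewrite /r /Defs.r !mulf_neq0 ?D0 ?invr_neq0 ?q_neq0 //.
by rewrite -(expr1n _ 2) subr_sqr mulf_neq0 //; [rewrite subr_eq0 eq_sym | rewrite addrC addr_eq0].
Qed.

Lemma sin_beta_neq0 : f != 0.
Proof. by rewrite /f !mulf_neq0 ?invr_neq0 ?D0 // pnatr_eq0. Qed.

Lemma alpha_unit : k ^+ 2 + l ^+ 2 = 1.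
Proof. by rewrite /k /l /q /Defs.q; field; rewrite Dq. Qed.

Lemma beta_unit : g ^+ 2 + f ^+ 2 = 1.
Proof. by rewrite /g /f; field; rewrite D0. Qed.

Lemma sin_alphaE : l = - (r * f).
Proof. by rewrite /l /f /r /Defs.r /q /Defs.q; field; rewrite D0 Dq. Qed.

Lemma sin_alpha_neq0 : l != 0.
Proof. by rewrite sin_alphaE oppr_eq0 mulf_neq0 ?r_neq0 ?sin_beta_neq0. Qed.

(** This and [bennett_rel2] are how [m2] enters the reduced mechanism: they let the two loop
    conditions in [factor_a] and [factor_c] split off [x0 y0 + m2 x2 y2]. *)
Lemma bennett_rel1 : 1 - r = - m2 * (k + g * r).
Proof. by rewrite /k /g /r /Defs.r /q /Defs.q; field; rewrite D0 Dq. Qed.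

Lemma bennett_rel2 : k - g * r = - m2 * (1 + r).
Proof. by rewrite /k /g /r /Defs.r /q /Defs.q; field; rewrite D0 Dq. Qed.

(** For unit [(x0, x2)], [c] and [s] are the cosine and sine of the joint angle. The vector is the
    axis joining bodies [a] and [b], as carried by body [a]; [axis_c] is the axis joining [b] and
    [c], as carried by [c]. *)
Definition axis_a (x0 x2 : R) : 'cV[R]_3 :=
  let c := x0 ^+ 2 - x2 ^+ 2 in let s := 2 * x0 * x2 in
  vec3 (- (s * l)) (g * k + f * c * l) (f * k - g * c * l).

Definition axis_c (y0 y2 : R) : 'cV[R]_3 :=
  let c := y0 ^+ 2 - y2 ^+ 2 in let s := 2 * y0 * y2 in vec3 (s * l) k (c * l).

Definition link_a (x0 x2 : R) : 'cV[R]_3 :=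
  let c := x0 ^+ 2 - x2 ^+ 2 in let s := 2 * x0 * x2 in vec3 c (f * s) (- (g * s)).

Definition link_c (y0 y2 : R) : 'cV[R]_3 :=
  let c := y0 ^+ 2 - y2 ^+ 2 in let s := 2 * y0 * y2 in vec3 c 0 (- s).

Let e1 : 'cV[R]_3 := vec3 1 0 0.

(** The formulas for [b] after removal of the constant factors; it is bilinear in [(x0, x2)] and
    [(y0, y2)]. *)
Definition quat_b (x0 x2 y0 y2 : R) : 'rV[R]_4 := quat
  ((m2 ^+ 2 - 1) * q4 m0 m2 / (m2 * q) * (x0 * y0))
  ((m2 ^+ 2 - 1) * (2 * m0) / (m2 * q) * (x0 * y0))
  (g * (k * (x0 * y2) + x2 * y0) + f * l * (x0 * y2))
  (f * (k * (x0 * y2) + x2 * y0) - g * l * (x0 * y2)).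

(** The two joint axes of body [b] in its own reduced coordinates: they are orthogonal to the link
    [e1] and enclose the angle beta. *)
Definition axis_b2 : 'cV[R]_3 := vec3 0 (k * g + l * f) (k * f - l * g).
Definition axis_b3 : 'cV[R]_3 :=
  vec3 0 (k * (g ^+ 2 - f ^+ 2) + l * (2 * g * f)) (k * (2 * g * f) - l * (g ^+ 2 - f ^+ 2)).

Section Closure.

Variables (x0 x2 y0 y2 : R).
Hypotheses (x_unit : x0 ^+ 2 + x2 ^+ 2 = 1) (y_unit : y0 ^+ 2 + y2 ^+ 2 = 1).
Hypothesis xy : x0 * y0 + m2 * (x2 * y2) = 0.

(* The relation [xy] makes (x0, x2) a multiple of (- m2 y2, y0). *)
Let xyP : exists s, x0 = - (m2 * y2 * s) /\ x2 = y0 * s.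
Proof.
exists (x2 * y0 - x0 * y2 / m2); split.
  by apply: (lincomb2 (- x0) y0 y_unit xy); field.
by apply: (lincomb2 (- x2) (y2 / m2) y_unit xy); field.
Qed.

(** This identity and the next three are first made homogeneous, 1 being replaced by
    [x0 ^+ 2 + x2 ^+ 2] and [y0 ^+ 2 + y2 ^+ 2]. After the substitution [xyP] they hold identically
    in [s], [y0] and [y2]. *)
Lemma norm2_quat_b : norm2 (quat_b x0 x2 y0 y2) = 1.
Proof.
transitivity ((x0 ^+ 2 + x2 ^+ 2) * (y0 ^+ 2 + y2 ^+ 2)); last first.
  by rewrite x_unit y_unit mul1r.
have [s [-> ->]] := xyP.
rewrite norm2_quat /k /l /g /f /q4 /q /Defs.q.
by field; rewrite m2_neq0 D0 Dq.
Qed.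

Lemma rotmx_quat_b_axis2 : rotmx (quat_b x0 x2 y0 y2) *m axis_b2 = axis_a x0 x2.
Proof.
transitivity ((y0 ^+ 2 + y2 ^+ 2) *: vec3 (- (2 * x0 * x2 * l))
  (g * k * (x0 ^+ 2 + x2 ^+ 2) + f * (x0 ^+ 2 - x2 ^+ 2) * l)
  (f * k * (x0 ^+ 2 + x2 ^+ 2) - g * (x0 ^+ 2 - x2 ^+ 2) * l)); last first.
  by rewrite x_unit y_unit scale1r !mulr1.
have [s [-> ->]] := xyP.
rewrite rotmx_vec3 scale_vec3 /k /l /g /f /q4 /q /Defs.q.
by congr vec3; field; rewrite m2_neq0 D0 Dq.
Qed.

Lemma rotmx_quat_b_axis3 : rotmx (quat_b x0 x2 y0 y2) *m axis_b3 = axis_c y0 y2.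
Proof.
transitivity ((x0 ^+ 2 + x2 ^+ 2) *: vec3 (2 * y0 * y2 * l)
  (k * (y0 ^+ 2 + y2 ^+ 2)) ((y0 ^+ 2 - y2 ^+ 2) * l)); last first.
  by rewrite x_unit y_unit scale1r !mulr1.
have [s [-> ->]] := xyP.
rewrite rotmx_vec3 scale_vec3 /k /l /g /f /q4 /q /Defs.q.
by congr vec3; field; rewrite m2_neq0 D0 Dq.
Qed.

Lemma loop_quat_b :
  e1 + r *: link_a x0 x2 + rotmx (quat_b x0 x2 y0 y2) *m e1 + r *: link_c y0 y2 = 0.
Proof.
have: ((x0 ^+ 2 + x2 ^+ 2) * (y0 ^+ 2 + y2 ^+ 2)) *: e1
  + (r * (y0 ^+ 2 + y2 ^+ 2)) *: link_a x0 x2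
  + rotmx (quat_b x0 x2 y0 y2) *m e1
  + (r * (x0 ^+ 2 + x2 ^+ 2)) *: link_c y0 y2 = 0; last first.
  by rewrite x_unit y_unit !mulr1 scale1r.
have [s [-> ->]] := xyP.
rewrite [in RHS]vec30 rotmx_vec3 !scale_vec3 !add_vec3.
rewrite /r /Defs.r /k /l /g /f /q4 /q /Defs.q.
by congr vec3; field; rewrite m2_neq0 D0 Dq.
Qed.

End Closure.

Section Forward.

Variables (x0 x2 y0 y2 : R).
Hypotheses (x_unit : x0 ^+ 2 + x2 ^+ 2 = 1) (y_unit : y0 ^+ 2 + y2 ^+ 2 = 1).

(** By the loop equation [- u] is the image of the link of body [b], so [u] has length 1 and is
    orthogonal to both axes of that body. *)
Let u := e1 + r *: link_a x0 x2 + r *: link_c y0 y2.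

Let pE : m2 * (1 + r) = - (k - g * r).
Proof. by rewrite bennett_rel2; ring. Qed.

Let p'E : 1 - r = - (m2 * (k + g * r)).
Proof. by rewrite bennett_rel1; ring. Qed.

Let rf_neq0 : r * f != 0.
Proof. by rewrite mulf_neq0 ?r_neq0 ?sin_beta_neq0. Qed.

Let two_neq0 : 2 != 0 :> R. Proof. by rewrite pnatr_eq0. Qed.

Let factor_a : dot u (axis_a x0 x2) = 0 ->
  (x0 * y0 + m2 * (x2 * y2)) * (m2 * (1 + r) * (x2 * y0) + (1 - r) * (x0 * y2)) = 0.
Proof.
rewrite /u !scale_vec3 !add_vec3 dot_vec3 => H.
(* Since [l = - (r * f)], the condition is divisible by [r * f]. Exchanging [x] and [y] in the
   quotient gives its counterpart in [factor_c]. *)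
have T : 2 * (x0 * x2) * (1 + r * (y0 ^+ 2 - y2 ^+ 2))
    - 2 * (y0 * y2) * (k + g * r * (x0 ^+ 2 - x2 ^+ 2)) = 0.
  apply: (mulfI rf_neq0); rewrite mulr0.
  apply: (lincomb2 1 (- (r * (x0 ^+ 2 - x2 ^+ 2) * (2 * x0 * x2) * l)) H beta_unit).
  by rewrite sin_alphaE; ring.
apply: (mulfI two_neq0); rewrite mulr0.
(* Modulo the unit equations and the two Bennett relations, [m2] times the left side of [T] is twice
   the product of the two bilinear forms. *)
apply: (lincomb5 m2 (2 * m2 * (x0 * x2)) (- (2 * m2 * k * (y0 * y2)))
  (2 * x0 ^+ 2 * (y0 * y2)) (2 * m2 * x2 ^+ 2 * (y0 * y2)) T y_unit x_unit p'E pE).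
ring.
Qed.

Let factor_c : dot u (axis_c y0 y2) = 0 ->
  (x0 * y0 + m2 * (x2 * y2)) * (m2 * (1 + r) * (x0 * y2) + (1 - r) * (x2 * y0)) = 0.
Proof.
rewrite /u !scale_vec3 !add_vec3 dot_vec3 => H.
have T : 2 * (y0 * y2) * (1 + r * (x0 ^+ 2 - x2 ^+ 2))
    - 2 * (x0 * x2) * (k + g * r * (y0 ^+ 2 - y2 ^+ 2)) = 0.
  apply: (mulfI rf_neq0); rewrite mulr0.
  by apply: (lincomb1 (-1) H); rewrite sin_alphaE; ring.
apply: (mulfI two_neq0); rewrite mulr0.
apply: (lincomb5 m2 (2 * m2 * (y0 * y2)) (- (2 * m2 * k * (x0 * x2)))
  (2 * y0 ^+ 2 * (x0 * x2)) (2 * m2 * y2 ^+ 2 * (x0 * x2)) T x_unit y_unit p'E pE).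
ring.
Qed.

(** The second factors of [factor_a] and [factor_c] are linear in [x2 * y0] and [x0 * y2], with this
    determinant. If it vanished, [k] would be 1 or -1, hence [l = 0]. *)
Let det_neq0 : (m2 * (1 + r)) ^+ 2 - (1 - r) ^+ 2 != 0.
Proof.
have l_neq0 : k ^+ 2 != 1.
  by rewrite -alpha_unit -subr_eq0 opprD addrA subrr sub0r oppr_eq0 sqrf_eq0 sin_alpha_neq0.
rewrite subr_sqr mulf_neq0 //; apply: contra l_neq0 => /eqP E.
  have -> : k = -1; last by rewrite sqrrN expr1n.
  apply: (mulfI m2_neq0).
  by apply: (lincomb3 (1 / 2) (m2 / 2) (- (m2 - 1) / 2) p'E pE E); field.
have -> : k = 1; last by rewrite expr1n.
apply: (mulfI m2_neq0).
by apply: (lincomb3 (1 / 2) (m2 / 2) (- (m2 + 1) / 2) p'E pE E); field.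
Qed.

Let four_neq0 : 4 != 0 :> R. Proof. by rewrite pnatr_eq0. Qed.

(* When both bilinear forms vanish, all links are parallel and r = 1 or -1. *)
Let not_folded : dot (axis_a x0 x2) (axis_c y0 y2) = g -> dot u u = 1 ->
  x2 * y0 = 0 -> x0 * y2 = 0 -> False.
Proof.
rewrite /u !scale_vec3 !add_vec3 !dot_vec3 => H uu.
(* In both folded cases [k = - g] and [l] is [f] or [- f], so the angle condition [H] shrinks to
   [g * f ^+ 2 = 0]. Then [g = 0] gives [k = g], which the Bennett relations exclude. *)
have g_absurd : 4 * (g * f ^+ 2) = 0 -> k = - g -> k - g != 0 -> False.
  move/eqP; rewrite mulf_eq0 (negbTE four_neq0) mulf_eq0 sqrf_eq0 (negbTE sin_beta_neq0) orbF /=.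
  by move=> /eqP g0 kE; rewrite kE g0 oppr0 addr0 eqxx.
move/eqP; rewrite mulf_eq0 => /orP[] /eqP E; move/eqP; rewrite mulf_eq0 => /orP[] /eqP E'.
- by move/eqP: x_unit; rewrite E E' expr0n addr0 eq_sym oner_eq0.
- have x1 : x0 ^+ 2 = 1 by rewrite -x_unit E expr0n addr0.
  have y1 : y0 ^+ 2 = 1 by rewrite -y_unit E' expr0n addr0.
  move: H uu; rewrite E E' x1 y1 => H uu.
  have /(mulfI four_neq0) : 4 * (r * (1 + r)) = 4 * 0 by apply: (lincomb1 1 uu); ring.
  move/eqP; rewrite mulf_eq0 (negbTE r_neq0) addrC addr_eq0 /= => /eqP rE.
  have kE : k = - g by apply: (lincomb2 1 (g - m2) pE rE); ring.
  have lE : l = f by rewrite sin_alphaE rE; ring.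
  apply: g_absurd => //.
    by move: H; rewrite kE lE => H; apply: (lincomb2 (-1) g H beta_unit); ring.
  apply/eqP => kg; have /eqP : 2 = 0 :> R.
    by apply: (lincomb3 1 (- m2) (1 - m2 * g) p'E kg rE); ring.
  by rewrite (negbTE two_neq0).
- have x1 : x2 ^+ 2 = 1 by rewrite -x_unit E' expr0n add0r.
  have y1 : y2 ^+ 2 = 1 by rewrite -y_unit E expr0n add0r.
  move: H uu; rewrite E E' x1 y1 => H uu.
  have /(mulfI four_neq0) : 4 * (r * (r - 1)) = 4 * 0 by apply: (lincomb1 1 uu); ring.
  move/eqP; rewrite mulf_eq0 (negbTE r_neq0) subr_eq0 /= => /eqP rE.
  have kE : k = - g.
    apply: (mulfI m2_neq0); apply: (lincomb2 1 (1 - m2 * g) p'E rE); ring.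
  have lE : l = - f by rewrite sin_alphaE rE; ring.
  apply: g_absurd => //.
    by move: H; rewrite kE lE => H; apply: (lincomb2 (-1) g H beta_unit); ring.
  apply/eqP => kg; move/eqP: m2_neq0; apply; apply: (mulfI two_neq0).
  by apply: (lincomb3 1 (-1) (g - m2) pE kg rE); ring.
- by move/eqP: y_unit; rewrite E E' expr0n addr0 eq_sym oner_eq0.
Qed.

Lemma closure_relation :
  dot u (axis_a x0 x2) = 0 -> dot u (axis_c y0 y2) = 0 ->
  dot (axis_a x0 x2) (axis_c y0 y2) = g -> dot u u = 1 ->
  x0 * y0 + m2 * (x2 * y2) = 0.
Proof.
move=> /factor_a /eqP + /factor_c /eqP + ac uu.
rewrite !mulf_eq0; case: eqP => //= _ /eqP Ea /eqP Ec; exfalso.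
apply: not_folded => //; apply: (mulfI det_neq0); rewrite mulr0.
  by apply: (lincomb2 (m2 * (1 + r)) (- (1 - r)) Ea Ec); ring.
by apply: (lincomb2 (- (1 - r)) (m2 * (1 + r)) Ea Ec); ring.
Qed.

End Forward.

End Reduced.

Section QuaternionFactors.

Variable R : realType.
Implicit Types (a b c p L B : 'rV[R]_4) (z u : 'cV[R]_3).

Lemma qmulA a b c : qmul a (qmul b c) = qmul (qmul a b) c.
Proof.
rewrite (quat_eta a) (quat_eta b) (quat_eta c) !qmul_quat.
by congr quat; ring.
Qed.

Definition e1 : 'cV[R]_3 := vec3 1 0 0.

Lemma rotmx_e1 (b0 b1 : R) :
  rotmx (quat b0 b1 0 0) *m e1 = norm2 (quat b0 b1 0 0) *: e1.
Proof. by rewrite rotmx_vec3 norm2_quat scale_vec3; congr vec3; ring. Qed.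

Lemma rotmx_tr_e1 (b0 b1 : R) :
  (rotmx (quat b0 b1 0 0))^T *m e1 = norm2 (quat b0 b1 0 0) *: e1.
Proof.
rewrite -rotmx_qconj /qconj !quatE oppr0 rotmx_e1 !norm2_quat.
by congr (_ *: _); ring.
Qed.

(** Removes the constant factors of a body: the right one is absorbed by the body frame, the left
    one by the fixed frame, and only [p] depends on the position. *)
Lemma rotmx_factors kappa L p B z :
  kappa ^+ 2 * (norm2 L * norm2 B) = 1 ->
  rotmx (kappa *: qmul (qmul L p) B) *m ((norm2 B)^-1 *: ((rotmx B)^T *m z)) =
  (norm2 L)^-1 *: (rotmx L *m (rotmx p *m z)).
Proof.
move=> kLB; have : kappa ^+ 2 * (norm2 L * norm2 B) != 0 by rewrite kLB oner_eq0.
rewrite !mulf_eq0 !negb_or => /and3P[_ L0 B0].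
rewrite rotmxZ !rotmxM -scalemxAl -scalemxAr -!mulmxA.
rewrite (mulmxA (rotmx B)) rotmxKV mul_scalar_mx -!scalemxAr !scalerA.
congr (_ *: _); apply: (mulIf L0); rewrite mulVf // -kLB.
by field.
Qed.

(** Body coordinates are defined through the initial orientation [a']; they recover the body vector
    [z] that [a'] carries to [u']. *)
Lemma rotmx_transport a a' z u u' : norm2 a' = 1 ->
  rotmx a *m z = u -> rotmx a' *m z = u' -> rotmx a *m ((rotmx a')^T *m u') = u.
Proof.
by move=> a1 <- <-; rewrite (mulmxA (rotmx a')^T) rotmxK a1 expr1n mul1mx.
Qed.

(** The unit quaternion [qmul (qconj b') b] fixes the two orthogonal vectors [e1] and [z], hence is
    1 or -1. *)
Lemma rotmx_inj b b' z : norm2 b = 1 -> norm2 b' = 1 ->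
  dot e1 z = 0 -> dot z z = 1 ->
  rotmx b *m e1 = rotmx b' *m e1 -> rotmx b *m z = rotmx b' *m z ->
  b = b' \/ b = - b'.
Proof.
move=> b1 b'1 e1z zz E1 Ez.
pose d := qmul (qconj b') b.
have d1 : norm2 d = 1 by rewrite norm2M norm2_qconj b1 b'1 mulr1.
have dv (v : 'cV[R]_3) : rotmx b *m v = rotmx b' *m v -> rotmx d *m v = v.
  by move=> E; rewrite rotmxM -mulmxA E mulmxA rotmx_qconj rotmxK b'1 expr1n mul1mx.
have bd : qmul b' d = b.
  by rewrite qmulA mulqconj b'1 (quat_eta b) qmul_quat; congr quat; ring.
move: d1 (dv _ E1) (dv _ Ez) bd e1z zz; rewrite (quat_eta d) (vec3_eta z).
set d0 := d 0 0; set d1 := d 0 1; set d2 := d 0 2; set d3 := d 0 3.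
rewrite norm2_quat !rotmx_vec3 !dot_vec3 => dd /vec3_inj[de _ _] dz <- e1z zz.
have /eqP : d2 ^+ 2 + d3 ^+ 2 = 0 by apply: (lincomb2 (1 / 2) (- 1 / 2) dd de); field.
rewrite paddr_eq0 ?sqr_ge0 // !sqrf_eq0 => /andP[/eqP d20 /eqP d30].
move: dz dd; rewrite d20 d30 => dz dd.
have z0 : z 0 0 = 0 by rewrite -e1z; ring.
move: dz zz; rewrite z0 => /vec3_inj[_ dy dz] zz.
have /eqP : d1 ^+ 2 = 0.
  apply: (lincomb4 (- (z 1 0) / 2) (- (z 2 0) / 2) (1 / 2 * (z 1 0 ^+ 2 + z 2 0 ^+ 2)) (- d1 ^+ 2) dy dz dd zz).
  by field.
rewrite sqrf_eq0 => /eqP d10.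
have : d0 ^+ 2 == 1 ^+ 2 by rewrite -[X in _ == X]mulr1 expr1n mul1r -dd d10; apply/eqP; ring.
rewrite eqf_sqr d10 => /orP[] /eqP ->; [left|right]; rewrite (quat_eta b') qmul_quat.
  by congr quat; ring.
by rewrite opp_quat; congr quat; ring.
Qed.

End QuaternionFactors.

(** * The three moving bodies *)

Section QuarterTurn.

Variable R : realType.

(* Conjugation by 1 + i: the common left factor of the three bodies. *)
Definition quarter_turn : 'M[R]_3 := 2^-1 *: rotmx (quat 1 1 0 0).

Local Notation rho := quarter_turn.

Lemma quarter_turn_vec3 (x y z : R) : rho *m vec3 x y z = vec3 x (- z) y.
Proof.
by rewrite /rho -scalemxAl rotmx_vec3 scale_vec3; congr vec3; field.
Qed.

Lemma dot_quarter_turn (u w : 'cV[R]_3) : dot (rho *m u) (rho *m w) = dot u w.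
Proof. by rewrite (vec3_eta u) (vec3_eta w) !quarter_turn_vec3 !dot_vec3; ring. Qed.

End QuarterTurn.

Section Bodies.

Variables (R : realType) (m0 m1 m2 : R).
Hypotheses (m0_neq0 : m0 != 0) (m1_neq0 : m1 != 0) (m2_neq0 : m2 != 0).
Hypotheses (m2_neq1 : m2 != 1) (m2_neqN1 : m2 != -1) (q5_neq0 : q5 m0 m1 != 0).

Local Notation k := (cos_alpha m0 m2).
Local Notation l := (sin_alpha m0 m2).
Local Notation g := (cos_beta m0).
Local Notation f := (sin_beta m0).
Local Notation r := (r m0 m2).
Local Notation q := (q m0 m2).
Local Notation q5 := (q5 m0 m1).
Local Notation e1 := (e1 R).

Let n1 := Num.sqrt (m1 ^+ 2 + 1).
Let n2 := Num.sqrt (m1 ^+ 2 + m2 ^+ 2).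
Let v2 := m0 ^+ 2 + 1.

Let n1E : n1 ^+ 2 = m1 ^+ 2 + 1.
Proof. by rewrite sqr_sqrtr // addr_ge0 ?sqr_ge0. Qed.

Let n2E : n2 ^+ 2 = m1 ^+ 2 + m2 ^+ 2.
Proof. by rewrite sqr_sqrtr // addr_ge0 ?sqr_ge0. Qed.

Lemma m1D1_gt0 : 0 < m1 ^+ 2 + 1. Proof. by rewrite ltr_wpDl ?sqr_ge0. Qed.

Lemma m1Dm2_gt0 : 0 < m1 ^+ 2 + m2 ^+ 2.
Proof. by rewrite ltr_wpDr ?sqr_ge0 // lt0r sqr_ge0 sqrf_eq0 m1_neq0. Qed.

Let n1_gt0 : 0 < n1. Proof. by rewrite sqrtr_gt0 m1D1_gt0. Qed.
Let n2_gt0 : 0 < n2. Proof. by rewrite sqrtr_gt0 m1Dm2_gt0. Qed.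
Let n1_neq0 : n1 != 0. Proof. exact: lt0r_neq0. Qed.
Let n2_neq0 : n2 != 0. Proof. exact: lt0r_neq0. Qed.
Let v2_neq0 : v2 != 0. Proof. exact: m0D1_neq0. Qed.
Let q_neq0 : q != 0. Proof. exact: q_neq0. Qed.

Let iota : 'rV[R]_4 := quat 1 1 0 0.
Let v : 'rV[R]_4 := quat m0 1 0 0.
Let Ba : 'rV[R]_4 := qmul (quat 1 m1 0 0) (qmul (quat m0 (-1) 0 0) (quat 1 (-1) 0 0)).
Let Bc : 'rV[R]_4 := qmul (quat m1 m2 0 0) (quat 1 (-1) 0 0).
(** Chosen so that [(1 + i) (q4 + 2 m0 i) Bb = 2 (q0 + q1 i)] as complex numbers, which matches the
    numerators of [t0] and [t1]. *)
Let Bb : 'rV[R]_4 :=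
  qmul (quat 1 (-1) 0 0) (qmul (quat m1 m2 0 0) (quat m1 (-1) 0 0)).

(* The factorizations mentioned at the top are [body_aE] and [body_cE]. *)
Definition body_a (x0 x2 : R) : 'rV[R]_4 := quat
  (x0 / n1) (m1 * x0 / n1) (q5 * x2 / (v2 * n1))
  ((m0 ^+ 2 + 2 * m0 * m1 - 1) * x2 / (v2 * n1)).

Definition body_c (y0 y2 : R) : 'rV[R]_4 := quat
  (m1 * y0 / n2) (m2 * y0 / n2) (m2 * y2 / n2) (m1 * y2 / n2).

Definition body_b (x0 x2 y0 y2 : R) : 'rV[R]_4 :=
  (2 * n1 * n2)^-1 *: qmul (qmul iota (quat_b m0 m2 x0 x2 y0 y2)) Bb.

Local Notation rho := (quarter_turn R).

Let body_aE x0 x2 : body_a x0 x2 =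
  (2 * v2 * n1)^-1 *: qmul (qmul (qmul iota v) (quat x0 0 x2 0)) Ba.
Proof.
rewrite /iota /v /Ba !qmul_quat !quatE scale_quat /body_a.
by congr quat; rewrite /Defs.q5 /v2; field; rewrite n1_neq0 v2_neq0.
Qed.

Let body_cE y0 y2 : body_c y0 y2 =
  (2 * n2)^-1 *: qmul (qmul iota (quat y0 0 y2 0)) Bc.
Proof.
rewrite /iota /Bc !qmul_quat !quatE scale_quat /body_c.
by congr quat; field; rewrite n2_neq0.
Qed.

Let norm2_iota : norm2 iota = 2. Proof. by rewrite norm2_quat; ring. Qed.
Let norm2_v : norm2 v = v2. Proof. by rewrite norm2_quat /v2; ring. Qed.
Let norm2_Ba : norm2 Ba = 2 * n1 ^+ 2 * v2.
Proof. by rewrite /Ba !qmul_quat ?quatE norm2_quat n1E /v2; ring. Qed.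
Let norm2_Bc : norm2 Bc = 2 * n2 ^+ 2.
Proof. by rewrite /Bc !qmul_quat ?quatE norm2_quat n2E; ring. Qed.
Let norm2_Bb : norm2 Bb = 2 * n1 ^+ 2 * n2 ^+ 2.
Proof. by rewrite /Bb !qmul_quat ?quatE norm2_quat n1E n2E; ring. Qed.

Let kappa_a : (2 * v2 * n1)^-1 ^+ 2 * (norm2 (qmul iota v) * norm2 Ba) = 1.
Proof. by rewrite norm2M norm2_iota norm2_v norm2_Ba; field; rewrite n1_neq0 v2_neq0. Qed.

Let kappa_c : (2 * n2)^-1 ^+ 2 * (norm2 iota * norm2 Bc) = 1.
Proof. by rewrite norm2_iota norm2_Bc; field; rewrite n2_neq0. Qed.

Let kappa_b : (2 * n1 * n2)^-1 ^+ 2 * (norm2 iota * norm2 Bb) = 1.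
Proof. by rewrite norm2_iota norm2_Bb; field; rewrite n1_neq0 n2_neq0. Qed.

Let norm2Z (t : R) (a : 'rV[R]_4) : norm2 (t *: a) = t ^+ 2 * norm2 a.
Proof. by rewrite (quat_eta a) scale_quat !norm2_quat; ring. Qed.

Lemma norm2_body_a x0 x2 : x0 ^+ 2 + x2 ^+ 2 = 1 -> norm2 (body_a x0 x2) = 1.
Proof.
move=> x1; rewrite body_aE norm2Z 2!norm2M (mulrAC (norm2 _)) mulrA kappa_a mul1r norm2_quat -x1; ring.
Qed.

Lemma norm2_body_c y0 y2 : y0 ^+ 2 + y2 ^+ 2 = 1 -> norm2 (body_c y0 y2) = 1.
Proof.
move=> y1; rewrite body_cE norm2Z 2!norm2M (mulrAC (norm2 _)) mulrA kappa_c mul1r norm2_quat -y1; ring.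
Qed.

Lemma norm2_body_b x0 x2 y0 y2 : x0 ^+ 2 + x2 ^+ 2 = 1 -> y0 ^+ 2 + y2 ^+ 2 = 1 ->
  x0 * y0 + m2 * (x2 * y2) = 0 -> norm2 (body_b x0 x2 y0 y2) = 1.
Proof.
move=> x1 y1 xy.
by rewrite norm2Z 2!norm2M (mulrAC (norm2 _)) mulrA kappa_b mul1r norm2_quat_b.
Qed.

(** The actual body vector that corresponds to the reduced vector [z] once the right factor [B] is
    put back. *)
Let zeta B z : 'cV[R]_3 := (norm2 B)^-1 *: ((rotmx B)^T *m z).

Let rotmx_body_a x0 x2 z : rotmx (body_a x0 x2) *m zeta Ba z =
  rho *m (v2^-1 *: (rotmx v *m (rotmx (quat x0 0 x2 0) *m z))).
Proof.
rewrite body_aE (rotmx_factors _ _ kappa_a) norm2M norm2_iota norm2_v rotmxM.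
by rewrite invfM /quarter_turn -scalemxAl -scalemxAr scalerA !mulmxA.
Qed.

Let rotmx_body_c y0 y2 z : rotmx (body_c y0 y2) *m zeta Bc z =
  rho *m (rotmx (quat y0 0 y2 0) *m z).
Proof.
by rewrite body_cE (rotmx_factors _ _ kappa_c) norm2_iota /quarter_turn -scalemxAl.
Qed.

Let rotmx_body_b x0 x2 y0 y2 z : rotmx (body_b x0 x2 y0 y2) *m zeta Bb z =
  rho *m (rotmx (quat_b m0 m2 x0 x2 y0 y2) *m z).
Proof.
by rewrite (rotmx_factors _ _ kappa_b) norm2_iota /quarter_turn -scalemxAl.
Qed.

Let zeta_e1 (b0 b1 : R) : norm2 (quat b0 b1 0 0) != 0 -> zeta (quat b0 b1 0 0) e1 = e1.
Proof. by move=> n0; rewrite /zeta rotmx_tr_e1 scalerA mulVf // scale1r. Qed.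

Let zeta_Ba : zeta Ba e1 = e1.
Proof.
have : norm2 Ba != 0 by rewrite norm2_Ba !mulf_neq0 ?expf_neq0 ?pnatr_eq0.
rewrite /Ba !qmul_quat ?quatE !(mulr0, mul0r, addr0, subr0, oppr0, sub0r, add0r).
exact: zeta_e1.
Qed.

Let zeta_Bc : zeta Bc e1 = e1.
Proof.
have : norm2 Bc != 0 by rewrite norm2_Bc !mulf_neq0 ?expf_neq0 ?pnatr_eq0.
rewrite /Bc !qmul_quat ?quatE !(mulr0, mul0r, addr0, subr0, oppr0, sub0r, add0r).
exact: zeta_e1.
Qed.

Let zeta_Bb : zeta Bb e1 = e1.
Proof.
have : norm2 Bb != 0 by rewrite norm2_Bb !mulf_neq0 ?expf_neq0 ?pnatr_eq0.
rewrite /Bb !qmul_quat ?quatE !(mulr0, mul0r, addr0, subr0, oppr0, sub0r, add0r).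
exact: zeta_e1.
Qed.

(** These values are read off from the first and third coordinates of [a_init] and [c_init]. *)
Let init_x0 := m1 / n1.
Let init_x2 := 1 / n1.
Let init_y0 := - m2 / n2.
Let init_y2 := m1 / n2.

Let init_x : init_x0 ^+ 2 + init_x2 ^+ 2 = 1.
Proof.
rewrite /init_x0 /init_x2 !expr_div_n n1E; field; exact: lt0r_neq0 m1D1_gt0.
Qed.

Let init_y : init_y0 ^+ 2 + init_y2 ^+ 2 = 1.
Proof.
rewrite /init_y0 /init_y2 !expr_div_n n2E; field; exact: lt0r_neq0 m1Dm2_gt0.
Qed.

Let init_xy : init_x0 * init_y0 + m2 * (init_x2 * init_y2) = 0.
Proof.
by rewrite /init_x0 /init_x2 /init_y0 /init_y2; field; rewrite n1_neq0 n2_neq0.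
Qed.

Let inv_n1 : n1^-1 ^+ 2 = (m1 ^+ 2 + 1)^-1. Proof. by rewrite exprVn n1E. Qed.
Let inv_n2 : n2^-1 ^+ 2 = (m1 ^+ 2 + m2 ^+ 2)^-1. Proof. by rewrite exprVn n2E. Qed.

Lemma init_closed : [/\ init_x0 ^+ 2 + init_x2 ^+ 2 = 1,
  init_y0 ^+ 2 + init_y2 ^+ 2 = 1 & init_x0 * init_y0 + m2 * (init_x2 * init_y2) = 0].
Proof. by []. Qed.

Lemma a_initE : a_init m0 m1 = body_a init_x0 init_x2.
Proof.
rewrite /a_init -[rvec _ _]/(quat _ _ _ _) scale_quat /body_a /v2 -inv_n1 /init_x0 /init_x2.
by congr quat; field; rewrite n1_neq0 ?m0D1_neq0.
Qed.

Lemma c_initE : c_init m1 m2 = body_c init_y0 init_y2.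
Proof.
rewrite /c_init -[rvec _ _]/(quat _ _ _ _) scale_quat /body_c -inv_n2 /init_y0 /init_y2.
by congr quat; field; rewrite n2_neq0.
Qed.

Lemma chi1E : chi1 m0 = rho *m vec3 0 g f.
Proof.
rewrite /chi1 -[cvec _]/(vec3 _ _ _) scale_vec3 quarter_turn_vec3 /cos_beta /sin_beta.
by congr vec3; field; exact: m0D1_neq0.
Qed.

Lemma chi0E : chi0 R = rho *m vec3 0 1 0.
Proof. by rewrite quarter_turn_vec3 oppr0. Qed.

Let Dq : (m0 * (m2 - 1)) ^+ 2 + (m2 + 1) ^+ 2 != 0.
Proof. by rewrite exprMn; exact: q_neq0. Qed.

Let D1 : m1 ^+ 2 + 1 != 0 := lt0r_neq0 m1D1_gt0.
Let D2 : m1 ^+ 2 + m2 ^+ 2 != 0 := lt0r_neq0 m1Dm2_gt0.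

Lemma chi2E : chi2 m0 m1 m2 = rho *m axis_a m0 m2 init_x0 init_x2.
Proof.
rewrite /chi2 -[cvec _]/(vec3 _ _ _) scale_vec3 quarter_turn_vec3.
have -> : init_x0 ^+ 2 - init_x2 ^+ 2 = (m1 ^+ 2 - 1) / (m1 ^+ 2 + 1).
  by rewrite /init_x0 /init_x2 -inv_n1; field; rewrite n1_neq0.
have -> : 2 * init_x0 * init_x2 = 2 * m1 / (m1 ^+ 2 + 1).
  by rewrite /init_x0 /init_x2 -inv_n1; field; rewrite n1_neq0.
rewrite /cos_alpha /sin_alpha /cos_beta /sin_beta /Defs.q.
by congr vec3; field; rewrite ?m0D1_neq0 ?Dq ?D1.
Qed.

Lemma chi3E : chi3 m0 m1 m2 = rho *m axis_c m0 m2 init_y0 init_y2.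
Proof.
rewrite /chi3 -[cvec _]/(vec3 _ _ _) scale_vec3 quarter_turn_vec3.
have -> : init_y0 ^+ 2 - init_y2 ^+ 2 = (m2 ^+ 2 - m1 ^+ 2) / (m1 ^+ 2 + m2 ^+ 2).
  by rewrite /init_y0 /init_y2 -inv_n2; field; rewrite n2_neq0.
have -> : 2 * init_y0 * init_y2 = - 2 * m1 * m2 / (m1 ^+ 2 + m2 ^+ 2).
  by rewrite /init_y0 /init_y2 -inv_n2; field; rewrite n2_neq0.
rewrite /cos_alpha /sin_alpha /Defs.q.
by congr vec3; field; rewrite ?Dq ?D2.
Qed.

Let body_b_init := body_b init_x0 init_x2 init_y0 init_y2.

(** The formulas for [b] reproduce the initial orientation with the opposite sign. This is the
    source of the identification of [b] with [- b] at the initial point. *)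
Lemma b_initE : b_init m0 m1 m2 = - body_b_init.
Proof.
rewrite /b_init -[rvec _ _]/(quat _ _ _ _) scale_quat /body_b_init /body_b.
rewrite /iota /Bb /quat_b !qmul_quat !quatE scale_quat opp_quat.
rewrite 2!invfM -inv_n1 -inv_n2 /init_x0 /init_x2 /init_y0 /init_y2.
rewrite /cos_alpha /sin_alpha /cos_beta /sin_beta /q0 /q1 /q2 /q3 /q4 /Defs.q.
by congr quat; field; rewrite ?n1_neq0 ?n2_neq0 ?Dq ?m0D1_neq0 ?m2_neq0.
Qed.

Section Rotations.

Variables (x0 x2 y0 y2 : R).
Hypotheses (x_unit : x0 ^+ 2 + x2 ^+ 2 = 1) (y_unit : y0 ^+ 2 + y2 ^+ 2 = 1).

Let za : 'cV[R]_3 := vec3 0 k (- l).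
Let zc : 'cV[R]_3 := vec3 0 k l.

Let Rxza (z0 z2 : R) : z0 ^+ 2 + z2 ^+ 2 = 1 ->
  rotmx (body_a z0 z2) *m zeta Ba za = rho *m axis_a m0 m2 z0 z2.
Proof.
move=> z1; rewrite rotmx_body_a !rotmx_vec3 scale_vec3 /axis_a.
have E : k * (z0 ^+ 2 + z2 ^+ 2) = k by rewrite z1 mulr1.
rewrite -[X in vec3 _ (g * X + _) _]E -[X in vec3 _ _ (f * X - _)]E /cos_beta /sin_beta.
by congr (_ *m vec3 _ _ _); rewrite /v2; field; rewrite m0D1_neq0.
Qed.

(** The rotation given by [z0 + z2 j] fixes its own axis [j], so the joint axis towards the fixed
    body does not move. *)
Let Rxe2 (z0 z2 : R) : z0 ^+ 2 + z2 ^+ 2 = 1 ->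
  rotmx (body_a z0 z2) *m zeta Ba (vec3 0 1 0) = chi1 m0.
Proof.
move=> z1; rewrite rotmx_body_a !rotmx_vec3 scale_vec3 chi1E.
have -> : vec3 0 g f = vec3 0 (g * (z0 ^+ 2 + z2 ^+ 2)) (f * (z0 ^+ 2 + z2 ^+ 2)).
  by rewrite z1 !mulr1.
rewrite /cos_beta /sin_beta.
by congr (_ *m vec3 _ _ _); rewrite /v2; field; rewrite m0D1_neq0.
Qed.

Let Ryzc (z0 z2 : R) : z0 ^+ 2 + z2 ^+ 2 = 1 ->
  rotmx (body_c z0 z2) *m zeta Bc zc = rho *m axis_c m0 m2 z0 z2.
Proof.
move=> z1; rewrite rotmx_body_c !rotmx_vec3 /axis_c.
have E : k * (z0 ^+ 2 + z2 ^+ 2) = k by rewrite z1 mulr1.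
by rewrite -[X in vec3 _ X (_ * l)]E; congr (_ *m vec3 _ _ _); ring.
Qed.

Let Rye2 (z0 z2 : R) : z0 ^+ 2 + z2 ^+ 2 = 1 ->
  rotmx (body_c z0 z2) *m zeta Bc (vec3 0 1 0) = chi0 R.
Proof.
move=> z1; rewrite rotmx_body_c !rotmx_vec3 chi0E.
have -> : vec3 0 1 0 = vec3 0 (z0 ^+ 2 + z2 ^+ 2) 0 :> 'cV[R]_3 by rewrite z1.
by congr (_ *m vec3 _ _ _); ring.
Qed.

Let a1i : norm2 (a_init m0 m1) = 1. Proof. by rewrite a_initE norm2_body_a. Qed.
Let c1i : norm2 (c_init m1 m2) = 1. Proof. by rewrite c_initE norm2_body_c. Qed.

Lemma rotmx_a_chi11 : rotmx (body_a x0 x2) *m chi_1_1 m0 m1 = chi1 m0.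
Proof. by apply: rotmx_transport a1i (Rxe2 x_unit) _; rewrite a_initE Rxe2. Qed.

Lemma rotmx_a_chi21 :
  rotmx (body_a x0 x2) *m ((rotmx (a_init m0 m1))^T *m chi2 m0 m1 m2) =
  rho *m axis_a m0 m2 x0 x2.
Proof. by apply: rotmx_transport a1i (Rxza x_unit) _; rewrite a_initE Rxza ?chi2E. Qed.

Lemma rotmx_a_e1 : rotmx (body_a x0 x2) *m e1 = rho *m link_a m0 x0 x2.
Proof.
rewrite -{1}zeta_Ba rotmx_body_a !rotmx_vec3 scale_vec3 /link_a /cos_beta /sin_beta.
by congr (_ *m vec3 _ _ _); rewrite /v2; field; rewrite m0D1_neq0.
Qed.

Lemma rotmx_c_chi33 :
  rotmx (body_c y0 y2) *m chi_3_3 m0 m1 m2 = rho *m axis_c m0 m2 y0 y2.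
Proof. by apply: rotmx_transport c1i (Ryzc y_unit) _; rewrite c_initE Ryzc ?chi3E. Qed.

Lemma rotmx_c_chi03 :
  rotmx (body_c y0 y2) *m ((rotmx (c_init m1 m2))^T *m chi0 R) = chi0 R.
Proof. by apply: rotmx_transport c1i (Rye2 y_unit) _; rewrite c_initE Rye2. Qed.

Lemma rotmx_c_e1 : rotmx (body_c y0 y2) *m e1 = rho *m link_c y0 y2.
Proof.
rewrite -{1}zeta_Bc rotmx_body_c !rotmx_vec3 /link_c.
by congr (_ *m vec3 _ _ _); ring.
Qed.

Let b1i : norm2 (b_init m0 m1 m2) = 1.
Proof. by rewrite b_initE norm2N norm2_body_b. Qed.

Let dot_zeta z z' : dot (zeta Bb z) (zeta Bb z') = dot z z'.
Proof.
rewrite /zeta dotZr dotC dotZr -rotmx_qconj dot_rotmx norm2_qconj (dotC z').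
have B0 : norm2 Bb != 0 by rewrite norm2_Bb !mulf_neq0 ?expf_neq0 ?pnatr_eq0.
by field.
Qed.

Hypothesis xy : x0 * y0 + m2 * (x2 * y2) = 0.

Let rotmx_b_axis2 w0 w2 z0 z2 : w0 ^+ 2 + w2 ^+ 2 = 1 -> z0 ^+ 2 + z2 ^+ 2 = 1 ->
  w0 * z0 + m2 * (w2 * z2) = 0 ->
  rotmx (body_b w0 w2 z0 z2) *m zeta Bb (axis_b2 m0 m2) = rho *m axis_a m0 m2 w0 w2.
Proof. by move=> w1 z1 wz; rewrite rotmx_body_b rotmx_quat_b_axis2. Qed.

Let rotmx_b_axis3 w0 w2 z0 z2 : w0 ^+ 2 + w2 ^+ 2 = 1 -> z0 ^+ 2 + z2 ^+ 2 = 1 ->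
  w0 * z0 + m2 * (w2 * z2) = 0 ->
  rotmx (body_b w0 w2 z0 z2) *m zeta Bb (axis_b3 m0 m2) = rho *m axis_c m0 m2 z0 z2.
Proof. by move=> w1 z1 wz; rewrite rotmx_body_b rotmx_quat_b_axis3. Qed.

Let chi22E : chi_2_2 m0 m1 m2 = zeta Bb (axis_b2 m0 m2).
Proof.
rewrite /chi_2_2 chi2E b_initE rotmxN -(rotmx_b_axis2 init_x init_y init_xy).
by rewrite mulmxA rotmxK norm2_body_b // expr1n mul1mx.
Qed.

Let chi32E : (rotmx (b_init m0 m1 m2))^T *m chi3 m0 m1 m2 = zeta Bb (axis_b3 m0 m2).
Proof.
rewrite chi3E b_initE rotmxN -(rotmx_b_axis3 init_x init_y init_xy).
by rewrite mulmxA rotmxK norm2_body_b // expr1n mul1mx.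
Qed.

Lemma dot_e1_chi22 : dot e1 (chi_2_2 m0 m1 m2) = 0.
Proof. by rewrite chi22E -zeta_Bb dot_zeta dot_vec3; ring. Qed.

Lemma dot_e1_chi32 : dot e1 ((rotmx (b_init m0 m1 m2))^T *m chi3 m0 m1 m2) = 0.
Proof. by rewrite chi32E -zeta_Bb dot_zeta dot_vec3; ring. Qed.

Lemma dot_chi22 : dot (chi_2_2 m0 m1 m2) (chi_2_2 m0 m1 m2) = 1.
Proof.
rewrite chi22E dot_zeta dot_vec3.
transitivity ((k ^+ 2 + l ^+ 2) * (g ^+ 2 + f ^+ 2)); first by ring.
by rewrite alpha_unit // beta_unit mulr1.
Qed.

Lemma dot_chi32 : dot ((rotmx (b_init m0 m1 m2))^T *m chi3 m0 m1 m2)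
  ((rotmx (b_init m0 m1 m2))^T *m chi3 m0 m1 m2) = 1.
Proof.
rewrite chi32E dot_zeta dot_vec3.
transitivity ((k ^+ 2 + l ^+ 2) * (g ^+ 2 + f ^+ 2) ^+ 2); first by ring.
by rewrite alpha_unit // beta_unit expr1n mulr1.
Qed.

(** The fixed angle between the two axes of body [b] is the condition by which [closure_relation]
    rules out the folded positions. *)
Lemma dot_chi22_chi32 :
  dot (chi_2_2 m0 m1 m2) ((rotmx (b_init m0 m1 m2))^T *m chi3 m0 m1 m2) = g.
Proof.
rewrite chi22E chi32E dot_zeta dot_vec3.
transitivity ((k ^+ 2 + l ^+ 2) * (g ^+ 2 + f ^+ 2) * g); first by ring.
by rewrite alpha_unit // beta_unit !mul1r.
Qed.

Lemma rotmx_b_chi22 :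
  rotmx (body_b x0 x2 y0 y2) *m chi_2_2 m0 m1 m2 = rho *m axis_a m0 m2 x0 x2.
Proof.
apply: rotmx_transport b1i (rotmx_b_axis2 x_unit y_unit xy) _.
by rewrite b_initE rotmxN rotmx_b_axis2 ?chi2E.
Qed.

Lemma rotmx_b_chi32 :
  rotmx (body_b x0 x2 y0 y2) *m ((rotmx (b_init m0 m1 m2))^T *m chi3 m0 m1 m2) =
  rho *m axis_c m0 m2 y0 y2.
Proof.
apply: rotmx_transport b1i (rotmx_b_axis3 x_unit y_unit xy) _.
by rewrite b_initE rotmxN rotmx_b_axis3 ?chi3E.
Qed.

Lemma rotmx_b_e1 : rotmx (body_b x0 x2 y0 y2) *m e1 =
  rho *m (rotmx (quat_b m0 m2 x0 x2 y0 y2) *m e1).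
Proof. by rewrite -{1}zeta_Bb rotmx_body_b. Qed.

End Rotations.

End Bodies.

(** [eta chi] and [xi chi] are the images of the first two basis vectors under the shortest rotation
    from the third one to [chi]. The denominators vanish when [chi] lies on the third axis, hence
    the second hypothesis. *)
Lemma orthoframe_eta (R : realType) (chi : 'cV[R]_3) :
  dot chi chi = 1 -> (chi 0 0 != 0) || (chi 1 0 != 0) ->
  orthoframe (eta chi) (xi chi) chi.
Proof.
rewrite (vec3_eta chi) /eta /xi !vec3E.
set x := chi 0 0; set y := chi 1 0; set z := chi 2 0.
rewrite -[cvec [:: _ / _; _; _]]/(vec3 _ _ _) -[cvec [:: - _; _; _]]/(vec3 _ _ _).
rewrite !dot_vec3 => u xy.
have z1 : (1 - z) * (1 + z) != 0.
  rewrite -subr_sqr expr1n (_ : 1 - z ^+ 2 = x ^+ 2 + y ^+ 2); last by rewrite -u; ring.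
  by rewrite paddr_eq0 ?sqr_ge0 // !sqrf_eq0 negb_and.
have zN : 1 + z != 0 by apply: contraNneq z1 => ->; rewrite mulr0.
have zB : 1 - z != 0 by apply: contraNneq z1 => ->; rewrite mul0r.
have -> : (z * x ^+ 2 + y ^+ 2) / (1 - z ^+ 2) = 1 - x ^+ 2 / (1 + z).
  have -> : 1 - z ^+ 2 = (1 - z) * (1 + z) by ring.
  have -> : y ^+ 2 = (1 - z) * (1 + z) - x ^+ 2 by apply: (lincomb1 1 u); ring.
  by field; rewrite zN zB.
have -> : z + x ^+ 2 / (1 + z) = 1 - y ^+ 2 / (1 + z).
  have -> : y ^+ 2 = (1 - z) * (1 + z) - x ^+ 2 by apply: (lincomb1 1 u); ring.
  by field; rewrite zN.
split; first split.
- by rewrite !dot_vec3; apply: (lincomb1 ((x / (1 + z)) ^+ 2) u); field; rewrite zN.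
- by rewrite !dot_vec3; apply: (lincomb1 ((y / (1 + z)) ^+ 2) u); field; rewrite zN.
- by rewrite dot_vec3.
- by rewrite !dot_vec3; apply: (lincomb1 (x * y / (1 + z) ^+ 2) u); field; rewrite zN.
- by rewrite !dot_vec3; apply: (lincomb1 (- x / (1 + z)) u); field; rewrite zN.
- by rewrite !dot_vec3; apply: (lincomb1 (- y / (1 + z)) u); field; rewrite zN.
Qed.

(** * Points of X in reduced parameters *)

Section Solutions.

Variables (R : realType) (m0 m1 m2 : R) (Jab Jbc : {pred {mpoly R[4 + 4]}}).
Hypotheses (m0_neq0 : m0 != 0) (m1_neq0 : m1 != 0) (m2_neq0 : m2 != 0).
Hypotheses (m2_neq1 : m2 != 1) (m2_neqN1 : m2 != -1) (q5_neq0 : q5 m0 m1 != 0).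
Hypothesis Jab_comp : prime_component (I_ab m0 m1 m2)
    (row_mx (a_init m0 m1) (b_init m0 m1 m2)) Jab.
Hypothesis Jbc_comp : prime_component (I_bc m0 m1 m2)
    (row_mx (b_init m0 m1 m2) (c_init m1 m2)) Jbc.

Local Notation rho := (quarter_turn R).
Local Notation e1 := (e1 R).
Local Notation r := (r m0 m2).
Local Notation q5 := (q5 m0 m1).

Let n1 := Num.sqrt (m1 ^+ 2 + 1).
Let n2 := Num.sqrt (m1 ^+ 2 + m2 ^+ 2).
Let v2 := m0 ^+ 2 + 1.

Definition closed_loop (x0 x2 y0 y2 : R) : Prop :=
  [/\ x0 ^+ 2 + x2 ^+ 2 = 1, y0 ^+ 2 + y2 ^+ 2 = 1 & x0 * y0 + m2 * (x2 * y2) = 0].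

Let ba := body_a m0 m1.
Let bc := body_c m1 m2.
Let bb := body_b m0 m1 m2.
Let chi33 := chi_3_3 m0 m1 m2.
Let chi22 := chi_2_2 m0 m1 m2.
Let chi21 := (rotmx (a_init m0 m1))^T *m chi2 m0 m1 m2.
Let chi32 := (rotmx (b_init m0 m1 m2))^T *m chi3 m0 m1 m2.

Let init := init_closed m2 m1_neq0.

Let a1i : norm2 (a_init m0 m1) = 1.
Proof. by rewrite a_initE // norm2_body_a //; case: init. Qed.

Let b1i : norm2 (b_init m0 m1 m2) = 1.
Proof. by rewrite b_initE // norm2N; case: init => *; apply: norm2_body_b. Qed.

Let c1i : norm2 (c_init m1 m2) = 1.
Proof. by rewrite c_initE // norm2_body_c //; case: init. Qed.

Let rotmx_trK a (u : 'cV[R]_3) : norm2 a = 1 -> rotmx a *m ((rotmx a)^T *m u) = u.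
Proof. by move=> a1; rewrite mulmxA rotmxKV a1 expr1n mul1mx. Qed.

Let dot_rotmx1 a (u w : 'cV[R]_3) :
  norm2 a = 1 -> dot (rotmx a *m u) (rotmx a *m w) = dot u w.
Proof. by move=> a1; rewrite dot_rotmx a1 expr1n mul1r. Qed.

Let dot_chi2 : dot (chi2 m0 m1 m2) (chi2 m0 m1 m2) = 1.
Proof. by rewrite -(rotmx_trK (chi2 m0 m1 m2) b1i) dot_rotmx1 // dot_chi22. Qed.

Let dot_chi3 : dot (chi3 m0 m1 m2) (chi3 m0 m1 m2) = 1.
Proof. by rewrite -(rotmx_trK (chi3 m0 m1 m2) b1i) dot_rotmx1 // dot_chi32. Qed.

Let dot_chi1 : dot (chi1 m0) (chi1 m0) = 1.
Proof.
rewrite chi1E dot_quarter_turn dot_vec3 -[RHS](beta_unit m0); ring.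
Qed.

Let q_neq0 : q m0 m2 != 0. Proof. exact: q_neq0. Qed.

Let D0 : m0 ^+ 2 + 1 != 0 := m0D1_neq0 m0.

Let one_m2 : 1 - m2 ^+ 2 != 0.
Proof.
rewrite -(expr1n _ 2) subr_sqr mulf_neq0 //.
  by rewrite subr_eq0 eq_sym.
by rewrite addrC addr_eq0.
Qed.

Let onb1 : orthoframe (eta (chi1 m0)) (xi (chi1 m0)) (chi1 m0).
Proof.
apply: orthoframe_eta => //; apply/orP; right.
rewrite /chi1 -[cvec _]/(vec3 _ _ _) scale_vec3 vec3E.
by rewrite !mulf_neq0 ?invr_neq0 ?oppr_eq0 ?pnatr_eq0.
Qed.

Let onb2 : orthoframe (eta (chi2 m0 m1 m2)) (xi (chi2 m0 m1 m2)) (chi2 m0 m1 m2).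
Proof.
apply: orthoframe_eta => //; apply/orP; left.
rewrite /chi2 -[cvec _]/(vec3 _ _ _) scale_vec3 vec3E.
have D1 := lt0r_neq0 (m1D1_gt0 m1).
by rewrite !mulf_neq0 ?invr_neq0 ?mulf_neq0 ?pnatr_eq0.
Qed.

Let onb3 : orthoframe (eta (chi3 m0 m1 m2)) (xi (chi3 m0 m1 m2)) (chi3 m0 m1 m2).
Proof.
apply: orthoframe_eta => //; apply/orP; left.
rewrite /chi3 -[cvec _]/(vec3 _ _ _) scale_vec3 vec3E.
have D2 := lt0r_neq0 (m1Dm2_gt0 m2 m1_neq0).
by rewrite !mulf_neq0 ?invr_neq0 ?mulf_neq0 ?pnatr_eq0.
Qed.

Let in_Jab a b : in_variety Jab (row_mx a b) <->
  [/\ norm2 a = 1, norm2 b = 1 & rotmx a *m chi21 = rotmx b *m chi22].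
Proof.
apply: prime_component_joint Jab_comp _ _; first exact: orthoframe_rotmx.
  exact: dot_chi22.
by rewrite !rotmx_trK.
Qed.

Let in_Jbc b c : in_variety Jbc (row_mx b c) <->
  [/\ norm2 b = 1, norm2 c = 1 & rotmx b *m chi32 = rotmx c *m chi33].
Proof.
apply: prime_component_joint Jbc_comp _ _; first exact: orthoframe_rotmx.
  by rewrite -(dot_rotmx1 _ _ c1i) rotmx_trK.
by rewrite !rotmx_trK.
Qed.

Lemma loop_eqE a b c : loop_eq m0 m2 (a, b, c) <->
  e1 + r *: (rotmx a *m e1) + rotmx b *m e1 + r *: (rotmx c *m e1) = 0.
Proof.
by rewrite /loop_eq -[cvec _]/e1 !mulmxDl mul1mx -!scalemxAl.
Qed.

Let n1_neq0 : n1 != 0. Proof. exact/lt0r_neq0/(eq_ind_r _ (m1D1_gt0 m1) (sqrtr_gt0 _)). Qed.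
Let n2_neq0 : n2 != 0.
Proof. exact/lt0r_neq0/(eq_ind_r _ (m1Dm2_gt0 m2 m1_neq0) (sqrtr_gt0 _)). Qed.

Let n1E : n1 ^+ 2 = m1 ^+ 2 + 1.
Proof. by rewrite sqr_sqrtr // addr_ge0 ?sqr_ge0. Qed.

Let n2E : n2 ^+ 2 = m1 ^+ 2 + m2 ^+ 2.
Proof. by rewrite sqr_sqrtr // addr_ge0 ?sqr_ge0. Qed.

(** Two linear equations and an ellipse; the ellipse is rescaled to the unit circle. *)
Lemma variety_JaP a : variety_Ja m0 m1 a <->
  exists x0 x2, x0 ^+ 2 + x2 ^+ 2 = 1 /\ a = ba x0 x2.
Proof.
rewrite (quat_eta a) /variety_Ja !quatE -n1E.
set a0 := a 0 0; set a1 := a 0 1; set a2 := a 0 2; set a3 := a 0 3.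
split=> [[A1 A3 A] | [x0 [x2 [x1 /quat_inj[-> -> -> ->]]]]].
  exists (a0 * n1), (a2 * (v2 * n1) / q5); split.
    by apply: (lincomb1 (q5 ^-2) A); rewrite /v2; field.
  rewrite /ba /body_a -/n1; congr quat.
  - by field.
  - by rewrite (subr0_eq A1); field; rewrite n1_neq0.
  - by rewrite /v2; field; rewrite q5_neq0 n1_neq0 D0.
  - apply: (mulfI q5_neq0); rewrite (subr0_eq A3) /v2.
    by field; rewrite q5_neq0 n1_neq0 D0.
split.
- by rewrite -/n1; field; rewrite n1_neq0.
- by rewrite -/n1; field; rewrite n1_neq0 D0.
rewrite -/n1; transitivity (q5 ^+ 2 * (x0 ^+ 2 + x2 ^+ 2) - q5 ^+ 2).
  by field; rewrite n1_neq0 D0.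
by rewrite x1 mulr1 subrr.
Qed.

Lemma variety_JcP c : variety_Jc m1 m2 c <->
  exists y0 y2, y0 ^+ 2 + y2 ^+ 2 = 1 /\ c = bc y0 y2.
Proof.
rewrite (quat_eta c) /variety_Jc !quatE -n2E.
set c0 := c 0 0; set c1 := c 0 1; set c2 := c 0 2; set c3 := c 0 3.
split=> [[A1 A3 A] | [x0 [x2 [x1 /quat_inj[-> -> -> ->]]]]].
  exists (c0 * n2 / m1), (c2 * n2 / m2); split.
    by apply: (lincomb1 ((m1 * m2) ^-2) A); field; rewrite m1_neq0 m2_neq0.
  rewrite /bc /body_c -/n2; congr quat.
  - by field; rewrite m1_neq0 n2_neq0.
  - apply: (mulfI m1_neq0); rewrite (subr0_eq A1).
    by field; rewrite n2_neq0 m1_neq0.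
  - by field; rewrite m2_neq0 n2_neq0.
  - apply: (mulfI m2_neq0); rewrite (subr0_eq A3).
    by field; rewrite n2_neq0 m2_neq0.
split.
- by rewrite -/n2; field; rewrite n2_neq0.
- by rewrite -/n2; field; rewrite n2_neq0.
rewrite -/n2; transitivity ((m1 * m2) ^+ 2 * (x0 ^+ 2 + x2 ^+ 2) - (m1 * m2) ^+ 2).
  by field; rewrite n2_neq0.
by rewrite x1 mulr1 subrr.
Qed.

Let ba_e1 x0 x2 : rotmx (ba x0 x2) *m e1 = rho *m link_a m0 x0 x2.
Proof. exact: rotmx_a_e1. Qed.

Let bc_e1 y0 y2 : rotmx (bc y0 y2) *m e1 = rho *m link_c y0 y2.
Proof. exact: rotmx_c_e1. Qed.

Let bb_e1 x0 x2 y0 y2 : rotmx (bb x0 x2 y0 y2) *m e1 =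
  rho *m (rotmx (quat_b m0 m2 x0 x2 y0 y2) *m e1).
Proof. exact: rotmx_b_e1. Qed.

Let rho_e1 : rho *m e1 = e1. Proof. by rewrite quarter_turn_vec3 oppr0. Qed.

Section ClosedPoint.

Variables x0 x2 y0 y2 : R.
Hypothesis closed : closed_loop x0 x2 y0 y2.

Let x1 : x0 ^+ 2 + x2 ^+ 2 = 1. Proof. by case: closed. Qed.
Let y1 : y0 ^+ 2 + y2 ^+ 2 = 1. Proof. by case: closed. Qed.
Let xy : x0 * y0 + m2 * (x2 * y2) = 0. Proof. by case: closed. Qed.

Lemma closed_norm : [/\ norm2 (ba x0 x2) = 1, norm2 (bb x0 x2 y0 y2) = 1
  & norm2 (bc y0 y2) = 1].
Proof. by split; [exact: norm2_body_a | exact: norm2_body_b | exact: norm2_body_c]. Qed.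

Lemma closed_joint_ab :
  rotmx (ba x0 x2) *m chi21 = rotmx (bb x0 x2 y0 y2) *m chi22.
Proof. by rewrite [RHS]rotmx_b_chi22 // [LHS]rotmx_a_chi21. Qed.

Lemma closed_joint_bc :
  rotmx (bb x0 x2 y0 y2) *m chi32 = rotmx (bc y0 y2) *m chi33.
Proof. by rewrite [LHS]rotmx_b_chi32 // [RHS]rotmx_c_chi33. Qed.

Lemma closed_loop_eq : loop_eq m0 m2 (ba x0 x2, bb x0 x2 y0 y2, bc y0 y2).
Proof.
apply/loop_eqE; rewrite ba_e1 bb_e1 bc_e1 -[X in X + _ + _ + _]rho_e1.
rewrite !scalemxAr -!mulmxDr.
by rewrite loop_quat_b // mulmx0.
Qed.

Lemma closed_constraint : constraint_eq m0 m1 m2 (ba x0 x2, bb x0 x2 y0 y2, bc y0 y2).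
Proof.
have [a1 b1 c1] := closed_norm.
split; [by split | exact: closed_loop_eq | split].
- have -> : rotmx (ba x0 x2) *m chi_1_1 m0 m1 = chi1 m0 by exact: rotmx_a_chi11.
  by case: onb1.
- have E : rotmx (bb x0 x2 y0 y2) *m chi_2_2 m0 m1 m2 = rotmx (ba x0 x2) *m chi21.
    by rewrite closed_joint_ab.
  rewrite E !dot_rotmx1 //.
  by have [_ _ _ ? ?] := orthoframe_rotmx a1i onb2.
- have E : rotmx (bc y0 y2) *m chi_3_3 m0 m1 m2 = rotmx (bb x0 x2 y0 y2) *m chi32.
    by rewrite closed_joint_bc.
  rewrite E !dot_rotmx1 //.
  by have [_ _ _ ? ?] := orthoframe_rotmx b1i onb3.
(* The fixed axis [chi0] is written as its own image under body [c], so that both arguments of the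
   last two joint equations carry the same rotation. *)
have E : rotmx (bc y0 y2) *m ((rotmx (c_init m1 m2))^T *m chi0 R) = chi0 R.
  exact: rotmx_c_chi03.
have o x y z : dot ((rotmx (c_init m1 m2))^T *m vec3 x y z)
   ((rotmx (c_init m1 m2))^T *m chi0 R) = z.
  rewrite -rotmx_qconj dot_rotmx norm2_qconj c1i expr1n mul1r dot_vec3; ring.
by rewrite -E !dot_rotmx1 //; split; exact: o.
Qed.

End ClosedPoint.

Lemma solutionsP p : solutions m0 m1 m2 Jab Jbc p <->
  exists x0 x2 y0 y2 (s : bool), closed_loop x0 x2 y0 y2 /\
    p = (ba x0 x2, (-1) ^+ s *: bb x0 x2 y0 y2, bc y0 y2).
Proof.
have rotmx_sg (s : bool) (b : 'rV[R]_4) : rotmx ((-1) ^+ s *: b) = rotmx b.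
  by rewrite rotmxZ -exprM mulnC exprM sqrrN !expr1n scale1r.
have norm2_sg (s : bool) (b : 'rV[R]_4) : norm2 ((-1) ^+ s *: b) = norm2 b.
  by case: s; rewrite ?scale1r // expr1 scaleN1r norm2N.
split=> [|[x0 [x2 [y0 [y2 [s [closed ->]]]]]]]; last first.
  have [a1 b1 c1] := closed_norm closed; have [x1 y1 xy] := closed.
  split.
  - by apply/variety_JaP; exists x0, x2.
  - by apply/in_Jab; rewrite norm2_sg rotmx_sg; split=> //; exact: closed_joint_ab.
  - by apply/in_Jbc; rewrite norm2_sg rotmx_sg; split=> //; exact: closed_joint_bc.
  - by apply/variety_JcP; exists y0, y2.
  - by have /loop_eqE := closed_loop_eq closed; rewrite loop_eqE rotmx_sg.
case: p => -[a b] c [/variety_JaP[x0 [x2 [x1 ->]]] /in_Jab[a1 b1 ab] /in_Jbc[_ c1 bcE]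
  /variety_JcP[y0 [y2 [y1 cE]]] /loop_eqE]; rewrite cE in c1 bcE *.
rewrite ba_e1 bc_e1 => loop.
pose u := e1 + r *: link_a m0 x0 x2 + r *: link_c y0 y2.
have ru : rho *m u = - (rotmx b *m e1).
  apply/eqP; rewrite -addr_eq0 -loop /u !mulmxDr rho_e1 -!scalemxAr -!addrA.
  by rewrite [r *: (rho *m link_c _ _) + _]addrC.
have b22 : rotmx b *m chi22 = rho *m axis_a m0 m2 x0 x2.
  by rewrite -ab; exact: rotmx_a_chi21.
have b32 : rotmx b *m chi32 = rho *m axis_c m0 m2 y0 y2.
  by rewrite bcE; exact: rotmx_c_chi33.
have dotNl (z w : 'cV[R]_3) : dot (- z) w = - dot z w by rewrite dotC dotNr dotC.
have e1_chi22 : dot e1 chi22 = 0 by exact: dot_e1_chi22.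
have closed : closed_loop x0 x2 y0 y2.
  split=> //; apply: (@closure_relation R m0 m2) => //; rewrite -dot_quarter_turn.
  - by rewrite ru -b22 dotNl dot_rotmx1 // e1_chi22 oppr0.
  - by rewrite ru -b32 dotNl dot_rotmx1 // dot_e1_chi32 // oppr0.
  - by rewrite -b22 -b32 dot_rotmx1 //; exact: dot_chi22_chi32.
  by rewrite ru dotNl dotNr opprK dot_rotmx1 // dot_vec3 mulr1 !mulr0 !addr0.
exists x0, x2, y0, y2.
have [_ bb1 _] := closed_norm closed.
have bb22 : rotmx b *m chi22 = rotmx (bb x0 x2 y0 y2) *m chi22.
  by rewrite -ab (closed_joint_ab closed).
have /loop_eqE := closed_loop_eq closed; rewrite ba_e1 bc_e1 -loop => /addIr /addrI be1E.
have chi22_1 : dot chi22 chi22 = 1 by exact: dot_chi22.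
have [->|->] := rotmx_inj b1 bb1 e1_chi22 chi22_1 (esym be1E) bb22.
  by exists false; rewrite scale1r.
by exists true; rewrite scaleN1r.
Qed.

End Solutions.

(** As a fixed-point condition, the formulas make the inverse property of [h] on Y immediate. *)
Lemma eight_formulasE (R : realType) (m0 m1 m2 : R) (p : conf R) :
  eight_formulas m0 m1 m2 p <-> bennett_map m0 m1 m2 (essential_coords p) = p.
Proof.
case: p => -[a b] c; rewrite /eight_formulas /bennett_map /essential_coords.
rewrite (quat_eta a) (quat_eta b) (quat_eta c) /=.
rewrite -![rvec 4 [:: _; _; _; _]]/(quat _ _ _ _) !quatE.
split=> [[[-> ->] [-> ->] [-> ->] [-> ->]] // | [/quat_inj[_ -> _ ->]]].
by move=> /quat_inj[-> -> -> ->] /quat_inj[_ -> _ ->].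
Qed.

(** * Bennett's variety in reduced parameters *)

Section Bennett.

Variables (R : realType) (m0 m1 m2 : R).
Hypotheses (m0_neq0 : m0 != 0) (m1_neq0 : m1 != 0) (m2_neq0 : m2 != 0).
Hypotheses (m2_neq1 : m2 != 1) (m2_neqN1 : m2 != -1) (q5_neq0 : q5 m0 m1 != 0).

Local Notation q5 := (q5 m0 m1).

Let n1 := Num.sqrt (m1 ^+ 2 + 1).
Let n2 := Num.sqrt (m1 ^+ 2 + m2 ^+ 2).
Let v2 := m0 ^+ 2 + 1.

Let n1_neq0 : n1 != 0. Proof. exact/lt0r_neq0/(eq_ind_r _ (m1D1_gt0 m1) (sqrtr_gt0 _)). Qed.
Let n2_neq0 : n2 != 0.
Proof. exact/lt0r_neq0/(eq_ind_r _ (m1Dm2_gt0 m2 m1_neq0) (sqrtr_gt0 _)). Qed.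

Let n1E : n1 ^+ 2 = m1 ^+ 2 + 1.
Proof. by rewrite sqr_sqrtr // addr_ge0 ?sqr_ge0. Qed.

Let n2E : n2 ^+ 2 = m1 ^+ 2 + m2 ^+ 2.
Proof. by rewrite sqr_sqrtr // addr_ge0 ?sqr_ge0. Qed.

Let D0 : m0 ^+ 2 + 1 != 0 := m0D1_neq0 m0.

Let Dq : m0 ^+ 2 * (m2 - 1) ^+ 2 + (m2 + 1) ^+ 2 != 0.
Proof. exact: q_neq0. Qed.

Let Dq' : (m0 * (m2 - 1)) ^+ 2 + (m2 + 1) ^+ 2 != 0.
Proof. by rewrite exprMn. Qed.

Definition essential_of (x0 x2 y0 y2 : R) : 'rV[R]_4 := quat
  (x0 / n1) (q5 * x2 / (v2 * n1)) (m1 * y0 / n2) (m2 * y2 / n2).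

Lemma bennett_mapE x0 x2 y0 y2 :
  bennett_map m0 m1 m2 (essential_of x0 x2 y0 y2) =
  (body_a m0 m1 x0 x2, body_b m0 m1 m2 x0 x2 y0 y2, body_c m1 m2 y0 y2).
Proof.
rewrite /bennett_map /essential_of !quatE -![rvec 4 _]/(quat _ _ _ _).
congr (_, _, _).
- rewrite /body_a -/n1 -/v2; congr quat; field; rewrite /v2 ?q5_neq0 n1_neq0 ?D0 //.
- rewrite /body_b /quat_b !qmul_quat !quatE scale_quat -/n1 -/n2.
  rewrite /t0 /t1 /t2 /t3 /t4 /t5 /q0 /q1 /cos_alpha /sin_alpha /cos_beta /sin_beta.
  rewrite /q4 /v2 /q.
  congr quat; field; rewrite ?q5_neq0 ?n1_neq0 ?n2_neq0 ?m1_neq0 ?m2_neq0 ?D0 ?Dq ?Dq' //.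
- rewrite /body_c -/n2; congr quat; field; rewrite ?m1_neq0 ?m2_neq0 n2_neq0 //.
Qed.

Lemma essential_coordsE x0 x2 y0 y2 b :
  essential_coords (body_a m0 m1 x0 x2, b, body_c m1 m2 y0 y2) =
  essential_of x0 x2 y0 y2.
Proof. by rewrite /essential_coords /= !quatE. Qed.

Lemma bennett_varietyE v : bennett_variety m0 m1 m2 v <->
  [/\ v 0 0 ^+ 2 + (m0 ^+ 2 + 1) ^+ 2 / q5 ^+ 2 * v 0 1 ^+ 2 - 1 / (m1 ^+ 2 + 1) = 0,
      m2 ^+ 2 * v 0 2 ^+ 2 + m1 ^+ 2 * v 0 3 ^+ 2
        - m1 ^+ 2 * m2 ^+ 2 / (m1 ^+ 2 + m2 ^+ 2) = 0
    & m1 * (m0 ^+ 2 + 1) * v 0 3 * v 0 1 + q5 * v 0 2 * v 0 0 = 0].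
Proof.
split=> [V | [E1 E2 E3] f].
  have Vi i : (i < 3)%N -> meval (v 0) (bennett m0 m1 m2)`_i = 0.
    by move=> i3; apply: V; apply: mem_nth.
  move: (Vi 0%N isT) (Vi 1%N isT) (Vi 2%N isT).
  by rewrite /= !(mevalD, mevalN, mevalM, mevalC, mevalXU).
rewrite !inE => /or3P[] /eqP ->;
  by rewrite !(mevalD, mevalN, mevalM, mevalC, mevalXU).
Qed.

(** A diagonal rescaling: each equation of V is a nonzero multiple of the corresponding equation of
    [closed_loop]. *)
Lemma bennettP v : bennett_variety m0 m1 m2 v <->
  exists x0 x2 y0 y2, closed_loop m2 x0 x2 y0 y2 /\ v = essential_of x0 x2 y0 y2.
Proof.
rewrite bennett_varietyE -n1E -n2E.
split=> [[E1 E2 E3] | [x0 [x2 [y0 [y2 [[x1 y1 xy] ->]]]]]].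
  exists (v 0 0 * n1), (v 0 1 * (v2 * n1) / q5), (v 0 2 * n2 / m1), (v 0 3 * n2 / m2).
  split; last first.
    rewrite [LHS]quat_eta /essential_of -/n1 -/n2 /v2.
    by congr quat; field; rewrite ?q5_neq0 ?n1_neq0 ?n2_neq0 ?m1_neq0 ?m2_neq0 ?D0.
  split.
  - by apply: (lincomb1 (n1 ^+ 2) E1); rewrite /v2; field; rewrite ?q5_neq0 ?n1_neq0.
  - apply: (lincomb1 (n2 ^+ 2 / (m1 * m2) ^+ 2) E2).
    by field; rewrite ?m1_neq0 ?m2_neq0 ?n2_neq0.
  - apply: (lincomb1 (n1 * n2 / (q5 * m1)) E3).
    by rewrite /v2; field; rewrite ?m1_neq0 ?m2_neq0 ?q5_neq0.
rewrite !quatE -/n1 -/n2 -/v2; split.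
- apply: (lincomb1 (n1 ^-2) x1); rewrite /v2.
  by field; rewrite ?q5_neq0 ?n1_neq0 ?D0.
- by apply: (lincomb1 ((m1 * m2 / n2) ^+ 2) y1); field; rewrite ?n2_neq0.
- apply: (lincomb1 (q5 * m1 / (n1 * n2)) xy); rewrite /v2.
  by field; rewrite ?n1_neq0 ?n2_neq0 ?D0.
Qed.

End Bennett.

(** * Sign changes of the Euler parameters *)

Section SignClass.

Variable R : realType.
Implicit Types p : conf R.

Definition signed p (s1 s2 s3 : bool) : conf R :=
  ((-1) ^+ s1 *: p.1.1, (-1) ^+ s2 *: p.1.2, (-1) ^+ s3 *: p.2).

Lemma signed_signed p s1 s2 s3 s1' s2' s3' :
  signed (signed p s1 s2 s3) s1' s2' s3' = signed p (s1' (+) s1) (s2' (+) s2) (s3' (+) s3).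
Proof. by rewrite /signed !scalerA -!signr_addb. Qed.

Lemma rotmx_sign (s : bool) (a : 'rV[R]_4) : rotmx ((-1) ^+ s *: a) = rotmx a.
Proof. by rewrite rotmxZ -exprM mulnC exprM sqrrN !expr1n scale1r. Qed.

Lemma sign_class_same_orientation p p1 p2 :
  sign_class p p1 -> sign_class p p2 -> same_orientation p1 p2.
Proof.
move=> [s1 [s2 [s3 ->]]] [s1' [s2' [s3' ->]]].
by split; rewrite /= !rotmx_sign.
Qed.

Lemma signr_scale_inj (s s' : bool) (a : 'rV[R]_4) :
  norm2 a = 1 -> (-1) ^+ s *: a = (-1) ^+ s' *: a -> s = s'.
Proof.
move=> a1; have a0 : a != 0.
  apply/eqP => a0; move: a1; rewrite a0 /norm2 big1 => [/esym/eqP|i _].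
    by rewrite oner_eq0.
  by rewrite mxE expr0n.
move/eqP; rewrite -subr_eq0 -scalerBl scaler_eq0 (negbTE a0) orbF subr_eq0.
by move/eqP/signr_inj.
Qed.

Definition unit_conf p : Prop := [/\ norm2 p.1.1 = 1, norm2 p.1.2 = 1 & norm2 p.2 = 1].

Lemma signed_inj p s1 s2 s3 s1' s2' s3' : unit_conf p ->
  signed p s1 s2 s3 = signed p s1' s2' s3' -> [/\ s1 = s1', s2 = s2' & s3 = s3'].
Proof.
move=> [a1 b1 c1] [ea eb ec].
by split; [exact: signr_scale_inj ea | exact: signr_scale_inj eb | exact: signr_scale_inj ec].
Qed.

Let bit (n i : nat) : bool := odd (iter i half n).

Let bits8 : {in `I_8 &, forall n n', bit n 0 = bit n' 0 -> bit n 1 = bit n' 1 ->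
  bit n 2 = bit n' 2 -> n = n'}.
Proof.
by move=> [|[|[|[|[|[|[|[|n]]]]]]]] [|[|[|[|[|[|[|[|n']]]]]]]] //; rewrite !inE.
Qed.

Lemma card_sign_class p : unit_conf p -> (sign_class p #= `I_8)%card.
Proof.
move=> p1; pose F n := signed p (bit n 0) (bit n 1) (bit n 2).
have -> : sign_class p = F @` `I_8.
  apply/seteqP; split=> [q [s1 [s2 [s3 ->]]] | q [n _ <-]]; last first.
    by exists (bit n 0), (bit n 1), (bit n 2).
  exists (s1 + s2.*2 + s3.*2.*2)%N; first by case: s1 s2 s3 => [] [] [].
  by rewrite /F /bit; case: s1 s2 s3 => [] [] [].
apply: inj_card_eq => n n' In In' /(signed_inj p1)[e0 e1 e2].
exact: bits8.
Qed.

(** [b] is bilinear in [a] and [c], so the sign changes compatible with the formulas are those where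
    the sign of [b] is the product of the other two. *)
Lemma card_sign_class_compatible p : unit_conf p ->
  ([set q | exists s1 s3 : bool, q = signed p s1 (s1 (+) s3) s3] #= `I_4)%card.
Proof.
move=> p1; pose F n := signed p (bit n 0) (bit n 0 (+) bit n 1) (bit n 1).
rewrite (_ : [set q | _] = F @` `I_4).
  apply: inj_card_eq => n n' In In' /(signed_inj p1)[e0 _ e1].
  by move: n n' e0 e1 In In'; move=> [|[|[|[|n]]]] [|[|[|[|n']]]] //; rewrite !inE.
apply/seteqP; split=> [q [s1 [s3 ->]] | q [n _ <-]]; last first.
  by exists (bit n 0), (bit n 1).
exists (s1 + s3.*2)%N; first by case: s1 s3 => [] [].
by rewrite /F /bit; case: s1 s3 => [] [].
Qed.

End SignClass.

(** * The sets X, X+ and Y *)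

Section SolutionSet.

Variables (R : realType) (m0 m1 m2 : R) (Jab Jbc : {pred {mpoly R[4 + 4]}}).
Hypotheses (m0_neq0 : m0 != 0) (m1_neq0 : m1 != 0) (m2_neq0 : m2 != 0).
Hypotheses (m2_neq1 : m2 != 1) (m2_neqN1 : m2 != -1) (q5_neq0 : q5 m0 m1 != 0).
Hypothesis Jab_comp : prime_component (I_ab m0 m1 m2)
    (row_mx (a_init m0 m1) (b_init m0 m1 m2)) Jab.
Hypothesis Jbc_comp : prime_component (I_bc m0 m1 m2)
    (row_mx (b_init m0 m1 m2) (c_init m1 m2)) Jbc.

Let ba := body_a m0 m1.
Let bc := body_c m1 m2.
Let bb := body_b m0 m1 m2.
Let ess := essential_of m0 m1 m2.
Let V := bennett_variety m0 m1 m2.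
Let X := solutions m0 m1 m2 Jab Jbc.
Let Y := solutions_by_formulas m0 m1 m2 Jab Jbc.
Let h := bennett_map m0 m1 m2.
Let Xplus := X `&` alternative m0 m1 m2 1.
Let Xminus := X `&` alternative m0 m1 m2 (-1).
Let Xa := Xplus `&` [set p : conf R | p.1.1 0 0 = 0].
Let Xc := Xplus `&` [set p : conf R | p.2 0 0 = 0].

Definition closed_conf (x0 x2 y0 y2 : R) : conf R := (ba x0 x2, bb x0 x2 y0 y2, bc y0 y2).

Let h_ess x0 x2 y0 y2 : h (ess x0 x2 y0 y2) = closed_conf x0 x2 y0 y2.
Proof. exact: bennett_mapE. Qed.

Let VP v : V v <-> exists x0 x2 y0 y2,
  closed_loop m2 x0 x2 y0 y2 /\ v = ess x0 x2 y0 y2.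
Proof. exact: bennettP. Qed.

Let XP p : X p <-> exists x0 x2 y0 y2 (s : bool),
  closed_loop m2 x0 x2 y0 y2 /\ p = signed (closed_conf x0 x2 y0 y2) false s false.
Proof.
split=> [/solutionsP H | [x0 [x2 [y0 [y2 [s [cl ->]]]]]]].
  have [x0 [x2 [y0 [y2 [s [cl ->]]]]]] := H m0_neq0 m1_neq0 m2_neq0 m2_neq1 m2_neqN1 q5_neq0 Jab_comp Jbc_comp.
  by exists x0, x2, y0, y2, s; rewrite /signed !scale1r.
apply/solutionsP => //; exists x0, x2, y0, y2, s; split=> //.
by rewrite /signed !scale1r.
Qed.

Lemma solutions_by_formulasP p : Y p <-> exists x0 x2 y0 y2,
  closed_loop m2 x0 x2 y0 y2 /\ p = closed_conf x0 x2 y0 y2.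
Proof.
split=> [[/XP[x0 [x2 [y0 [y2 [s [cl pE]]]]]] /eight_formulasE] | [x0 [x2 [y0 [y2 [cl ->]]]]]].
  rewrite pE /signed !scale1r essential_coordsE => hE; exists x0, x2, y0, y2.
  by split=> //; rewrite -hE -h_ess.
have Xp : X (closed_conf x0 x2 y0 y2).
  by apply/XP; exists x0, x2, y0, y2, false; split=> //; rewrite /signed !scale1r.
split; first exact: Xp.
by apply/eight_formulasE; rewrite essential_coordsE; exact: h_ess.
Qed.

Let YP := solutions_by_formulasP.

Let sgE (s : bool) : (-1) ^+ s = 1 :> R \/ (-1) ^+ s = -1 :> R.
Proof. by case: s; [right | left]. Qed.

Lemma closed_unit x0 x2 y0 y2 : closed_loop m2 x0 x2 y0 y2 ->
  unit_conf (closed_conf x0 x2 y0 y2).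
Proof. by move=> cl; apply: closed_norm. Qed.

Let closed_b01 x0 x2 y0 y2 :
  bb x0 x2 y0 y2 0 0 = t0 m0 m1 m2 * ba x0 x2 0 0 * bc y0 y2 0 0 /\
  bb x0 x2 y0 y2 0 1 = t1 m0 m1 m2 * ba x0 x2 0 0 * bc y0 y2 0 0.
Proof.
have := h_ess x0 x2 y0 y2; rewrite /h /bennett_map /closed_conf => -[_ <- _].
by rewrite -[rvec 4 _]/(quat _ _ _ _) !quatE.
Qed.

Let scaleE (k : R) (b : 'rV[R]_4) i : (k *: b) 0 i = k * b 0 i.
Proof. by rewrite mxE. Qed.

Let signedE x0 x2 y0 y2 s : signed (closed_conf x0 x2 y0 y2) false s false =
  (ba x0 x2, (-1) ^+ s *: bb x0 x2 y0 y2, bc y0 y2).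
Proof. by rewrite /signed !scale1r. Qed.

Let signed_alternative x0 x2 y0 y2 (s : bool) :
  alternative m0 m1 m2 ((-1) ^+ s) (signed (closed_conf x0 x2 y0 y2) false s false).
Proof.
by rewrite signedE; have [b0 b1] := closed_b01 x0 x2 y0 y2; split; rewrite scaleE ?b0 ?b1.
Qed.

(** [q0 + q1 i = (q4 + 2 m0 i)(m1 + m2 i)(m1 - i)] is a product of nonzero complex numbers; [E] is
    the square of its absolute value. *)
Let t01_neq0 : (t0 m0 m1 m2 == 0) && (t1 m0 m1 m2 == 0) = false.
Proof.
apply/negP => /andP[T0 T1].
have D : m1 * m2 * q m0 m2 != 0 by rewrite !mulf_neq0 //; exact: q_neq0.
have m2N : m2 ^+ 2 - 1 != 0.
  by rewrite -(expr1n _ 2) subr_sqr mulf_neq0 // ?subr_eq0 // addr_eq0.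
move: T0 T1; rewrite /t0 /t1.
rewrite !mulf_eq0 !invr_eq0 (negbTE D) (negbTE m2N) !orbF /= => /eqP Q0 /eqP Q1.
have E : (q4 m0 m2 ^+ 2 + (2 * m0) ^+ 2) * ((m1 ^+ 2 + m2 ^+ 2) * (m1 ^+ 2 + 1)) = 0.
  transitivity (q0 m0 m1 m2 ^+ 2 + q1 m0 m1 m2 ^+ 2).
    by rewrite /q0 /q1; ring.
  by rewrite Q0 Q1 expr0n addr0.
have m00 : 0 < (2 * m0) ^+ 2.
  by rewrite lt0r sqr_ge0 sqrf_eq0 mulf_neq0 // pnatr_eq0.
have : 0 < (q4 m0 m2 ^+ 2 + (2 * m0) ^+ 2) * ((m1 ^+ 2 + m2 ^+ 2) * (m1 ^+ 2 + 1)).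
  apply: mulr_gt0; first by rewrite ltr_wpDl ?sqr_ge0.
  by apply: mulr_gt0; [exact: m1Dm2_gt0 | exact: m1D1_gt0].
by rewrite E ltxx.
Qed.

Lemma bennett_map_solution v : V v -> Y (h v).
Proof.
move=> /VP[x0 [x2 [y0 [y2 [cl ->]]]]]; rewrite h_ess.
by apply/YP; exists x0, x2, y0, y2.
Qed.

Lemma bennett_map_constraint v : V v -> constraint_eq m0 m1 m2 (h v).
Proof.
by move=> /VP[x0 [x2 [y0 [y2 [cl ->]]]]]; rewrite h_ess; exact: closed_constraint.
Qed.

Lemma essential_coords_variety p : Y p -> V (essential_coords p).
Proof.
move=> /YP[x0 [x2 [y0 [y2 [cl ->]]]]]; apply/VP; exists x0, x2, y0, y2; split=> //.
exact: essential_coordsE.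
Qed.

Lemma bennett_mapK v : essential_coords (h v) = v.
Proof.
rewrite /essential_coords /h /bennett_map /= -![rvec 4 _]/(quat _ _ _ _) !quatE.
by rewrite -quat_eta.
Qed.

Lemma essential_coordsK p : Y p -> h (essential_coords p) = p.
Proof. by case=> _ /eight_formulasE. Qed.

Lemma solutions_sign_class p : X p -> exists2 p', Y p' & sign_class p' p.
Proof.
move=> /XP[x0 [x2 [y0 [y2 [s [cl ->]]]]]]; exists (closed_conf x0 x2 y0 y2).
  by apply/YP; exists x0, x2, y0, y2.
by exists false, s, false.
Qed.

Lemma solutions_alternatives : X = Xplus `|` Xminus.
Proof.
apply/seteqP; split=> [p Xp | p [[]|[]] //].
have /XP[x0 [x2 [y0 [y2 [s [cl pE]]]]]] := Xp.
have := signed_alternative x0 x2 y0 y2 s; rewrite -pE.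
by case: (sgE s) => -> ?; [left | right].
Qed.

Lemma flip_b_alternative : Xminus = @flip_b R @` Xplus.
Proof.
have flipK p : flip_b (flip_b p) = p by case: p => -[a b] c; rewrite /flip_b opprK.
have Xflip p : X p -> X (flip_b p).
  move=> /XP[x0 [x2 [y0 [y2 [s [cl ->]]]]]]; apply/XP; exists x0, x2, y0, y2, (~~ s).
  by split=> //; rewrite /flip_b /signed /= signrN scaleNr.
have alt s p : alternative m0 m1 m2 s p -> alternative m0 m1 m2 (- s) (flip_b p).
  by case: p => -[a b] c [b0 b1]; split; rewrite mxE mulNr ?b0 ?b1.
apply/seteqP; split=> [p [Xp Ap] | _ [p [Xp Ap] <-]].
  by exists (flip_b p); rewrite ?flipK //; split; [exact: Xflip | rewrite -[1]opprK; exact: alt].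
by split; [exact: Xflip | exact: alt].
Qed.

(** A point of [Xplus] whose [b] is minus the one given by the formulas satisfies both alternatives.
    Hence [t0 a0 c0 = t1 a0 c0 = 0], while [t0] and [t1] do not both vanish. *)
Lemma Xplus_cover : Xplus = Y `|` Xa `|` Xc.
Proof.
apply/seteqP; split=> [p [Xp Ap] | p [[Yp|[]]|[]] //]; last first.
  split; first by case: Yp.
  have /YP[x0 [x2 [y0 [y2 [cl ->]]]]] := Yp.
  have := signed_alternative x0 x2 y0 y2 false.
  by rewrite /signed !scale1r.
have /XP[x0 [x2 [y0 [y2 [s [cl pE]]]]]] := Xp.
have [sE | sE] : s = false \/ s = true by case: (s); [right | left].
  by left; left; apply/YP; exists x0, x2, y0, y2; rewrite pE sE /signed !scale1r.
have := signed_alternative x0 x2 y0 y2 s; rewrite -pE sE expr1 => Ap'.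
move: (Ap) (Ap') pE; case: p Xp {Ap'} Ap => -[a b] c Xp Ap [b0 b1] [b0' b1'] pE.
have ac : (a 0 0 == 0) || (c 0 0 == 0).
  have z t : - 1 * t = 1 * t -> t == 0 :> R.
    rewrite mulN1r mul1r => /eqP; rewrite eq_sym -subr_eq0 opprK -mulr2n mulrn_eq0.
    by [].
  apply/negPn/negP; rewrite negb_or => /andP[/negbTE a0 /negbTE c0].
  have zt t : t * a 0 0 * c 0 0 == 0 -> t == 0 by rewrite mulf_eq0 c0 orbF mulf_eq0 a0 orbF.
  have := zt _ (z _ (etrans (esym b0') b0)); have := zt _ (z _ (etrans (esym b1') b1)).
  by move=> T1 T0; move: t01_neq0; rewrite T0 T1.
by case/orP: ac => /eqP E; [left; right | right]; split.
Qed.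

Let baZ k x0 x2 : ba (k * x0) (k * x2) = k *: ba x0 x2.
Proof. by rewrite /ba /body_a scale_quat; congr quat; ring. Qed.

Let bcZ k y0 y2 : bc (k * y0) (k * y2) = k *: bc y0 y2.
Proof. by rewrite /bc /body_c scale_quat; congr quat; ring. Qed.

Let qmulZr k (a b : 'rV[R]_4) : qmul a (k *: b) = k *: qmul a b.
Proof.
by rewrite (quat_eta a) (quat_eta b) scale_quat !qmul_quat scale_quat; congr quat; ring.
Qed.

Let qmulZl k (a b : 'rV[R]_4) : qmul (k *: a) b = k *: qmul a b.
Proof.
by rewrite (quat_eta a) (quat_eta b) scale_quat !qmul_quat scale_quat; congr quat; ring.
Qed.

Let bbZ k l x0 x2 y0 y2 :
  bb (k * x0) (k * x2) (l * y0) (l * y2) = (k * l) *: bb x0 x2 y0 y2.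
Proof.
rewrite /bb /body_b.
have -> : quat_b m0 m2 (k * x0) (k * x2) (l * y0) (l * y2) =
    (k * l) *: quat_b m0 m2 x0 x2 y0 y2.
  by rewrite /quat_b scale_quat; congr quat; ring.
by rewrite qmulZr qmulZl !scalerA mulrC.
Qed.

Lemma signed_closed_conf (s1 s3 : bool) x0 x2 y0 y2 :
  signed (closed_conf x0 x2 y0 y2) s1 (s1 (+) s3) s3 =
  closed_conf ((-1) ^+ s1 * x0) ((-1) ^+ s1 * x2) ((-1) ^+ s3 * y0) ((-1) ^+ s3 * y2).
Proof. by rewrite /closed_conf baZ bcZ bbZ /signed signr_addb. Qed.

Lemma closed_loop_sign (s1 s3 : bool) x0 x2 y0 y2 : closed_loop m2 x0 x2 y0 y2 ->
  closed_loop m2 ((-1) ^+ s1 * x0) ((-1) ^+ s1 * x2) ((-1) ^+ s3 * y0) ((-1) ^+ s3 * y2).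
Proof.
move=> [x1 y1 xy]; split; rewrite ?exprMn ?sqrr_sign ?mul1r //.
by apply: (lincomb1 ((-1) ^+ s1 * (-1) ^+ s3) xy); ring.
Qed.

Section Degenerate.

Variables (x0 x2 y0 y2 : R) (Q : set (conf R)).
Hypothesis closed : closed_loop m2 x0 x2 y0 y2.
Hypothesis ac0 : ba x0 x2 0 0 * bc y0 y2 0 0 = 0.
Hypothesis Q_signed : forall s1 s2 s3, Q (signed (closed_conf x0 x2 y0 y2) s1 s2 s3).
Hypothesis Q_closed : forall x0' x2' y0' y2' s, closed_loop m2 x0' x2' y0' y2' ->
  Q (signed (closed_conf x0' x2' y0' y2') false s false) -> exists s1 s3 : bool,
  [/\ x0' = (-1) ^+ s1 * x0, x2' = (-1) ^+ s1 * x2, y0' = (-1) ^+ s3 * y0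
     & y2' = (-1) ^+ s3 * y2].

Let P := closed_conf x0 x2 y0 y2.
Let E := Xplus `&` Q.

Lemma degenerate_sign_class : E = sign_class P.
Proof.
apply/seteqP; split=> [p [[/XP[x0' [x2' [y0' [y2' [s [cl ->]]]]]] _] Qp] | p].
  have [s1 [s3 [-> -> -> ->]]] := Q_closed cl Qp.
  rewrite -signed_closed_conf; exists s1, (s (+) (s1 (+) s3)), s3.
  by rewrite signed_signed.
move=> [s1 [s2 [s3 pE]]].
have {pE} pE : p = signed P s1 s2 s3 by [].
have pE' : p = signed (closed_conf ((-1) ^+ s1 * x0) ((-1) ^+ s1 * x2)
    ((-1) ^+ s3 * y0) ((-1) ^+ s3 * y2)) false (s2 (+) (s1 (+) s3)) false.
  by rewrite -signed_closed_conf pE signed_signed -addbA addbb addbF.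
split; last by rewrite pE; exact: Q_signed.
split.
  rewrite pE'; apply/XP; do 5![eexists]; split; last reflexivity.
  exact: closed_loop_sign.
have [b0 b1] := closed_b01 x0 x2 y0 y2.
rewrite pE /signed /=; split; rewrite [LHS]scaleE ?b0 ?b1 !scaleE mul1r;
  move: ((-1) ^+ s1) ((-1) ^+ s2) ((-1) ^+ s3) => e1 e2 e3.
  by apply: (lincomb1 ((e2 - e1 * e3) * t0 m0 m1 m2) ac0); ring.
  by apply: (lincomb1 ((e2 - e1 * e3) * t1 m0 m1 m2) ac0); ring.
Qed.

Lemma degenerate_card : (E #= `I_8)%card.
Proof. by rewrite degenerate_sign_class; apply/card_sign_class/closed_unit. Qed.

Lemma degenerate_card_formulas : (E `&` Y #= `I_4)%card.
Proof.
rewrite (_ : E `&` Y = [set q | exists s1 s3 : bool, q = signed P s1 (s1 (+) s3) s3]).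
  exact/card_sign_class_compatible/closed_unit.
apply/seteqP; split=> [p [[_ Qp] /YP[x0' [x2' [y0' [y2' [cl pE]]]]]] | p [s1 [s3 pE]]].
  have pE' : p = signed (closed_conf x0' x2' y0' y2') false false false.
    by rewrite pE /signed !scale1r.
  move: Qp; rewrite pE' => /(Q_closed cl)[s1 [s3 [-> -> -> ->]]].
  rewrite -signed_closed_conf; exists s1, s3.
  by rewrite signed_signed.
split; first by rewrite degenerate_sign_class pE; exists s1, (s1 (+) s3), s3.
apply/YP; rewrite pE signed_closed_conf; do 4![eexists]; split; last reflexivity.
exact: closed_loop_sign.
Qed.

End Degenerate.

Let unit_sign (x : R) : x ^+ 2 = 1 -> exists s : bool, x = (-1) ^+ s.
Proof.
move/eqP; rewrite sqrf_eq1 => /orP[] /eqP ->; [by exists false | by exists true].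
Qed.

Let div_eq0 (x y : R) : y != 0 -> x / y = 0 -> x = 0.
Proof. by move=> y0 /eqP; rewrite mulf_eq0 invr_eq0 (negbTE y0) orbF => /eqP. Qed.

Lemma degenerateP (E : set (conf R)) : E = Xa \/ E = Xc ->
  [/\ (E #= `I_8)%card, exists p, E = sign_class p,
      forall p p', E p -> E p' -> same_orientation p p' & (E `&` Y #= `I_4)%card].
Proof.
have n1 : Num.sqrt (m1 ^+ 2 + 1) != 0.
  by rewrite lt0r_neq0 // sqrtr_gt0 m1D1_gt0.
have n2 : Num.sqrt (m1 ^+ 2 + m2 ^+ 2) != 0.
  by rewrite lt0r_neq0 // sqrtr_gt0 m1Dm2_gt0.
have concl x0 x2 y0 y2 (Q : set (conf R)) : E = Xplus `&` Q ->
  closed_loop m2 x0 x2 y0 y2 -> ba x0 x2 0 0 * bc y0 y2 0 0 = 0 ->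
  (forall s1 s2 s3, Q (signed (closed_conf x0 x2 y0 y2) s1 s2 s3)) ->
  (forall x0' x2' y0' y2' s, closed_loop m2 x0' x2' y0' y2' ->
    Q (signed (closed_conf x0' x2' y0' y2') false s false) -> exists s1 s3 : bool,
    [/\ x0' = (-1) ^+ s1 * x0, x2' = (-1) ^+ s1 * x2, y0' = (-1) ^+ s3 * y0
      & y2' = (-1) ^+ s3 * y2]) ->
  [/\ (E #= `I_8)%card, exists p, E = sign_class p,
      forall p p', E p -> E p' -> same_orientation p p' & (E `&` Y #= `I_4)%card].
  move=> -> cl ac Q1 Q2; split.
  - exact: degenerate_card cl ac Q1 Q2.
  - by exists (closed_conf x0 x2 y0 y2); exact: degenerate_sign_class.
  - rewrite (degenerate_sign_class cl ac Q1 Q2) => p p'.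
    exact: sign_class_same_orientation.
  - exact: degenerate_card_formulas cl ac Q1 Q2.
case=> [EXa | EXc].
(* If [x0 = 0], the relation [x0 y0 + m2 x2 y2 = 0] forces [y2 = 0], and the two unit circles leave
   only signs for [x2] and [y0]. The case [c_0 = 0] is symmetric. *)
- apply: (concl 0 1 1 0 _ EXa).
  + by split; rewrite ?expr0n ?expr1n ?add0r ?addr0 // mul0r !mulr0 addr0.
  + by rewrite quatE mul0r mul0r.
  + by move=> s1 s2 s3; rewrite /= scaleE quatE mul0r mulr0.
  move=> x0' x2' y0' y2' s [x1 y1 xy] /=; rewrite scale1r quatE => /(div_eq0 n1) x0.
  move: x1 xy; rewrite x0 expr0n add0r mul0r add0r => x1 /eqP.
  have x2 : x2' != 0 by apply: contraTneq isT => x2; move/eqP: x1; rewrite x2 expr0n eq_sym oner_eq0.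
  rewrite !mulf_eq0 (negbTE m2_neq0) (negbTE x2) /= => /eqP y2.
  move: y1; rewrite y2 expr0n addr0 => y1.
  have [[s1 ->] [s3 ->]] := (unit_sign x1, unit_sign y1).
  by exists s1, s3; rewrite !mulr0 !mulr1.
- apply: (concl 1 0 0 1 _ EXc).
  + by split; rewrite ?expr0n ?expr1n ?add0r ?addr0 // mul0r !mulr0 addr0.
  + by rewrite [bc _ _ 0 0]quatE mulr0 mul0r mulr0.
  + by move=> s1 s2 s3; rewrite /= scaleE quatE mulr0 mul0r mulr0.
  move=> x0' x2' y0' y2' s [x1 y1 xy] /=.
  rewrite scale1r quatE => /(div_eq0 n2) /eqP.
  rewrite mulf_eq0 (negbTE m1_neq0) /= => /eqP y0.
  move: y1 xy; rewrite y0 expr0n add0r mulr0 add0r => y1 /eqP.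
  have y2 : y2' != 0 by apply: contraTneq isT => y2; move/eqP: y1; rewrite y2 expr0n eq_sym oner_eq0.
  rewrite !mulf_eq0 (negbTE m2_neq0) (negbTE y2) orbF /= => /eqP x2.
  move: x1; rewrite x2 expr0n addr0 => x1.
  have [[s1 ->] [s3 ->]] := (unit_sign x1, unit_sign y1).
  by exists s1, s3; rewrite !mulr0 !mulr1.
Qed.

End SolutionSet.

(** * Real components *)

Lemma cvg_mx (T : topologicalType) m n (S : Type) (F : set_system S) (FF : Filter F)
    (f : S -> 'M[T]_(m, n)) (M : 'M[T]_(m, n)) :
  (forall i j, f x i j @[x --> F] --> M i j) -> f x @[x --> F] --> M.
Proof.
move=> fM A [P nP sPA]; have : \forall x \near F, forall i j, P i j (f x i j).
  by apply: filter_forall => i; apply: filter_forall => j; exact: fM (nP i j).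
by apply: filterS => x Px; exact: sPA.
Qed.

Lemma continuous_rvec4 (T : topologicalType) (R : realType) (f0 f1 f2 f3 : T -> R) :
  continuous f0 -> continuous f1 -> continuous f2 -> continuous f3 ->
  continuous (fun x => rvec 4 [:: f0 x; f1 x; f2 x; f3 x]).
Proof.
move=> c0 c1 c2 c3 x; apply: cvg_mx => i j; rewrite mxE.
rewrite (_ : (fun y => _) = fun y => [:: f0 y; f1 y; f2 y; f3 y]`_j); last first.
  by apply/funext => y; rewrite mxE.
move: j; apply: ord4P => /=; [exact: c0 | exact: c1 | exact: c2 | exact: c3].
Qed.

Section ContinuousFunctions.

Variables (R : realType) (T : topologicalType).
Implicit Types f g : T -> R.

Lemma continuous_mul f g :
  continuous f -> continuous g -> continuous (fun x => f x * g x).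
Proof. by move=> cf cg x; apply: cvgM; [exact: cf | exact: cg]. Qed.

Lemma continuous_add f g :
  continuous f -> continuous g -> continuous (fun x => f x + g x).
Proof. by move=> cf cg x; apply: cvgD; [exact: cf | exact: cg]. Qed.

Lemma continuous_opp f : continuous f -> continuous (fun x => - f x).
Proof. by move=> cf x; apply: cvgN; exact: cf. Qed.

Lemma continuous_const (k : R) : continuous (fun _ : T => k).
Proof. by move=> x; exact: cvg_cst. Qed.

End ContinuousFunctions.

Ltac continuity_by tac := repeat match goal with
  | |- context [ fun x => @?f x + @?g x ] => refine (@continuous_add _ _ f g _ _)
  | |- context [ fun x => @?f x * @?g x ] => refine (@continuous_mul _ _ f g _ _)
  | |- context [ fun x => @?f x ^+ 2 ] => refine (@continuous_mul _ _ f f _ _)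
  | |- context [ fun x => - @?f x ] => refine (@continuous_opp _ _ f _)
  | |- context [ fun x => ?k ] => refine (@continuous_const _ _ k)
  | _ => tac
  end.

(** On a connected subset of [E] the condition [0 < phi] is open. It is also closed there, since it
    agrees with [0 <= phi] as long as [phi] has no zero on [E]. *)
Lemma components_sign (T : topologicalType) (R : realType) (E A B : set T) (phi : T -> R) :
  continuous phi -> E = A `|` B -> connected A -> connected B ->
  A !=set0 -> B !=set0 -> (forall x, A x -> 0 < phi x) -> (forall x, B x -> phi x < 0) ->
  components E = [set A; B].
Proof.
move=> cphi -> cA cB [a Aa] [b Bb] Apos Bneg.
have comp (A' B' : set T) (psi : T -> R) x : continuous psi -> connected A' -> A' x ->
    (forall x, A' x -> 0 < psi x) -> (forall x, B' x -> psi x < 0) ->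
    connected_component (A' `|` B') x = A'.
  move=> cpsi cA' A'x A'pos B'neg; apply/seteqP; split=> [y [K [Kx KE cK] Ky] | y A'y].
    have KP : K `&` [set z | 0 < psi z] = K.
      apply: cK; first by exists x; split=> //=; exact: A'pos.
        exists [set z | 0 < psi z] => //.
        by have /continuousP := cpsi; move=> /(_ _ (@open_gt _ 0)).
      exists [set z | 0 <= psi z].
        by have /continuous_closedP := cpsi; move=> /(_ _ (@closed_ge _ 0)).
      apply/seteqP; split=> [z [Kz /= z0]|z [Kz /= z0]]; split=> //=; first exact: ltW.
      by have [/A'pos //|/B'neg] := KE _ Kz; rewrite ltNge z0.
    by move: Ky; rewrite -KP => -[/KE[//|/B'neg /= y0 /= y1]]; have := lt_trans y0 y1; rewrite ltxx.
  by exists A' => //; split=> //; left.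
have cpsi : continuous (fun x => - phi x) by move=> x; apply: cvgN; exact: cphi.
have compA x : A x -> connected_component (A `|` B) x = A.
  by move=> Ax; exact: comp cphi cA Ax Apos Bneg.
have compB x : B x -> connected_component (A `|` B) x = B.
  move=> Bx; rewrite setUC; apply: comp cpsi cB Bx _ _ => y.
    by rewrite oppr_gt0; exact: Bneg.
  by rewrite oppr_lt0; exact: Apos.
apply/seteqP; split=> [C [x [Ax|Bx] <-] | C [->|->]].
- by left; exact: compA.
- by right; exact: compB.
- by exists a; [left | exact: compA].
- by exists b; [right | exact: compB].
Qed.

Lemma cos_sin_onto (R : realType) (x y : R) :
  x ^+ 2 + y ^+ 2 = 1 -> exists t, cos t = x /\ sin t = y.
Proof.
move=> xy1; have x1 : -1 <= x <= 1.
  by rewrite -ler_norml -(@expr_le1 _ 2) // real_normK ?num_real // -xy1 lerDl sqr_ge0.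
have ca : cos (acos x) = x by apply: acosK; rewrite in_itv.
have sa : sin (acos x) = `|y|.
  by rewrite sin_acos // -xy1 addrAC subrr add0r sqrtr_sqr.
have [y0|y0] := leP 0 y.
  by exists (acos x); rewrite ca sa ger0_norm.
by exists (- acos x); rewrite cosN sinN ca sa ltr0_norm // opprK.
Qed.


Section Components.

Variables (R : realType) (m0 m1 m2 : R) (Jab Jbc : {pred {mpoly R[4 + 4]}}).
Hypotheses (m0_neq0 : m0 != 0) (m1_neq0 : m1 != 0) (m2_neq0 : m2 != 0).
Hypotheses (m2_neq1 : m2 != 1) (m2_neqN1 : m2 != -1) (q5_neq0 : q5 m0 m1 != 0).
Hypothesis Jab_comp : prime_component (I_ab m0 m1 m2)
    (row_mx (a_init m0 m1) (b_init m0 m1 m2)) Jab.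
Hypothesis Jbc_comp : prime_component (I_bc m0 m1 m2)
    (row_mx (b_init m0 m1 m2) (c_init m1 m2)) Jbc.

Let ess := essential_of m0 m1 m2.
Let V := bennett_variety m0 m1 m2.
Let Y := solutions_by_formulas m0 m1 m2 Jab Jbc.
Let h := bennett_map m0 m1 m2.
Let gamma := param m0 m1 m2.
Let gamma' := fun t => flip_c (gamma t).

Let n1 := Num.sqrt (m1 ^+ 2 + 1).
Let n2 := Num.sqrt (m1 ^+ 2 + m2 ^+ 2).
Let v2 := m0 ^+ 2 + 1.

Let n1_gt0 : 0 < n1. Proof. by rewrite sqrtr_gt0 m1D1_gt0. Qed.
Let n2_gt0 : 0 < n2. Proof. by rewrite sqrtr_gt0 m1Dm2_gt0. Qed.
Let n1_neq0 : n1 != 0. Proof. exact: lt0r_neq0. Qed.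
Let n2_neq0 : n2 != 0. Proof. exact: lt0r_neq0. Qed.
Let D0 : m0 ^+ 2 + 1 != 0 := m0D1_neq0 m0.

Let w2 (t : R) := m2 ^+ 2 * sin t ^+ 2 + cos t ^+ 2.
Let w (t : R) := Num.sqrt (w2 t).

Let w2_gt0 t : 0 < w2 t.
Proof.
have m22 : 0 < m2 ^+ 2 by rewrite lt0r sqrf_eq0 m2_neq0 sqr_ge0.
have [s0|s0] := eqVneq (sin t) 0.
  have := cos2Dsin2 t; rewrite /w2 s0 expr0n addr0 mulr0 add0r => ->.
  exact: ltr01.
by rewrite ltr_pwDl ?sqr_ge0 // mulr_gt0 // lt0r sqrf_eq0 s0 sqr_ge0.
Qed.

Let w_gt0 t : 0 < w t. Proof. by rewrite sqrtr_gt0. Qed.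
Let w_neq0 t : w t != 0. Proof. exact: lt0r_neq0. Qed.
Let wE t : w t ^+ 2 = w2 t. Proof. by rewrite sqr_sqrtr // ltW. Qed.

Let gammaE t : gamma t = ess (cos t) (- sin t) (m2 * sin t / w t) (cos t / w t).
Proof.
rewrite /gamma /param /q6 -[m2 ^+ 2 * _ + _]/(w2 t) sqrtrM ?ltW ?m1Dm2_gt0 //.
rewrite -/n1 -/n2 -/(w t) -[rvec 4 _]/(quat _ _ _ _) /ess /essential_of -/n1 -/n2.
congr quat; field; rewrite ?D0 ?n1_neq0 ?n2_neq0 ?w_neq0 //.
Qed.

Let flip_ess x0 x2 y0 y2 : flip_c (ess x0 x2 y0 y2) = ess x0 x2 (- y0) (- y2).
Proof.
rewrite /flip_c /ess /essential_of !quatE -[rvec 4 _]/(quat _ _ _ _).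
by congr quat; ring.
Qed.

Let closed_gamma t (e : R) : e ^+ 2 = 1 ->
  closed_loop m2 (cos t) (- sin t) (e * (m2 * sin t / w t)) (e * (cos t / w t)).
Proof.
move=> e1; split.
- by rewrite sqrrN cos2Dsin2.
- transitivity (e ^+ 2 * (w2 t / w t ^+ 2)).
    by have wi := w_neq0 t; rewrite /w2; field.
  by rewrite e1 wE divff ?mulr1 // lt0r_neq0.
by have wi := w_neq0 t; field.
Qed.

Let closed_gammaP x0 x2 y0 y2 : closed_loop m2 x0 x2 y0 y2 -> exists t e,
  [/\ e = 1 \/ e = -1, x0 = cos t, x2 = - sin t, y0 = e * (m2 * sin t / w t)
    & y2 = e * (cos t / w t)].
Proof.
move=> [x1 y1 xy].
have [t [ct st]] : exists t, cos t = x0 /\ sin t = - x2.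
  by apply: cos_sin_onto; rewrite sqrrN.
have x2E : x2 = - sin t by rewrite st opprK.
move: x1 xy; rewrite -ct x2E => x1 xy.
(* The relation puts [(y0, y2)] on the line spanned by the unit vector [(m2 sin t, cos t) / w t];
   [K] is its coordinate on that line. *)
pose K := (m2 * sin t * y0 + cos t * y2) / w t.
have wi := w_neq0 t.
have y0E : y0 = K * (m2 * sin t / w t).
  transitivity (K * w t * (m2 * sin t) / w t ^+ 2); last by field.
  apply: (canRL (mulfK _)); first by rewrite expf_neq0.
  rewrite /K mulfVK // wE /w2.
  by apply: (lincomb1 (cos t) xy); ring.
have y2E : y2 = K * (cos t / w t).
  transitivity (K * w t * cos t / w t ^+ 2); last by field.
  apply: (canRL (mulfK _)); first by rewrite expf_neq0.
  rewrite /K mulfVK // wE /w2.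
  by apply: (lincomb1 (- m2 * sin t) xy); ring.
exists t, K; split=> //.
have : K ^+ 2 = 1.
  rewrite -y1 y0E y2E.
  transitivity (K ^+ 2 * (w2 t / w t ^+ 2)); last by rewrite /w2; field.
  by rewrite wE divff ?mulr1 // lt0r_neq0.
by move/eqP; rewrite sqrf_eq1 => /orP[] /eqP; [left | right].
Qed.

Let gamma'E t : gamma' t = ess (cos t) (- sin t) (-1 * (m2 * sin t / w t)) (-1 * (cos t / w t)).
Proof. by rewrite /gamma' gammaE flip_ess !mulN1r. Qed.

Let VE : V = range gamma `|` range gamma'.
Proof.
apply/seteqP; split=> [v /bennettP H | v [] [t _ <-]].
- have [x0 [x2 [y0 [y2 [cl ->]]]]] := H m1_neq0 m2_neq0 q5_neq0.
  have [t [e [[] -> -> -> -> ->]]] := closed_gammaP cl.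
    by left; exists t => //; rewrite gammaE !mul1r.
  by right; exists t => //; rewrite gamma'E.
- apply/bennettP => //; do 4![eexists]; split; last exact: gammaE.
  by have := @closed_gamma t 1 (expr1n _ _); rewrite !mul1r.
- apply/bennettP => //; do 4![eexists]; split; last exact: gamma'E.
  by apply: closed_gamma; rewrite sqrrN expr1n.
Qed.

(** In reduced parameters this is [(x0 y2 - m2 x2 y0) / (n1 n2)]. It equals [w t / (n1 * n2)] along
    [gamma] and is odd under [flip_c], so it separates the two curves. *)
Let phi (v : 'rV[R]_4) : R :=
  v 0 0 * v 0 3 / m2 - m2 * (v 0 1 * (v2 / q5 m0 m1)) * (v 0 2 / m1).

Let phi_gamma t : 0 < phi (gamma t).
Proof.
have -> : phi (gamma t) = w t / (n1 * n2).
  apply: (mulfI (w_neq0 t)); rewrite mulrA -expr2 wE gammaE /phi /ess /essential_of !quatE.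
  rewrite /w2 -/n1 -/n2 /v2.
  by field; rewrite ?m1_neq0 ?m2_neq0 ?q5_neq0 ?D0 ?n1_neq0 ?n2_neq0 ?w_neq0.
by rewrite divr_gt0 // mulr_gt0.
Qed.

Let phi_flip v : phi (flip_c v) = - phi v.
Proof.
rewrite /phi /flip_c -[rvec 4 _]/(quat _ _ _ _) !quatE; field.
by rewrite m1_neq0 q5_neq0 m2_neq0.
Qed.

Let coord_c i : continuous (fun v : 'rV[R]_4 => v 0 i).
Proof. exact: coord_continuous. Qed.

Let phi_c : continuous phi.
Proof. by rewrite /phi; continuity_by ltac:(exact: coord_c). Qed.

Let cos_c : continuous (fun t : R => cos t). Proof. exact: continuous_cos. Qed.
Let sin_c : continuous (fun t : R => sin t). Proof. exact: continuous_sin. Qed.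

Let gamma_c : continuous gamma.
Proof.
have q6_c : continuous (fun t => q6 m1 m2 t).
  by rewrite /q6; continuity_by ltac:(first [exact: cos_c | exact: sin_c]).
have inv_c : continuous (fun t : R => (Num.sqrt (q6 m1 m2 t))^-1).
  move=> t; apply: cvgV.
    by rewrite lt0r_neq0 // sqrtr_gt0 mulr_gt0 ?m1Dm2_gt0 //; exact: w2_gt0.
  by apply: (continuous_comp (q6_c t)); exact: sqrt_continuous.
by apply: continuous_rvec4;
  continuity_by ltac:(first [exact: inv_c | exact: cos_c | exact: sin_c]).
Qed.

Let flip_continuous : continuous (@flip_c R).
Proof. by apply: continuous_rvec4; continuity_by ltac:(exact: coord_c). Qed.

Let h_continuous : continuous h.
Proof.
have ha : continuous (fun v => (h v).1.1).
  by apply: continuous_rvec4; continuity_by ltac:(exact: coord_c).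
have hb : continuous (fun v => (h v).1.2).
  by apply: continuous_rvec4; continuity_by ltac:(exact: coord_c).
have hc : continuous (fun v => (h v).2).
  by apply: continuous_rvec4; continuity_by ltac:(exact: coord_c).
by move=> v; exact: (cvg_pair (cvg_pair (ha v) (hb v)) (hc v)).
Qed.

Let gamma'_c : continuous gamma'.
Proof. by move=> t; apply: continuous_comp; [exact: gamma_c | exact: flip_continuous]. Qed.

Let hgamma_c : continuous (h \o gamma).
Proof. by move=> t; apply: continuous_comp; [exact: gamma_c | exact: h_continuous]. Qed.

Let hgamma'_c : continuous (h \o gamma').
Proof. by move=> t; apply: continuous_comp; [exact: gamma'_c | exact: h_continuous]. Qed.

Let connected_range (T : topologicalType) (f : R -> T) : continuous f -> connected (range f).
Proof.
move=> cf; apply: connected_continuous_connected; last exact: continuous_subspaceT.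
by apply/connected_intervalP => x y _ _ z _.
Qed.

Let phi_gamma' t : phi (gamma' t) < 0.
Proof. by rewrite /gamma' phi_flip oppr_lt0. Qed.

Lemma range_gamma_neq : range gamma <> range gamma'.
Proof.
move=> E; have : range gamma (gamma 0) by exists 0.
by rewrite E => -[t _ Et]; have := phi_gamma 0; rewrite -Et ltNge ltW.
Qed.

Lemma components_bennett : components V = [set range gamma; range gamma'].
Proof.
apply: (components_sign phi_c VE); try exact: connected_range.
- by exists (gamma 0), 0.
- by exists (gamma' 0), 0.
- by move=> _ [t _ <-].
- by move=> _ [t _ <-].
Qed.

Let psi (p : conf R) : R := phi (essential_coords p).

Let psi_h v : psi (h v) = phi v.
Proof. by rewrite /psi bennett_mapK. Qed.

Let psi_c : continuous psi.
Proof.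
have fst_c : continuous (fun p : conf R => p.1.1).
  by move=> p; exact: (@continuous_comp _ _ _ fst fst p cvg_fst cvg_fst).
have snd_c : continuous (fun p : conf R => p.2) by move=> p; exact: cvg_snd.
have ess_c : continuous (@essential_coords R).
  apply: (@continuous_rvec4 _ R (fun p : conf R => p.1.1 0 0) (fun p => p.1.1 0 2)
    (fun p => p.2 0 0) (fun p => p.2 0 2)) => p.
  - exact: (continuous_comp (fst_c p) (@coord_c 0 _)).
  - exact: (continuous_comp (fst_c p) (@coord_c 2 _)).
  - exact: (continuous_comp (snd_c p) (@coord_c 0 _)).
  - exact: (continuous_comp (snd_c p) (@coord_c 2 _)).
by move=> p; exact: (continuous_comp (ess_c p) (@phi_c _)).
Qed.

Let YE : Y = range (h \o gamma) `|` range (h \o gamma').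
Proof.
apply/seteqP; split=> [p Yp | p [] [t _ <-]].
- have := essential_coords_variety m0_neq0 m1_neq0 m2_neq0 m2_neq1 m2_neqN1 q5_neq0 Jab_comp Jbc_comp Yp.
  rewrite -/V VE => -[] [t _ Et]; [left | right]; exists t => //=;
  by rewrite Et; apply: essential_coordsK Yp.
- by apply: bennett_map_solution => //; rewrite -/V VE; left; exists t.
- by apply: bennett_map_solution => //; rewrite -/V VE; right; exists t.
Qed.

Lemma components_solutions_by_formulas :
  components Y = [set range (h \o gamma); range (h \o gamma')].
Proof.
apply: (components_sign psi_c YE); try exact: connected_range.
- by exists (h (gamma 0)), 0.
- by exists (h (gamma' 0)), 0.
- by move=> _ [t _ <-] /=; rewrite psi_h.
- by move=> _ [t _ <-] /=; rewrite psi_h.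
Qed.

Lemma gamma_same_orientation t : same_orientation (h (gamma t)) (h (gamma' t)).
Proof.
have -> : h (gamma' t) = signed (h (gamma t)) false true true.
  rewrite /signed !expr1 !scaleN1r scale1r /gamma' /h /bennett_map /flip_c /=.
  rewrite -![rvec 4 _]/(quat _ _ _ _) !quatE !opp_quat.
  by congr (_, quat _ _ _ _, quat _ _ _ _); ring.
by split; rewrite [RHS]rotmx_sign.
Qed.

Lemma gamma_initial : exists t,
  [/\ cos t = m1 / Num.sqrt (m1 ^+ 2 + 1), sin t = - (1 / Num.sqrt (m1 ^+ 2 + 1)) &
      h (gamma t) = init m0 m1 m2 \/ h (gamma t) = flip_b (init m0 m1 m2)].
Proof.
have [t [ct st]] : exists t, cos t = m1 / n1 /\ sin t = - (1 / n1).
  apply: cos_sin_onto; have := init_closed m2 m1_neq0; rewrite -/n1 => -[+ _ _].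
  by rewrite sqrrN.
(* The second alternative, because the formulas yield [- b_init] here, by [b_initE]. *)
exists t; split=> //; right; rewrite gammaE.
have wt : w t = n2 / n1.
  have -> : w t = `|n2 / n1|; last by rewrite gtr0_norm ?divr_gt0.
  rewrite -sqrtr_sqr; congr Num.sqrt; rewrite /w2 ct st.
  have -> : (n2 / n1) ^+ 2 = (m1 ^+ 2 + m2 ^+ 2) / n1 ^+ 2.
    by rewrite expr_div_n sqr_sqrtr // ltW ?m1Dm2_gt0.
  by field.
rewrite [LHS]bennett_mapE // /flip_b /init /= a_initE // b_initE // c_initE //.
have -> : m2 * sin t / w t = - m2 / n2.
  by rewrite wt st; field; rewrite n1_neq0 n2_neq0.
have -> : cos t / w t = m1 / n2 by rewrite wt ct; field; rewrite n1_neq0 n2_neq0.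
by rewrite ct st !opprK.
Qed.

End Components.

(** * Regularity of Bennett's variety *)

Lemma meval_mderivXU (R : realType) n (i j : 'I_n) (v : 'I_n -> R) :
  meval v (mderiv i (mpolyX R (mnm1 j))) = (i == j)%:R.
Proof.
rewrite mderivX mevalZ mnm1E eq_sym.
have [->|_] := eqVneq i j; last by rewrite mul0r.
by rewrite (_ : mnm_sub _ _ = mnm0) ?mpolyX0 ?meval1 ?mulr1 //; apply/mnmP => k; rewrite mnmBE subnn mnm0E.
Qed.

Lemma sum_ord3 (A : nmodType) (F : 'I_3 -> A) : \sum_(i < 3) F i = F 0 + F 1 + F 2.
Proof.
rewrite !big_ord_recr big_ord0 /= add0r.
by congr (F _ + F _ + F _); apply: val_inj.
Qed.

Section Jacobian.

Variables (R : realType) (m0 m1 m2 : R).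
Hypotheses (m1_neq0 : m1 != 0) (m2_neq0 : m2 != 0) (q5_neq0 : q5 m0 m1 != 0).
Hypotheses (m2_neq1 : m2 != 1) (m2_neqN1 : m2 != -1).

Local Notation q5 := (q5 m0 m1).

Let D0 : m0 ^+ 2 + 1 != 0 := m0D1_neq0 m0.

Lemma poly_jacobian_bennett (v : 'rV[R]_4) i j :
  poly_jacobian (bennett m0 m1 m2) v i j = (nth [::]
   [:: [:: 2 * v 0 0; (m0 ^+ 2 + 1) ^+ 2 / q5 ^+ 2 * (2 * v 0 1); 0; 0];
       [:: 0; 0; m2 ^+ 2 * (2 * v 0 2); m1 ^+ 2 * (2 * v 0 3)];
       [:: q5 * v 0 2; m1 * (m0 ^+ 2 + 1) * v 0 3; q5 * v 0 0;
           m1 * (m0 ^+ 2 + 1) * v 0 1]] i)`_j.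
Proof.
rewrite mxE; have dE := (mderivD, mderivN, mderivM, mderivC, mevalD, mevalN, mevalM, mevalC,
  mevalXU, meval_mderivXU, meval0).
change 'I_3 in i.
by move: i j; apply: ord3P; apply: ord4P; rewrite /= !expr2 !dE /=; ring.
Qed.

(** Let [u] be a left null vector. If [u2 != 0], eliminating [u0] from the first two columns and
    [u1] from the last two gives linear equations for [c0 * a2] and [c2 * a0] with determinant
    proportional to [1 - m2 ^+ 2]. Both products vanish, and with [E3] this kills [(a0, a2)] or
    [(c0, c2)], against the ellipses. If [u2 = 0], the gradients of the two ellipses are nonzero and
    involve different variables. *)
Lemma rank_poly_jacobian_bennett v : bennett_variety m0 m1 m2 v ->
  \rank (poly_jacobian (bennett m0 m1 m2) v) = 3%N.
Proof.
move=> /bennett_varietyE[E1 E2 E3]; set J := poly_jacobian _ _.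
suff : row_free J by move/eqP.
rewrite -kermx_eq0; apply/rowV0P => u /sub_kermxP uJ.
have e j : \sum_(i < 3) u 0 i * J i j = 0.
  by have := congr1 (fun M : 'rV_4 => M 0 j) uJ; rewrite !mxE.
move: (e 0) (e 1) (e 2) (e 3); rewrite !sum_ord3 !poly_jacobian_bennett /= {e}.
set a0 := v 0 0 in E1 E2 E3 *; set a2 := v 0 1 in E1 E2 E3 *.
set c0 := v 0 2 in E1 E2 E3 *; set c2 := v 0 3 in E1 E2 E3 *.
set u0 := u 0 0; set u1 := u 0 1; set u2 := u 0 2 => e0 e1 e2 e3.
have a_neq0 : a0 = 0 -> a2 = 0 -> False.
  move=> a00 a20; move/eqP: E1; rewrite a00 a20 expr0n mulr0 addr0 sub0r oppr_eq0 div1r.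
  by rewrite invr_eq0 (negbTE (lt0r_neq0 (m1D1_gt0 _))).
have c_neq0 : c0 = 0 -> c2 = 0 -> False.
  move=> c00 c20; move/eqP: E2; rewrite c00 c20 expr0n !mulr0 addr0 sub0r oppr_eq0.
  apply/negP; rewrite !mulf_neq0 ?invr_neq0 ?expf_neq0 //.
  exact/lt0r_neq0/m1Dm2_gt0.
have eq0 (x y : R) : x != 0 -> x * y = 0 -> y = 0.
  by move=> x0 /eqP; rewrite mulf_eq0 (negbTE x0) => /eqP.
have [u20|u2_neq0] := eqVneq u2 0; last first.
  have A : (m0 ^+ 2 + 1) * (c0 * a2) - m1 * q5 * (c2 * a0) = 0.
    apply: (eq0 _ _ u2_neq0); apply: (eq0 _ _ D0).
    by apply: (lincomb2 ((m0 ^+ 2 + 1) ^+ 2 / q5 * a2) (- q5 * a0) e0 e1); field.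
  have B : q5 * m1 * (c2 * a0) - (m0 ^+ 2 + 1) * m2 ^+ 2 * (c0 * a2) = 0.
    apply: (eq0 _ _ u2_neq0); apply: (eq0 _ _ m1_neq0).
    by apply: (lincomb2 (m1 ^+ 2 * c2) (- m2 ^+ 2 * c0) e2 e3); ring.
  have ca : c0 * a2 = 0.
    apply: (eq0 (1 - m2 ^+ 2)).
      rewrite -(expr1n _ 2) subr_sqr mulf_neq0 //.
        by rewrite subr_eq0 eq_sym.
      by rewrite addrC addr_eq0.
    by apply: (eq0 _ _ D0); apply: (lincomb2 1 1 A B); ring.
  have ac : c2 * a0 = 0.
    apply: (eq0 _ _ (mulf_neq0 m1_neq0 q5_neq0)).
    by move: A; rewrite ca mulr0 sub0r => /eqP; rewrite oppr_eq0 => /eqP.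
  exfalso; move/eqP: ca; rewrite mulf_eq0 => /orP[] /eqP z.
    have a00 : a0 = 0 by apply: (eq0 c2) ac; apply/eqP; exact: c_neq0.
    apply: (a_neq0 a00); apply: (eq0 c2); first by apply/eqP; exact: c_neq0.
    apply: (eq0 _ _ (mulf_neq0 m1_neq0 D0)).
    by move: E3; rewrite a00 mulr0 addr0 mulrA.
  have a0_neq0 : a0 != 0 by apply/eqP => /a_neq0 /(_ z).
  have c20 : c2 = 0 by apply: (eq0 _ _ a0_neq0); rewrite mulrC.
  apply: c_neq0 c20; apply: (eq0 _ _ a0_neq0); apply: (eq0 _ _ q5_neq0).
  by move: E3; rewrite z mulr0 add0r => <-; ring.
have two0 : 2 != 0 :> R by rewrite pnatr_eq0.
have u00 : u0 = 0.
  apply/eqP; apply: contraT => u0_neq0; exfalso.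
  move: e0 e1; rewrite u20 !mulr0 !mul0r !addr0 => /(eq0 _ _ u0_neq0) /(eq0 _ _ two0) a00.
  move=> /(eq0 _ _ u0_neq0); rewrite mulrCA => /(eq0 _ _ two0) /eq0 H.
  by apply: (a_neq0 a00); apply: H; rewrite !mulf_neq0 ?invr_neq0 ?expf_neq0.
have u10 : u1 = 0.
  apply/eqP; apply: contraT => u1_neq0; exfalso.
  move: e2 e3; rewrite u20 !mulr0 !mul0r !addr0 !add0r.
  move=> /(eq0 _ _ u1_neq0) /(eq0 _ _ (expf_neq0 2 m2_neq0)) /(eq0 _ _ two0) c00.
  by move=> /(eq0 _ _ u1_neq0) /(eq0 _ _ (expf_neq0 2 m1_neq0)) /(eq0 _ _ two0) /(c_neq0 c00).
apply/rowP => i; rewrite [RHS]mxE; change 'I_3 in i.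
by move: i; apply: ord3P.
Qed.

End Jacobian.

(** * Essential variables *)

Section Coords.

Variable R : realType.
Implicit Types p : conf R.

Lemma coordsE p i : coords p 0 i = [:: p.1.1 0 0; p.1.1 0 1; p.1.1 0 2; p.1.1 0 3;
  p.1.2 0 0; p.1.2 0 1; p.1.2 0 2; p.1.2 0 3; p.2 0 0; p.2 0 1; p.2 0 2; p.2 0 3]`_i.
Proof.
change 'I_(4 + 4 + 4) in i; rewrite /coords mxE; case: splitP => j ->.
  rewrite mxE; case: splitP => k ->; move: k; by apply: ord4P.
by move: j; apply: ord4P.
Qed.

Lemma coords_inj p p' : coords p = coords p' -> p = p'.
Proof.
case: p p' => -[a b] c [[a' b'] c']; rewrite /coords /=.
move=> e; have [e' ->] := @eq_row_mx _ _ (4 + 4) 4 _ _ _ _ e.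
by have [-> ->] := eq_row_mx e'.
Qed.

Lemma polynomial_in_on_inj (S : {set 'I_12}) (Y : set (conf R)) p p' :
  polynomial_in_on S Y -> Y p -> Y p' ->
  (forall i, i \in S -> coords p 0 i = coords p' 0 i) -> p = p'.
Proof.
move=> polS Yp Yp' eqS; apply: coords_inj; apply/rowP => i.
have [f fE] := polS i; rewrite (fE p) // (fE p') //; apply: meval_eq => j.
by case: ifP => // /eqS.
Qed.

Definition block_sign (s1 s3 : bool) (i : nat) : bool :=
  if (i < 4)%N then s1 else if (i < 8)%N then s1 (+) s3 else s3.

Lemma coords_signed p s1 s3 i :
  coords (signed p s1 (s1 (+) s3) s3) 0 i = (-1) ^+ block_sign s1 s3 i * coords p 0 i.
Proof.
rewrite !coordsE; case: i; do 12?[case=> [?|]]; by rewrite //= mxE.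
Qed.

End Coords.


Section ClosedConfB.

Variables (R : realType) (m0 m1 m2 : R).
Hypotheses (m0_neq0 : m0 != 0) (m1_neq0 : m1 != 0) (m2_neq0 : m2 != 0).
Hypotheses (m2_neq1 : m2 != 1) (m2_neqN1 : m2 != -1) (q5_neq0 : q5 m0 m1 != 0).

Lemma closed_conf_b x0 x2 y0 y2 (P := closed_conf m0 m1 m2 x0 x2 y0 y2) :
  [/\ P.1.2 0 0 = t0 m0 m1 m2 * P.1.1 0 0 * P.2 0 0,
      P.1.2 0 1 = t1 m0 m1 m2 * P.1.1 0 0 * P.2 0 0,
      P.1.2 0 2 = t2 m0 m1 m2 * P.1.1 0 0 * P.2 0 2 + t3 m0 m1 m2 * P.1.1 0 2 * P.2 0 0
    & P.1.2 0 3 = t4 m0 m1 m2 * P.1.1 0 0 * P.2 0 2 + t5 m0 m1 m2 * P.1.1 0 2 * P.2 0 0].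
Proof.
have /eight_formulasE : bennett_map m0 m1 m2 (essential_coords P) = P.
  by rewrite /P /closed_conf essential_coordsE bennett_mapE.
by move=> [_ _ [? ?] [? ?]].
Qed.

End ClosedConfB.

Section EssentialVariables.

Variables (R : realType) (m0 m1 m2 : R) (Jab Jbc : {pred {mpoly R[4 + 4]}}).
Hypotheses (m0_neq0 : m0 != 0) (m1_neq0 : m1 != 0) (m2_neq0 : m2 != 0).
Hypotheses (m2_neq1 : m2 != 1) (m2_neqN1 : m2 != -1) (q5_neq0 : q5 m0 m1 != 0).
Hypothesis Jab_comp : prime_component (I_ab m0 m1 m2)
    (row_mx (a_init m0 m1) (b_init m0 m1 m2)) Jab.
Hypothesis Jbc_comp : prime_component (I_bc m0 m1 m2)
    (row_mx (b_init m0 m1 m2) (c_init m1 m2)) Jbc.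

Let Y := solutions_by_formulas m0 m1 m2 Jab Jbc.
Let conf_of := closed_conf m0 m1 m2.

Let YP p : Y p <-> exists x0 x2 y0 y2, closed_loop m2 x0 x2 y0 y2 /\ p = conf_of x0 x2 y0 y2.
Proof. exact: solutions_by_formulasP. Qed.

Lemma polynomial_in_on_essential : polynomial_in_on essential Y.
Proof.
pose X k (k12 : (k < 12)%N) := mpolyX R (mnm1 (Ordinal k12)).
pose C := @mpolyC 12 R.
pose a0 := @X 0%N isT; pose a2 := @X 2%N isT.
pose c0 := @X 8%N isT; pose c2 := @X 10%N isT.
pose f := [:: a0; C m1 * a0; a2; C ((m0 ^+ 2 + 2 * m0 * m1 - 1) / q5 m0 m1) * a2;
  C (t0 m0 m1 m2) * a0 * c0; C (t1 m0 m1 m2) * a0 * c0;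
  C (t2 m0 m1 m2) * a0 * c2 + C (t3 m0 m1 m2) * a2 * c0;
  C (t4 m0 m1 m2) * a0 * c2 + C (t5 m0 m1 m2) * a2 * c0;
  c0; C (m2 / m1) * c0; c2; C (m1 / m2) * c2].
move=> i; exists f`_i => -[[a b] c] [_ [[a1 a3] [c1 c3] [b0 b1] [b2 b3]]].
set w := fun j => _.
have w0 : meval w a0 = a 0 0 by rewrite mevalXU /w inE coordsE.
have w2 : meval w a2 = a 0 2 by rewrite mevalXU /w inE coordsE.
have w8 : meval w c0 = c 0 0 by rewrite mevalXU /w inE coordsE.
have w10 : meval w c2 = c 0 2 by rewrite mevalXU /w inE coordsE.
rewrite coordsE {}/f; move: w w0 w2 w8 w10 => w w0 w2 w8 w10.
by case: i; do 12?[case=> [?|]] => //=;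
  rewrite !(mevalD, mevalM, mevalC, w0, w2, w8, w10).
Qed.

(** The sign change moves [P] to a different point of Y. The coordinates in [S] determine points of
    Y, so one of them must be nonzero and reversed. *)
Let hit x0 x2 y0 y2 (S : {set 'I_12}) (s1 s3 : bool) (P := conf_of x0 x2 y0 y2) :
  closed_loop m2 x0 x2 y0 y2 -> polynomial_in_on S Y -> s1 || s3 ->
  exists2 i, i \in S & block_sign s1 s3 i /\ coords P 0 i != 0.
Proof.
move=> cl polS s13; have YPt s1' s3' : Y (signed P s1' (s1' (+) s3') s3').
  apply/YP; rewrite signed_closed_conf; do 4![eexists]; split; last reflexivity.
  exact: closed_loop_sign.
apply: contrapT => noi.
have P1 : unit_conf P by exact: closed_unit.
have : signed P s1 (s1 (+) s3) s3 = signed P false (false (+) false) false.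
  apply: (polynomial_in_on_inj polS (YPt s1 s3) (YPt false false)) => i iS.
  rewrite !coords_signed; have [->|Pi] := eqVneq (coords P 0 i) 0; first by rewrite !mulr0.
  have -> : block_sign s1 s3 i = false; last by rewrite /block_sign; do 2?case: ifP.
  by apply/negP => bi; apply: noi; exists i.
by move=> /(signed_inj P1)[s1E _ s3E]; move: s13; rewrite s1E s3E.
Qed.

Let essential_one_zero : closed_loop m2 1 0 0 1.
Proof. by split; rewrite ?expr0n ?expr1n ?add0r ?addr0 // mul0r !mulr0 addr0. Qed.

Let essential_zero_one : closed_loop m2 0 1 1 0.
Proof. by split; rewrite ?expr0n ?expr1n ?add0r ?addr0 // mul0r !mulr0 addr0. Qed.

Let conf_b := closed_conf_b m0_neq0 m1_neq0 m2_neq0 m2_neq1 q5_neq0.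

(** The list contains the positions of [a_0, a_1, b_2, b_3, c_2, c_3]: the other coordinates vanish
    when [a_2 = c_0 = 0]. Likewise [hit2] belongs to the point with [a_0 = c_2 = 0]. *)
Let hit1 (S : {set 'I_12}) s1 s3 : polynomial_in_on S Y -> s1 || s3 ->
  exists2 i : 'I_12, i \in S & block_sign s1 s3 i && ((i : nat) \in [:: 0; 1; 6; 7; 10; 11]%N).
Proof.
move=> polS s13; have [i iS [bi]] := hit essential_one_zero polS s13.
rewrite coordsE; have [-> -> _ _] := conf_b 1 0 0 1; rewrite /= !quatE => ci.
exists i => //; rewrite bi; move: ci; case: i {iS bi}; do 12?[case=> [?|]] => //=;
by rewrite ?(mulr0, mul0r) eqxx.
Qed.

Let hit2 (S : {set 'I_12}) s1 s3 : polynomial_in_on S Y -> s1 || s3 ->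
  exists2 i : 'I_12, i \in S & block_sign s1 s3 i && ((i : nat) \in [:: 2; 3; 6; 7; 8; 9]%N).
Proof.
move=> polS s13; have [i iS [bi]] := hit essential_zero_one polS s13.
rewrite coordsE; have [-> -> _ _] := conf_b 0 1 1 0; rewrite /= !quatE => ci.
exists i => //; rewrite bi; move: ci; case: i {iS bi}; do 12?[case=> [?|]] => //=;
by rewrite ?(mulr0, mul0r) eqxx.
Qed.

(** At each of the two points, each of the two single sign changes leaves exactly one essential
    coordinate as witness, so all four lie in [S]. *)
Lemma essential_minimal (S : {set 'I_12}) :
  S \proper essential -> ~ polynomial_in_on S Y.
Proof.
move=> /properP[/fintype.subsetP SE [j jE jS]] polS.
have [i1 i1S /andP[b1 h1]] := hit1 polS (isT : true || false).
have [i2 i2S /andP[b2 h2]] := hit1 polS (isT : false || true).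
have [i3 i3S /andP[b3 h3]] := hit2 polS (isT : true || false).
have [i4 i4S /andP[b4 h4]] := hit2 polS (isT : false || true).
have := (SE _ i1S, SE _ i2S, SE _ i3S, SE _ i4S); rewrite !inE => -[[[e1 e2] e3] e4].
have i1E : i1 = 0%N :> nat by move: b1 h1 e1; case: i1 {i1S}; do 12?[case=> [?|]].
have i2E : i2 = 10%N :> nat by move: b2 h2 e2; case: i2 {i2S}; do 12?[case=> [?|]].
have i3E : i3 = 2%N :> nat by move: b3 h3 e3; case: i3 {i3S}; do 12?[case=> [?|]].
have i4E : i4 = 8%N :> nat by move: b4 h4 e4; case: i4 {i4S}; do 12?[case=> [?|]].
move: jE; rewrite !inE => /or4P[] /eqP jE; move/negP: jS; apply.
- by rewrite (_ : j = i1) //; apply: val_inj; rewrite /= jE i1E.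
- by rewrite (_ : j = i3) //; apply: val_inj; rewrite /= jE i3E.
- by rewrite (_ : j = i4) //; apply: val_inj; rewrite /= jE i4E.
- by rewrite (_ : j = i2) //; apply: val_inj; rewrite /= jE i2E.
Qed.

(** Reversing [a] and [c] together leaves [b] fixed, which yields [e1] and [e2]. If [S] contained
    neither [b_2] nor [b_3], the single sign changes at the two points would require four different
    members. *)
Lemma three_coordinates (S : {set 'I_12}) : polynomial_in_on S Y -> (#|S| <= 3)%N ->
  exists e1 e2 e3 : 'I_12,
    [/\ e1 \in S /\ (e1 : nat) \in [:: 0; 1; 10; 11]%N,
        e2 \in S /\ (e2 : nat) \in [:: 2; 3; 8; 9]%N,
        e3 \in S /\ (e3 : nat) \in [:: 6; 7]%N
      & {subset S <= [:: e1; e2; e3]}].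
Proof.
move=> polS S3.
have small (l : seq 'I_12) : uniq l -> {subset l <= S} -> (size l <= 3)%N.
  move=> ul lS; apply: leq_trans S3; rewrite cardE; apply: uniq_leq_size => // x /lS.
  by rewrite mem_enum.
have [i1 i1S /andP[b1 h1]] := hit1 polS (isT : true || true).
have [i2 i2S /andP[b2 h2]] := hit2 polS (isT : true || true).
have i1E : (i1 : nat) \in [:: 0; 1; 10; 11]%N.
  by move: b1 h1; case: i1 {i1S}; do 12?[case=> [?|]].
have i2E : (i2 : nat) \in [:: 2; 3; 8; 9]%N.
  by move: b2 h2; case: i2 {i2S}; do 12?[case=> [?|]].
have [i3 i3S i3E] : exists2 i3 : 'I_12, i3 \in S & (i3 : nat) \in [:: 6; 7]%N.
  apply: contrapT => no3.
  have [j1 j1S /andP[c1 k1]] := hit1 polS (isT : true || false).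
  have [j2 j2S /andP[c2 k2]] := hit1 polS (isT : false || true).
  have [j3 j3S /andP[c3 k3]] := hit2 polS (isT : true || false).
  have [j4 j4S /andP[c4 k4]] := hit2 polS (isT : false || true).
  have n67 j : j \in S -> (j : nat) \notin [:: 6; 7]%N.
    by move=> jS; apply/negP => j67; apply: no3; exists j.
  suff : (size [:: j1; j2; j3; j4] <= 3)%N by [].
  apply: small.
    have J1 : (j1 : nat) \in [:: 0; 1]%N.
      by move: c1 k1 (n67 _ j1S); case: j1 {j1S}; do 12?[case=> [?|]].
    have J2 : (j2 : nat) \in [:: 10; 11]%N.
      by move: c2 k2 (n67 _ j2S); case: j2 {j2S}; do 12?[case=> [?|]].
    have J3 : (j3 : nat) \in [:: 2; 3]%N.
      by move: c3 k3 (n67 _ j3S); case: j3 {j3S}; do 12?[case=> [?|]].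
    have J4 : (j4 : nat) \in [:: 8; 9]%N.
      by move: c4 k4 (n67 _ j4S); case: j4 {j4S}; do 12?[case=> [?|]].
    have -> : uniq [:: j1; j2; j3; j4] = uniq [seq val j | j <- [:: j1; j2; j3; j4]].
      by rewrite (map_inj_uniq val_inj).
    rewrite /=; move: J1 J2 J3 J4; rewrite !inE.
    by do 4!case/orP => /eqP ->.
  by move=> j; rewrite !inE => /or4P[] /eqP ->.
exists i1, i2, i3; split=> // j jS.
apply: contraT => jN; suff : (size [:: j; i1; i2; i3] <= 3)%N by [].
apply: small; last by move=> k; rewrite !inE => /or4P[] /eqP ->.
have u3 : uniq [:: i1; i2; i3].
  have -> : uniq [:: i1; i2; i3] = uniq [seq val j | j <- [:: i1; i2; i3]].
    by rewrite (map_inj_uniq val_inj).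
  rewrite /=; move: i1E i2E i3E; rewrite !inE.
  by do 2![case/or4P => /eqP ->]; case/orP => /eqP ->.
by rewrite cons_uniq jN u3.
Qed.

End EssentialVariables.

Local Notation "p @_ m" := (@mcoeff _ _ m p) (at level 2).

(** * The lower bound on the number of variables for generic parameters *)

Lemma poly_eq0_unit_interval (R : realType) (p : {poly R}) :
  (forall s, 0 < s < 1 -> p.[s] = 0) -> p = 0.
Proof.
move=> p0; pose rs := [seq (i.+2%:R)^-1 : R | i <- iota 0 (size p)].
apply: (@roots_geq_poly_eq0 _ p rs); last by rewrite size_map size_iota.
  apply/allP => _ /mapP[i _ ->]; apply/eqP/p0.
  by rewrite invr_gt0 ltr0n /= invf_lt1 ?ltr0n // ltr1n.
rewrite map_inj_uniq ?iota_uniq // => i j /invr_inj /eqP.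
by rewrite eqr_nat => /eqP[].
Qed.

Section RationalOnInterval.

Variables (R : realType) (M : {poly R}).
Implicit Types F : R -> R.

(** When [M] has no zero in the open interval, [F] agrees there with an element of the localization
    [R[s, 1/M]]. This continues a function known only on the interval to other values of [s]. *)
Definition rational_on F : Prop :=
  exists N (G : {poly R}), forall s, 0 < s < 1 -> F s * M.[s] ^+ N = G.[s].

Lemma rational_on_const k : rational_on (fun=> k).
Proof. by exists 0%N, k%:P => s _; rewrite expr0 mulr1 hornerC. Qed.

Lemma rational_on_ext F F' :
  (forall s, 0 < s < 1 -> F s = F' s) -> rational_on F -> rational_on F'.
Proof. by move=> FF' [N [G H]]; exists N, G => s s01; rewrite -FF' // H. Qed.

Lemma rational_on_poly (P : {poly R}) : rational_on (fun s => P.[s]).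
Proof. by exists 0%N, P => s _; rewrite expr0 mulr1. Qed.

Lemma rational_on_add F F' :
  rational_on F -> rational_on F' -> rational_on (fun s => F s + F' s).
Proof.
move=> [N [G FG]] [N' [G' FG']]; exists (N + N')%N, (G * M ^+ N' + G' * M ^+ N) => s s01.
by rewrite hornerD !hornerM !horner_exp -FG // -FG' // exprD; ring.
Qed.

Lemma rational_on_mul F F' :
  rational_on F -> rational_on F' -> rational_on (fun s => F s * F' s).
Proof.
move=> [N [G FG]] [N' [G' FG']]; exists (N + N')%N, (G * G') => s s01.
by rewrite hornerM -FG // -FG' // exprD; ring.
Qed.

Lemma rational_on_exp F n : rational_on F -> rational_on (fun s => F s ^+ n).
Proof.
move=> [N [G FG]]; exists (N * n)%N, (G ^+ n) => s s01.
by rewrite exprM -exprMn FG // horner_exp.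
Qed.

Lemma rational_on_sum (I : Type) (l : seq I) (F : I -> R -> R) :
  (forall i, rational_on (F i)) -> rational_on (fun s => \sum_(i <- l) F i s).
Proof.
move=> ratF; elim: l => [|i l IH].
  by have [N [G H]] := rational_on_const 0; exists N, G => s s01; rewrite big_nil H.
have [N [G H]] := rational_on_add (ratF i) IH.
by exists N, G => s s01; rewrite big_cons H.
Qed.

Lemma rational_on_prod (I : Type) (l : seq I) (F : I -> R -> R) :
  (forall i, rational_on (F i)) -> rational_on (fun s => \prod_(i <- l) F i s).
Proof.
move=> ratF; elim: l => [|i l IH].
  by have [N [G H]] := rational_on_const 1; exists N, G => s s01; rewrite big_nil H.
have [N [G H]] := rational_on_mul (ratF i) IH.
by exists N, G => s s01; rewrite big_cons H.
Qed.

(* A quotient of a polynomial by a power of [M] cannot be divisible by [L] when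
   [L] has a root that is not a root of [M]. *)
Lemma not_rational_multiple (L : {poly R}) (k : R) n F : rational_on F -> k != 0 ->
  (exists2 s0, L.[s0] = 0 & M.[s0] != 0) ->
  ~ (forall s, 0 < s < 1 -> k * M.[s] ^+ n = L.[s] * F s).
Proof.
move=> [N [G FG]] k0 [s0 Ls0 Ms0] kL.
have E : k *: M ^+ (n + N) - L * G = 0.
  apply: poly_eq0_unit_interval => s s01.
  rewrite hornerD hornerN hornerZ horner_exp hornerM -FG // exprD.
  by rewrite mulrA kL // mulrA subrr.
have /eqP := congr1 (fun p => p.[s0]) E.
rewrite hornerD hornerN hornerZ horner_exp hornerM Ls0 mul0r subr0 horner0.
by rewrite mulf_eq0 (negbTE k0) expf_eq0 (negbTE Ms0) andbF.
Qed.

End RationalOnInterval.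

Section SignAverage.

Variable R : realType.

Let big_bool3 (F : bool -> bool -> bool -> R) :
  \sum_(b : bool * bool * bool) F b.1.1 b.1.2 b.2 =
  F true true true + F true true false + F true false true + F true false false
  + F false true true + F false true false + F false false true + F false false false.
Proof.
rewrite -(pair_bigA _ (fun p b4 => F p.1 p.2 b4)) /=.
rewrite -(pair_bigA _ (fun b1 b2 => \sum_b4 F b1 b2 b4)) /= !big_bool /=.
ring.
Qed.

Lemma sign_exp (b : bool) n : ((-1) ^+ b) ^+ n = (-1) ^+ (b && odd n) :> R.
Proof. by case: b; rewrite /= ?expr1 ?expr0 ?expr1n // -signr_odd. Qed.

(* Orthogonality of the characters of (Z/2)^3. *)
Lemma sign_average (c1 c2 : bool) n1 n2 n3 :
  \sum_(b : bool * bool * bool)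
    (-1) ^+ (if c1 then b.2 else b.1.1) *
    (((-1) ^+ (if c1 then b.1.1 else b.2)) ^+ n1 *
     (((-1) ^+ (if c2 then b.1.2 else b.1.1 (+) b.1.2 (+) b.2)) ^+ n2 *
      ((-1) ^+ (b.1.1 (+) b.2)) ^+ n3)) =
  8 * [&& odd n1, ~~ odd n2 & odd n3]%:R :> R.
Proof.
rewrite (big_bool3 (fun b1 b2 b4 => (-1) ^+ (if c1 then b4 else b1) *
    (((-1) ^+ (if c1 then b1 else b4)) ^+ n1 *
     (((-1) ^+ (if c2 then b2 else b1 (+) b2 (+) b4)) ^+ n2 *
      ((-1) ^+ (b1 (+) b4)) ^+ n3)))) !sign_exp.
by case: c1; case: c2; case: (odd n1); case: (odd n2); case: (odd n3);
   rewrite /= ?expr0 ?expr1; ring.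
Qed.

End SignAverage.

Section GenericParameter.

(* Here N and N' are the numerators of t_2 and t_3 (or of t_4 and t_5). The two
   factors say that b_2 (or b_3) is, up to its denominator, a nonconstant linear
   function of sin^2 t, and that the zero of this function is not a zero of
   m2^2 sin^2 t + cos^2 t, the radicand in the denominator. *)
Definition generic_factor (A : pzRingType) (m0 m2 N N' : A) : A :=
  let q := m0 ^+ 2 * (m2 - 1) ^+ 2 + (m2 + 1) ^+ 2 in
  (N + m2 * q * N') * (m2 * N + q * N').

Definition generic_parameter (A : pzRingType) (m0 m1 m2 : A) : A :=
  let q4 := m0 ^+ 2 * (m2 - 1) + m2 + 1 in
  let x := m1 ^+ 2 + m2 in let y := m1 * (m2 - 1) in
  generic_factor m0 m2 (y * (q4 ^+ 2 - 4 * m0 ^+ 2) + 4 * m0 * q4 * x)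
    (y * (m0 ^+ 2 - 1) - 2 * m0 * x) *
  generic_factor m0 m2 (x * (q4 ^+ 2 - 4 * m0 ^+ 2) - 4 * m0 * y * q4)
    (x * (m0 ^+ 2 - 1) + 2 * m0 * y).

Lemma map_generic_factor (A B : comNzRingType) (phi : {rmorphism A -> B}) m0 m2 N N' :
  phi (generic_factor m0 m2 N N') = generic_factor (phi m0) (phi m2) (phi N) (phi N').
Proof.
by rewrite /generic_factor !(rmorphM, rmorphD, rmorphN, rmorphXn, rmorph1).
Qed.

Lemma map_generic_parameter (A B : comNzRingType) (phi : {rmorphism A -> B}) m0 m1 m2 :
  phi (generic_parameter m0 m1 m2) = generic_parameter (phi m0) (phi m1) (phi m2).
Proof.
rewrite /generic_parameter rmorphM !map_generic_factor.
by congr (generic_factor _ _ _ _ * generic_factor _ _ _ _);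
  rewrite !(rmorphM, rmorphD, rmorphN, rmorphXn, rmorph_nat, rmorph1).
Qed.

Variable R : realType.

Definition generic_poly : {mpoly R[3]} :=
  generic_parameter (mpolyX R (mnm1 0)) (mpolyX R (mnm1 1)) (mpolyX R (mnm1 2)).

Lemma generic_polyE m0 m1 m2 :
  meval (rvec 3 [:: m0; m1; m2] 0) generic_poly = generic_parameter m0 m1 m2.
Proof.
by rewrite /generic_poly (map_generic_parameter (meval _)) /= !mevalXU /rvec !mxE.
Qed.

Lemma generic_poly_neq0 : generic_poly != 0.
Proof.
(* Any point with a nonzero value serves; [m2 = 0] is not admissible for the mechanism, but it keeps
   the numbers small. *)
apply/eqP => D0; have := generic_polyE 1 1 0; rewrite D0 meval0 => /eqP.
have -> : generic_parameter 1 1 0 = - 256%:R :> R.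
  by rewrite /generic_parameter /generic_factor; ring.
by rewrite eq_sym oppr_eq0 pnatr_eq0.
Qed.

End GenericParameter.

Section Generic.

Variables (R : realType) (m0 m1 m2 : R) (Jab Jbc : {pred {mpoly R[4 + 4]}}).
Hypotheses (m0_neq0 : m0 != 0) (m1_neq0 : m1 != 0) (m2_neq0 : m2 != 0).
Hypotheses (m2_neq1 : m2 != 1) (m2_neqN1 : m2 != -1) (q5_neq0 : q5 m0 m1 != 0).
Hypothesis Jab_comp : prime_component (I_ab m0 m1 m2)
    (row_mx (a_init m0 m1) (b_init m0 m1 m2)) Jab.
Hypothesis Jbc_comp : prime_component (I_bc m0 m1 m2)
    (row_mx (b_init m0 m1 m2) (c_init m1 m2)) Jbc.

Let Y := solutions_by_formulas m0 m1 m2 Jab Jbc.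
Let conf_of := closed_conf m0 m1 m2.

Let n1 := Num.sqrt (m1 ^+ 2 + 1).
Let n2 := Num.sqrt (m1 ^+ 2 + m2 ^+ 2).
Let n1_neq0 : n1 != 0. Proof. by rewrite lt0r_neq0 // sqrtr_gt0 m1D1_gt0. Qed.
Let n2_neq0 : n2 != 0. Proof. by rewrite lt0r_neq0 // sqrtr_gt0 m1Dm2_gt0. Qed.
Let D0 : m0 ^+ 2 + 1 != 0 := m0D1_neq0 m0.

(** For [s = sin t ^+ 2] this is [m2 ^+ 2 * sin t ^+ 2 + cos t ^+ 2], the factor of [q6] that
    depends on [t]. *)
Let M : {poly R} := 1 + (m2 ^+ 2 - 1) *: 'X.

Let ME s : M.[s] = (1 - s) + m2 ^+ 2 * s.
Proof. by rewrite hornerD hornerZ hornerX hornerC; ring. Qed.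

Let C (s : R) := Num.sqrt (1 - s).
Let S (s : R) := Num.sqrt s.
Let mu (s : R) := (Num.sqrt M.[s])^-1.

Let M_gt0 s : 0 < s < 1 -> 0 < M.[s].
Proof.
case/andP=> s0 s1; rewrite ME addr_gt0 ?subr_gt0 // mulr_gt0 //.
by rewrite lt0r sqrf_eq0 m2_neq0 sqr_ge0.
Qed.

Let C2 s : 0 < s < 1 -> C s ^+ 2 = 1 - s.
Proof. by case/andP=> s0 s1; rewrite sqr_sqrtr // subr_ge0 ltW. Qed.

Let S2 s : 0 < s < 1 -> S s ^+ 2 = s.
Proof. by case/andP=> s0 s1; rewrite sqr_sqrtr // ltW. Qed.

Let mu2 s : 0 < s < 1 -> mu s ^+ 2 * M.[s] = 1.
Proof.
by move=> s01; rewrite exprVn sqr_sqrtr ?ltW ?M_gt0 // mulVf // lt0r_neq0 // M_gt0.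
Qed.

Let C_neq0 s : 0 < s < 1 -> C s != 0.
Proof. by case/andP=> s0 s1; rewrite lt0r_neq0 // sqrtr_gt0 subr_gt0. Qed.

Let mu_neq0 s : 0 < s < 1 -> mu s != 0.
Proof. by move=> s01; rewrite invr_neq0 // lt0r_neq0 // sqrtr_gt0 M_gt0. Qed.

(* The parametrization of V with s = sin^2 t, and all its sign changes. *)
Definition interval_point (s : R) (b1 b2 b4 : bool) : conf R :=
  conf_of ((-1) ^+ b1 * C s) ((-1) ^+ b2 * - S s)
    ((-1) ^+ (b1 (+) b2 (+) b4) * (m2 * S s * mu s)) ((-1) ^+ b4 * (C s * mu s)).

Let interval_point_sol s b1 b2 b4 : 0 < s < 1 -> Y (interval_point s b1 b2 b4).
Proof.
move=> s01; apply/solutions_by_formulasP => //; do 4![eexists]; split; last reflexivity.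
split.
- by rewrite !exprMn !sqrr_sign !mul1r sqrrN C2 // S2 // subrK.
- rewrite !exprMn !sqrr_sign !mul1r S2 // C2 // -mulrDl mulrC addrC -ME.
  exact: mu2.
- by rewrite !signr_addb; case: b1 b2 b4 => [] [] []; rewrite ?expr1 ?expr0; ring.
Qed.

(** The signs [b1], [b2], [b4] of [x0], [x2], [y2] are free, and the relation between [x] and [y]
    then fixes the sign of [y0]. The entries are the resulting characters of the twelve
    coordinates. *)
Definition coord_sign (b1 b2 b4 : bool) (i : nat) : bool :=
  [:: b1; b1; b2; b2; b2 (+) b4; b2 (+) b4; b1 (+) b4; b1 (+) b4;
      b1 (+) b2 (+) b4; b1 (+) b2 (+) b4; b4; b4]`_i.

Let base s i := coords (interval_point s false false false) 0 i.

Let conf_b x0 x2 y0 y2 (P := conf_of x0 x2 y0 y2) :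
  [/\ P.1.2 0 0 = t0 m0 m1 m2 * P.1.1 0 0 * P.2 0 0,
      P.1.2 0 1 = t1 m0 m1 m2 * P.1.1 0 0 * P.2 0 0,
      P.1.2 0 2 = t2 m0 m1 m2 * P.1.1 0 0 * P.2 0 2 + t3 m0 m1 m2 * P.1.1 0 2 * P.2 0 0
    & P.1.2 0 3 = t4 m0 m1 m2 * P.1.1 0 0 * P.2 0 2 + t5 m0 m1 m2 * P.1.1 0 2 * P.2 0 0].
Proof. exact: closed_conf_b. Qed.

Let coords_interval_point s b1 b2 b4 i :
  coords (interval_point s b1 b2 b4) 0 i = (-1) ^+ coord_sign b1 b2 b4 i * base s i.
Proof.
rewrite /base !coordsE /interval_point.
have [-> -> -> ->] := conf_b ((-1) ^+ b1 * C s) ((-1) ^+ b2 * - S s)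
    ((-1) ^+ (b1 (+) b2 (+) b4) * (m2 * S s * mu s)) ((-1) ^+ b4 * (C s * mu s)).
have [-> -> -> ->] := conf_b ((-1) ^+ false * C s) ((-1) ^+ false * - S s)
    ((-1) ^+ (false (+) false (+) false) * (m2 * S s * mu s)) ((-1) ^+ false * (C s * mu s)).
rewrite /= !quatE.
case: b1; case: b2; case: b4; case: i; do 12?[case=> [?|]] => //=;
  rewrite ?expr1 ?expr0; ring.
Qed.

(** [b_2] and [b_3] are [mu s] times this polynomial at [s], for [(t2, t3)] and [(t4, t5)]. *)
Let lin (t t' : R) : {poly R} :=
  (t * m2 / (n1 * n2)) *: (1 - 'X)
  - (t' * q5 m0 m1 * m1 * m2 / ((m0 ^+ 2 + 1) * n1 * n2)) *: 'X.

Let linE t t' s : (lin t t').[s] = t * m2 / (n1 * n2) * (1 - s)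
  - t' * q5 m0 m1 * m1 * m2 / ((m0 ^+ 2 + 1) * n1 * n2) * s.
Proof. by rewrite hornerD hornerN !hornerZ hornerD hornerN hornerX hornerC. Qed.

(** The root need not lie in the unit interval, where the points of Y are; only polynomial
    identities can be evaluated there. *)
Let lin_root t t' N N' : t = N / (m2 * (m0 ^+ 2 + 1) * q m0 m2) -> t' = N' / (m1 * q5 m0 m1) ->
  generic_factor m0 m2 N N' != 0 -> exists2 s0, (lin t t').[s0] = 0 & M.[s0] != 0.
Proof.
move=> tE t'E; rewrite /generic_factor -/(q m0 m2) mulf_eq0 negb_or => /andP[G1 G2].
have q0 : q m0 m2 != 0 by exact: q_neq0.
exists (N / (N + m2 * q m0 m2 * N')).
  by rewrite linE tE t'E; field; rewrite ?D0 ?n1_neq0 ?n2_neq0 ?q5_neq0 ?m1_neq0 ?m2_neq0 ?q0 ?G1.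
rewrite ME (_ : _ + _ = m2 * (m2 * N + q m0 m2 * N') / (N + m2 * q m0 m2 * N')).
  by rewrite !mulf_neq0 ?invr_neq0.
by field.
Qed.

Let baseE s (i : 'I_12) : base s i =
  [:: C s / n1; m1 * C s / n1; - (q5 m0 m1 * S s / ((m0 ^+ 2 + 1) * n1));
   - ((m0 ^+ 2 + 2 * m0 * m1 - 1) * S s / ((m0 ^+ 2 + 1) * n1));
   t0 m0 m1 m2 * (C s / n1) * (m1 * m2 / n2 * (S s * mu s));
   t1 m0 m1 m2 * (C s / n1) * (m1 * m2 / n2 * (S s * mu s));
   mu s * (t2 m0 m1 m2 * m2 / (n1 * n2) * C s ^+ 2
     - t3 m0 m1 m2 * q5 m0 m1 * m1 * m2 / ((m0 ^+ 2 + 1) * n1 * n2) * S s ^+ 2);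
   mu s * (t4 m0 m1 m2 * m2 / (n1 * n2) * C s ^+ 2
     - t5 m0 m1 m2 * q5 m0 m1 * m1 * m2 / ((m0 ^+ 2 + 1) * n1 * n2) * S s ^+ 2);
   m1 * m2 / n2 * (S s * mu s); m2 ^+ 2 / n2 * (S s * mu s);
   m2 / n2 * (C s * mu s); m1 / n2 * (C s * mu s)]`_i.
Proof.
rewrite /base coordsE /interval_point.
have [-> -> -> ->] := conf_b ((-1) ^+ false * C s) ((-1) ^+ false * - S s)
    ((-1) ^+ (false (+) false (+) false) * (m2 * S s * mu s)) ((-1) ^+ false * (C s * mu s)).
rewrite /= !quatE !expr0 !mul1r.
by case: i; do 12?[case=> [?|]] => //=; rewrite -/n1 -/n2; field;
  rewrite ?n1_neq0 ?n2_neq0 ?D0.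
Qed.

Let rational_mu2 : rational_on M (fun s => mu s ^+ 2).
Proof. by exists 1%N, 1%:P => s s01; rewrite expr1 mu2 // hornerC. Qed.

Let rational_C2 : rational_on M (fun s => C s ^+ 2).
Proof.
apply: (rational_on_ext _ (rational_on_poly M (1 - 'X))) => s s01.
by rewrite hornerD hornerN hornerX hornerC C2.
Qed.

Let rational_S2 : rational_on M (fun s => S s ^+ 2).
Proof.
apply: (rational_on_ext _ (rational_on_poly M 'X)) => s s01.
by rewrite hornerX S2.
Qed.

Let rational_sqr (i : 'I_12) : (i : nat) \notin [:: 4; 5]%N ->
  rational_on M (fun s => base s i ^+ 2).
Proof.
have ratM := rational_on_mul; have ratC := rational_on_const M.
move=> i45; have E s := congr1 (fun x => x ^+ 2) (baseE s i).
apply: (rational_on_ext (fun s _ => esym (E s))) => {E}.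
have rC k : rational_on M (fun s => (k * C s) ^+ 2).
  by apply: (rational_on_ext _ (ratM _ _ _ _ (ratC (k ^+ 2)) rational_C2)) => s _; rewrite exprMn.
have rS k : rational_on M (fun s => (k * S s) ^+ 2).
  by apply: (rational_on_ext _ (ratM _ _ _ _ (ratC (k ^+ 2)) rational_S2)) => s _; rewrite exprMn.
have rmu (F : R -> R) : rational_on M (fun s => F s ^+ 2) ->
    rational_on M (fun s => (F s * mu s) ^+ 2).
  by move=> rF; apply: (rational_on_ext _ (ratM _ _ _ _ rF rational_mu2)) => s _; rewrite exprMn.
have rL a b : rational_on M (fun s => (mu s * (a * C s ^+ 2 - b * S s ^+ 2)) ^+ 2).
  have r1 := ratM _ _ _ _ (ratC a) rational_C2.
  have r2 := ratM _ _ _ _ (ratC (- b)) rational_S2.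
  have r3 := rational_on_exp 2 (rational_on_add r1 r2).
  apply: (rational_on_ext _ (ratM _ _ _ _ rational_mu2 r3)) => s _.
  by rewrite exprMn mulNr.
move: i45; case: i; do 12?[case=> [?|]] => //= _.
- by apply: rational_on_ext (rC n1^-1) => s _; rewrite mulrC.
- by apply: rational_on_ext (rC (m1 / n1)) => s _; rewrite mulrAC.
- apply: rational_on_ext (rS (- (q5 m0 m1 / ((m0 ^+ 2 + 1) * n1)))) => s _.
  by rewrite mulNr mulrAC.
- apply: rational_on_ext (rS (- ((m0 ^+ 2 + 2 * m0 * m1 - 1) / ((m0 ^+ 2 + 1) * n1)))) => s _.
  by rewrite mulNr mulrAC.
- by apply: rational_on_ext (rmu _ (rS (m1 * m2 / n2))) => s _; rewrite mulrA.
- by apply: rational_on_ext (rmu _ (rS (m2 ^+ 2 / n2))) => s _; rewrite mulrA.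
- by apply: rational_on_ext (rmu _ (rC (m2 / n2))) => s _; rewrite mulrA.
- by apply: rational_on_ext (rmu _ (rC (m1 / n2))) => s _; rewrite mulrA.
Qed.

Lemma generic_lower_bound (I : {set 'I_12}) :
  generic_parameter m0 m1 m2 != 0 -> polynomial_in_on I Y -> (4 <= #|I|)%N.
Proof.
rewrite /generic_parameter mulf_eq0 negb_or => /andP[gen2 gen3] polI.
rewrite leqNgt; apply/negP; rewrite ltnS => I3.
have [e1 [e2 [e3 [[e1I e1E] [e2I e2E] [e3I e3E] sub_e]]]] :=
  three_coordinates m0_neq0 m1_neq0 m2_neq0 m2_neq1 m2_neqN1 q5_neq0 Jab_comp Jbc_comp polI I3.
have e12 : e1 != e2.
  by apply: contraTneq e1E => ->; move: e2E; rewrite !inE => /or4P[] /eqP ->.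
have e13 : e1 != e3.
  by apply: contraTneq e1E => ->; move: e3E; rewrite !inE => /orP[] /eqP ->.
have e23 : e2 != e3.
  by apply: contraTneq e2E => ->; move: e3E; rewrite !inE => /orP[] /eqP ->.
pose c1 := (e1 < 4)%N; pose c2 := (e2 < 4)%N.
(* The missing variable: [c_2] if [e1] belongs to [a], and [a_0] if it belongs to [c]. *)
pose t : 'I_12 := if c1 then @Ordinal 12 10 isT else @Ordinal 12 0 isT.
have sign_e1 b1 b2 b4 : coord_sign b1 b2 b4 e1 = if c1 then b1 else b4.
  by rewrite /c1; move: e1E; rewrite !inE => /or4P[] /eqP ->.
have sign_t b1 b2 b4 : coord_sign b1 b2 b4 t = if c1 then b4 else b1.
  by rewrite /t; case: (c1).
have sign_e2 b1 b2 b4 : coord_sign b1 b2 b4 e2 = if c2 then b2 else b1 (+) b2 (+) b4.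
  by rewrite /c2; move: e2E; rewrite !inE => /or4P[] /eqP ->.
have sign_e3 b1 b2 b4 : coord_sign b1 b2 b4 e3 = b1 (+) b4.
  by move: e3E; rewrite !inE => /orP[] /eqP ->.
have [f fE] := polI t.
(* Outside [I] the argument of [f] is 0, so its sign is free there; the choice 1 reduces the product
   in [prod_sg] to [e1], [e2] and [e3]. *)
pose w s i := if i \in I then base s i else 0.
pose sg (b : bool * bool * bool) (i : 'I_12) : R :=
  if i \in I then (-1) ^+ coord_sign b.1.1 b.1.2 b.2 i else 1.
(* The characters of [e1], [e2], [e3] are independent, and that of [t] is the product of the first
   and the third. These are therefore the monomials that transform like [t]. *)
pose par (m : multinom 12) := [&& odd (m e1), ~~ odd (m e2) & odd (m e3)].
have prod_sg b (m : multinom 12) : \prod_i sg b i ^+ m i =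
    ((-1) ^+ (if c1 then b.1.1 else b.2)) ^+ m e1 *
    (((-1) ^+ (if c2 then b.1.2 else b.1.1 (+) b.1.2 (+) b.2)) ^+ m e2 *
     ((-1) ^+ (b.1.1 (+) b.2)) ^+ m e3).
  rewrite (bigD1 e1) //= (bigD1 e2) 1?eq_sym //= (bigD1 e3) /=; last first.
    by rewrite eq_sym e13 eq_sym e23.
  rewrite big1 ?mulr1 => [|i /andP[/andP[i1 i2] i3]].
    by rewrite /sg e1I e2I e3I sign_e1 sign_e2 sign_e3.
  rewrite /sg; case: ifP => [/sub_e|_]; last by rewrite expr1n.
  by rewrite !inE (negbTE i1) (negbTE i2) (negbTE i3).
have eval_sign s (b : bool * bool * bool) : 0 < s < 1 -> (-1) ^+ (if c1 then b.2 else b.1.1) * base s t =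
    \sum_(m <- msupp f) f@_m * (\prod_i sg b i ^+ m i * \prod_i w s i ^+ m i).
  move=> s01; have := fE _ (interval_point_sol b.1.1 b.1.2 b.2 s01).
  rewrite coords_interval_point sign_t => ->; rewrite mevalE; apply: eq_bigr => m _.
  congr (_ * _); rewrite -big_split /=; apply: eq_bigr => i _.
  rewrite -exprMn /sg /w; case: ifP => iI; last by rewrite mulr0.
  by rewrite coords_interval_point.
have base_t s : 0 < s < 1 -> base s t =
    \sum_(m <- msupp f) (if par m then f@_m * \prod_i w s i ^+ m i else 0).
  move=> s01; have eight : 8 != 0 :> R by rewrite pnatr_eq0.
  apply: (mulfI eight); rewrite mulr_sumr.
  transitivity (\sum_(b : bool * bool * bool) (-1) ^+ (if c1 then b.2 else b.1.1) *
      ((-1) ^+ (if c1 then b.2 else b.1.1) * base s t)).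
    rewrite (eq_bigr (fun _ => base s t)) => [|b _]; last by rewrite mulrA -expr2 sqrr_sign mul1r.
    by rewrite sumr_const !card_prod card_bool mulr_natl.
  under eq_bigr => b _ do rewrite eval_sign // mulr_sumr.
  rewrite exchange_big /=; apply: eq_bigr => m _.
  transitivity ((\sum_(b : bool * bool * bool) (-1) ^+ (if c1 then b.2 else b.1.1) *
      \prod_i sg b i ^+ m i) * (f@_m * \prod_i w s i ^+ m i)).
    rewrite mulr_suml; apply: eq_bigr => b _.
    by rewrite -mulrA; congr (_ * _); rewrite mulrCA.
  have -> : \sum_(b : bool * bool * bool) (-1) ^+ (if c1 then b.2 else b.1.1) *
      \prod_i sg b i ^+ m i = 8 * (par m)%:R.
    by rewrite -(sign_average R c1 c2); apply: eq_bigr => b _; rewrite prod_sg.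
  case: (par m); first by rewrite mulr1.
  by rewrite !mulr0 mul0r.
(* On the parities selected by [par], each monomial is the product of the
   coordinates e1, e3 and a monomial in squares. *)
pose m' (m : multinom 12) i := (m i - (i == e1) - (i == e3))%N.
pose H s := \sum_(m <- msupp f)
  (if par m then f@_m * \prod_i w s i ^+ m' m i else 0).
have w1 s : \prod_i w s i ^+ (i == e1) = base s e1.
  rewrite (bigD1 e1) //= eqxx expr1 big1 => [|i /negbTE ->]; last by rewrite expr0.
  by rewrite mulr1 /w e1I.
have w3 s : \prod_i w s i ^+ (i == e3) = base s e3.
  rewrite (bigD1 e3) //= eqxx expr1 big1 => [|i /negbTE ->]; last by rewrite expr0.
  by rewrite mulr1 /w e3I.
have base_H s : 0 < s < 1 -> base s t = base s e1 * base s e3 * H s.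
  move=> s01; rewrite base_t // /H mulr_sumr; apply: eq_bigr => m _.
  case: ifP => [/and3P[ o1 _ o3]|_]; last by rewrite mulr0.
  rewrite -(w1 s) -(w3 s) mulrCA -!big_split /=; congr (_ * _).
  apply: eq_bigr => i _; rewrite -!exprD /m'; congr (_ ^+ _).
  rewrite -subnDA subnKC //.
  have [->|ne1] := eqVneq i e1; first by rewrite (negbTE e13) addn0; case: (m e1) o1.
  have [->|_] := eqVneq i e3; last by [].
  by case: (m e3) o3.
have not45 i : i \in I -> (i : nat) \notin [:: 4; 5]%N.
  move=> /sub_e; rewrite !inE => /or3P[] /eqP ->.
  - by move: e1E; rewrite !inE => /or4P[] /eqP ->.
  - by move: e2E; rewrite !inE => /or4P[] /eqP ->.
  - by move: e3E; rewrite !inE => /orP[] /eqP ->.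
(* Only even powers of the coordinates in [I] are left in [H], and their squares are free of square
   roots. *)
have rational_H : rational_on M H.
  apply: rational_on_sum => m; case: (boolP (par m)) => [/and3P[ o1 o2 o3]|_]; last first.
    exact: rational_on_const.
  apply: rational_on_mul; first exact: rational_on_const.
  apply: rational_on_prod => i; rewrite /w; case: (boolP (i \in I)) => iI; last first.
    exact: rational_on_const.
  have ev : ~~ odd (m' m i).
    move: (sub_e _ iI); rewrite /m' !inE => /or3P[] /eqP ->.
    - by rewrite eqxx (negbTE e13) subn0 subn1; case: (m e1) o1 => //= n; rewrite negbK.
    - by rewrite eq_sym (negbTE e12) (negbTE e23) !subn0.
    - rewrite eqxx eq_sym (negbTE e13) subn0 subn1.
      by case: (m e3) o3 => //= n; rewrite negbK.
  apply: (rational_on_ext _ (rational_on_exp (m' m i)./2 (rational_sqr (not45 _ iI)))) => s _.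
  by rewrite -exprM mul2n -[in RHS](odd_double_half (m' m i)) (negbTE ev).
have [L [s0 Ls0 Ms0] LE] : exists2 L : {poly R}, exists2 s0, L.[s0] = 0 & M.[s0] != 0 &
    forall s, 0 < s < 1 -> base s e3 = mu s * L.[s].
  move: e3E; rewrite !inE => /orP[] /eqP e3E'.
    exists (lin (t2 m0 m1 m2) (t3 m0 m1 m2)).
      by apply: lin_root gen2; rewrite /t2 /t3 /q4; congr (_ / _); ring.
    by move=> s s01; rewrite baseE e3E' linE /= C2 // S2.
  exists (lin (t4 m0 m1 m2) (t5 m0 m1 m2)).
    by apply: lin_root gen3; rewrite /t4 /t5 /q4; congr (_ / _); ring.
  by move=> s s01; rewrite baseE e3E' linE /= C2 // S2.
(* Cancelling square roots in [base_H] leaves a nonzero constant times [M ^+ n] equal to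
   [L * (k1 * H)]. If [e1] belongs to [a], one factor [mu] cancels and [n = 0]; otherwise [mu ^+ 2]
   remains and [n = 1]. *)
case: (boolP c1) => c1E.
  have [k1 k1E] : exists k1, forall s, base s e1 = k1 * C s.
    move: e1E c1E; rewrite /c1 !inE => /or4P[] /eqP e1E'; rewrite e1E' // => _.
      by exists n1^-1 => s; rewrite baseE e1E' /= mulrC.
    by exists (m1 / n1) => s; rewrite baseE e1E' /= mulrAC.
  apply: (@not_rational_multiple R M L (m2 / n2) 0 (fun s => k1 * H s)).
  - by apply: rational_on_mul => //; exact: rational_on_const.
  - by rewrite mulf_neq0 ?invr_neq0.
  - by exists s0.
  move=> s s01; apply: (mulIf (mulf_neq0 (C_neq0 s01) (mu_neq0 s01))).
  rewrite expr0 mulr1; have := base_H s s01; rewrite k1E LE // {1}/t c1E baseE /= => ->.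
  by ring.
have [k1 k1E] : exists k1, forall s, base s e1 = k1 * (C s * mu s).
  move: e1E c1E; rewrite /c1 !inE => /or4P[] /eqP e1E'; rewrite e1E' // => _.
    by exists (m2 / n2) => s; rewrite baseE e1E'.
  by exists (m1 / n2) => s; rewrite baseE e1E'.
apply: (@not_rational_multiple R M L n1^-1 1 (fun s => k1 * H s)).
- by apply: rational_on_mul => //; exact: rational_on_const.
- by rewrite invr_neq0.
- by exists s0.
move=> s s01; apply: (mulIf (C_neq0 s01)).
have := base_H s s01; rewrite k1E LE // {1}/t (negbTE c1E) baseE /= => E.
rewrite expr1 mulrAC [n1^-1 * C s]mulrC E.
transitivity (mu s ^+ 2 * M.[s] * (k1 * C s * L.[s] * H s)); first by ring.
by rewrite mu2 //; ring.
Qed.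

End Generic.

(* D describes a proper algebraic subset of parameter space; it only occurs in
   the last clause of (i), which holds for generic m, that is, for D(m) != 0. *)
Theorem mainTheorem3 (R : realType) :
  exists2 D : {mpoly R[3]}, D != 0 &
  forall (m0 m1 m2 : R) (Jab Jbc : {pred {mpoly R[4 + 4]}}),
  m0 != 0 -> m1 != 0 -> m2 != 0 -> m2 != 1 -> m2 != -1 -> q5 m0 m1 != 0 ->
  prime_component (I_ab m0 m1 m2)
    (row_mx (a_init m0 m1) (b_init m0 m1 m2)) Jab ->
  prime_component (I_bc m0 m1 m2)
    (row_mx (b_init m0 m1 m2) (c_init m1 m2)) Jbc ->
  let V := bennett_variety m0 m1 m2 in
  let X := solutions m0 m1 m2 Jab Jbc in
  let Y := solutions_by_formulas m0 m1 m2 Jab Jbc in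
  let h := bennett_map m0 m1 m2 in
  let Xplus := X `&` alternative m0 m1 m2 1 in
  let Xminus := X `&` alternative m0 m1 m2 (-1) in
  let Xa := Xplus `&` [set p : conf R | p.1.1 0 0 = 0] in
  let Xc := Xplus `&` [set p : conf R | p.2 0 0 = 0] in
  let gamma := param m0 m1 m2 in
  let gamma' := fun t => flip_c (gamma t) in
  (* (i) *)
  ([/\ forall v, V v -> Y (h v),
       forall v, V v -> constraint_eq m0 m1 m2 (h v),
       forall p, Y p -> V (essential_coords p),
       forall v, V v -> essential_coords (h v) = v &
       forall p, Y p -> h (essential_coords p) = p] /\
   [/\ polynomial_in_on essential Y,
       forall S : {set 'I_12},
         S \proper essential -> ~ polynomial_in_on S Y &
       nonzero_at D m0 m1 m2 ->
       forall S : {set 'I_12}, polynomial_in_on S Y -> (4 <= #|S|)%N]) /\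
  (* (ii) *)
  ([/\ forall a : 'rV[R]_4, rotmx (- a) = rotmx a,
       forall p, X p -> exists2 p', Y p' & sign_class p' p,
       X = Xplus `|` Xminus,
       Xminus = @flip_b R @` Xplus &
       Xplus = Y `|` Xa `|` Xc] /\
   (forall E, E = Xa \/ E = Xc ->
      [/\ (E #= `I_8)%card,
          exists p, E = sign_class p,
          forall p p', E p -> E p' -> same_orientation p p' &
          (E `&` Y #= `I_4)%card])) /\
  (* (iii) *)
  ([/\ forall v, V v -> \rank (poly_jacobian (bennett m0 m1 m2) v) = 3%N,
       range gamma <> range gamma',
       components V = [set range gamma; range gamma'],
       components Y = [set range (h \o gamma); range (h \o gamma')] &
       forall t, same_orientation (h (gamma t)) (h (gamma' t))] /\
   (exists t,
      [/\ cos t = m1 / Num.sqrt (m1 ^+ 2 + 1),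
          sin t = - (1 / Num.sqrt (m1 ^+ 2 + 1)) &
          h (gamma t) = init m0 m1 m2 \/
          h (gamma t) = flip_b (init m0 m1 m2)])).
Proof.
exists (generic_poly R); first exact: generic_poly_neq0.
move=> m0 m1 m2 Jab Jbc m0_neq0 m1_neq0 m2_neq0 m2_neq1 m2_neqN1 q5_neq0 Jab_comp Jbc_comp.
move=> V X Y h Xplus Xminus Xa Xc gamma gamma'.
split; [split; split | split; [split; [split|] | split; [split|]]].
- by move=> v; exact: bennett_map_solution.
- by move=> v; exact: bennett_map_constraint.
- by move=> p; exact: essential_coords_variety.
- by move=> v _; exact: bennett_mapK.
- by move=> p; exact: essential_coordsK.
- exact: polynomial_in_on_essential.
- by move=> S; exact: essential_minimal.
- rewrite /nonzero_at generic_polyE => gen S.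
  exact: generic_lower_bound.
- exact: rotmxN.
- by move=> p; exact: solutions_sign_class.
- exact: solutions_alternatives.
- exact: flip_b_alternative.
- exact: Xplus_cover.
- by move=> E; exact: degenerateP.
- by move=> v; exact: rank_poly_jacobian_bennett.
- exact: range_gamma_neq.
- exact: components_bennett.
- exact: components_solutions_by_formulas.
- by move=> t; exact: gamma_same_orientation.
- exact: gamma_initial.
Qed.
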